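(* Let $T\in(0,\infty)$, let $(\Omega,\mathcal{F},(\mathcal{F}_t)_{t\in[0,T]},\mathbb{P})$ be a filtered probability space satisfying the usual conditions, let $(B_t)_{t\in[0,T]}$ be a standard Brownian motion on it, and let $x_0\colon[0,T]\to\mathbb{R}$ be continuous. Let $K_\mu,K_\sigma\colon\Delta_T\to\mathbb{R}$ be measurable functions. Suppose $K_\mu(s,\cdot)$ is absolutely continuous for every $s\in[0,T]$ with $\partial_2K_\mu\in L^1(\Delta_T)$, $K_\sigma(s,\cdot)$ is absolutely continuous for every $s\in[0,T]$ with $\partial_2K_\sigma\in L^2(\Delta_T)$, and let $\mu,\sigma\colon[0,T]\times\mathbb{R}\to\mathbb{R}$ be measurable functions such that there is $C_{\mu,\sigma}>0$ with $|\mu(t,x)|+|\sigma(t,x)|\le C_{\mu,\sigma}(1+|x|)$ for all $t\in[0,T]$, $x\in\mathbb{R}$. Let $(X_t)_{t\in[0,T]}$ be a solution to the stochastic Volterra equation $$X_t=x_0(t)+\int_0^tK_\mu(s,t)\mu(s,X_s)\,\mathrm{d}s+\int_0^tK_\sigma(s,t)\sigma(s,X_s)\,\mathrm{d}B_s,\quad t\in[0,T],$$ such that $\mathbb{E}[|X_t|^2]\le C$ for all $t\in[0,T]$ and some constant $C$. Then $(X_t-x_0(t))_{t\in[0,T]}$ is a semimartingale with decomposition $X_t-x_0(t)=M_t+A_t$, where $$M_t:=\int_0^tK_\sigma(s,s)\sigma(s,X_s)\,\mathrm{d}B_s$$ and $$A_t:=\int_0^tK_\mu(s,s)\mu(s,X_s)\,\mathrm{d}s+\int_0^t\Big(\int_0^s\partial_2K_\mu(u,s)\mu(u,X_u)\,\mathrm{d}u+\int_0^s\partial_2K_\sigma(u,s)\sigma(u,X_u)\,\mathrm{d}B_u\Big)\,\mathrm{d}s$$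 for $t\in[0,T]$.
   Context: $\Delta_T:=\{(s,t)\in[0,T]\times[0,T]: 0\le s\le t\le T\}$. The $\mathrm{d}s$-integral is a pathwise integral and the $\mathrm{d}B_s$-integral is an Itô integral; the Brownian motion is with respect to $(\mathcal{F}_t)_{t\in[0,T]}$. For measurable $K\colon\Delta_T\to\mathbb{R}$, $K(s,\cdot)$ is absolutely continuous for every $s\in[0,T]$ if there is an integrable function $\partial_2K\colon\Delta_T\to\mathbb{R}$ with $K(s,t)-K(s,s)=\int_s^t\partial_2K(s,u)\,\mathrm{d}u$ for $(s,t)\in\Delta_T$. $K\in L^p(\Delta_T)$ means $\int_0^T\int_0^t|K(s,t)|^p\,\mathrm{d}s\,\mathrm{d}t<\infty$. A solution (strong $L^1$-solution) is an $(\mathcal{F}_t)$-progressively measurable process $(X_t)_{t\in[0,T]}\in L^1(\Omega\times[0,T])$ on the given filtered probability space such that, for all $t\in[0,T]$, $\int_0^t(|K_\mu(s,t)\mu(s,X_s)|+|K_\sigma(s,t)\sigma(s,X_s)|^2)\,\mathrm{d}s<\infty$ and the equation holds $\mathbb{P}$-almost surely. The equality $X_t-x_0(t)=M_t+A_t$ is understood $\mathbb{P}$-a.s. for each $t$, i.e. the semimartingale property is understood up to modification. *)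

(* Defs.v *)
From HB Require Import structures.
From mathcomp Require Import all_boot all_order all_algebra.
From mathcomp Require Import all_classical all_reals all_analysis.

Set Implicit Arguments.
Unset Strict Implicit.
Unset Printing Implicit Defensive.

Import Order.TTheory GRing.Theory Num.Theory.
Import numFieldNormedType.Exports.

Local Open Scope classical_set_scope.
Local Open Scope ring_scope.

(* Processes and kernels on [0, T] are total functions on R; only their values
   at times in [0, T] (resp. on the triangle) are ever constrained or used. *)

Section Kernels.
Context {R : realType}.
Local Notation leb := (@lebesgue_measure R).

Definition triangle (T : R) : set (R * R) :=
  [set p | 0 <= p.1 /\ p.1 <= p.2 /\ p.2 <= T].

Definition measurable_on_triangle (T : R) (K : R -> R -> R) : Prop :=
  measurable_fun (triangle T) (fun p => K p.1 p.2).

(* Integrability of dK s on [s, T] is what makes the integral in the identity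
   meaningful: Rintegral is total. *)
Definition abs_continuous_kernel (T : R) (K dK : R -> R -> R) : Prop :=
  measurable_on_triangle T dK /\
  forall s, 0 <= s <= T ->
    leb.-integrable `[s, T] (fun u => (dK s u)%:E) /\
    forall t, s <= t <= T ->
      K s t - K s s = \int[leb]_(u in `[s, t]) dK s u.

Definition in_Lp_triangle (p : nat) (T : R) (K : R -> R -> R) : Prop :=
  measurable_on_triangle T K /\
  (\int[leb]_(t in `[0%R, T]) \int[leb]_(s in `[0%R, t])
     (`|K s t| ^+ p)%:E < +oo)%E.

Definition cadlag (T : R) (f : R -> R) : Prop :=
  (forall t, 0 <= t < T -> f s @[s --> t^'+] --> f t) /\
  (forall t, 0 < t <= T -> cvg (f s @[s --> t^'-])).

End Kernels.

Section Processes.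
Context {R : realType} {d : measure_display} {Omega : measurableType d}.
Local Notation leb := (@lebesgue_measure R).

Implicit Types (P : probability Omega R) (F : R -> set_system Omega)
  (B X H M A : R -> Omega -> R) (T t : R).

Definition filtration F T : Prop :=
  (forall t, 0 <= t <= T ->
     sigma_algebra [set: Omega] (F t) /\ F t `<=` measurable) /\
  (forall s t, 0 <= s -> s <= t -> t <= T -> F s `<=` F t).

(* [P.-negligible N] does not presuppose that N is measurable, so the last
   clause also says that P is complete. *)
Definition usual_conditions P F T : Prop :=
  [/\ filtration F T,
      forall t, 0 <= t < T -> \bigcap_(s in `]t, T]) F s `<=` F t &
      forall N, P.-negligible N -> F 0 N].

Definition measurable_wrt (G : set_system Omega) (Y : Omega -> R) : Prop :=
  @measurable_fun _ _ (g_sigma_algebraType G) R setT Y.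

Definition adapted F T X : Prop :=
  forall t, 0 <= t <= T -> measurable_wrt (F t) (X t).

Definition progressive F T X : Prop :=
  forall t, 0 <= t <= T ->
    @measurable_fun _ _ (R * g_sigma_algebraType (F t))%type R
      (`[0, t] `*` setT) (fun p => X p.1 p.2).

Definition brownian_motion P F T B : Prop :=
  [/\ adapted F T B,
      {ae P, forall w, B 0 w = 0},
      {ae P, forall w, {within `[0, T], continuous (fun t => B t w)}} &
      forall s t, 0 <= s -> s < t -> t <= T ->
        let incr w := B t w - B s w in
        (forall V : set R, measurable V ->
           P (incr @^-1` V) = normal_prob 0 (Num.sqrt (t - s)) V) /\
        (forall (E : set Omega) (V : set R), F s E -> measurable V ->
           P (E `&` incr @^-1` V) = (P E * P (incr @^-1` V))%E)].

Definition cvg0_in_probability P (Z : nat -> Omega -> \bar R) : Prop :=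
  forall eps : R, 0 < eps ->
    (fun n => P [set w | (eps%:E <= Z n w)%E]) @ \oo --> 0%E.

(* The simple process with value coef i on ]time i, time i.+1], i < size. *)
Record simple_process := SimpleProcess {
  sp_size : nat;
  sp_time : nat -> R;
  sp_coef : nat -> Omega -> R }.

Implicit Types S : simple_process.

Definition is_simple F t S : Prop :=
  [/\ forall i, (i <= sp_size S)%N -> 0 <= sp_time S i <= t,
      forall i, (i < sp_size S)%N -> sp_time S i <= sp_time S i.+1 &
      forall i, (i < sp_size S)%N ->
        measurable_wrt (F (sp_time S i)) (sp_coef S i) /\
        exists c : R, forall w, `|sp_coef S i w| <= c].

Definition sp_val S (s : R) (w : Omega) : R :=
  \sum_(i < sp_size S)
    sp_coef S i w * \1_(`]sp_time S i, sp_time S i.+1]) s.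

Definition sp_integral B S (w : Omega) : R :=
  \sum_(i < sp_size S)
    sp_coef S i w * (B (sp_time S i.+1) w - B (sp_time S i) w).

(* [is_ito_integral P F B H t I]: the random variable I is (a version of) the
   Ito integral of H against B over [0, t]. The integral is only determined up
   to null sets, hence a relation rather than a function. Measurability of H and
   I makes the events in [cvg0_in_probability] measurable. *)
Definition is_ito_integral P F B H t (I : Omega -> R) : Prop :=
  [/\ progressive F t H,
      {ae P, forall w,
        (\int[leb]_(s in `[0%R, t]) ((H s w) ^+ 2)%:E < +oo)%E},
      measurable_wrt (F t) I &
      exists S : nat -> simple_process,
        [/\ forall n, is_simple F t (S n),
            cvg0_in_probability P (fun n w =>
              \int[leb]_(s in `[0%R, t]) ((sp_val (S n) s w - H s w) ^+ 2)%:E)%E &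
            cvg0_in_probability P (fun n w =>
              (`|sp_integral B (S n) w - I w|)%:E)]].

Definition ito_integral_process P F T B H M : Prop :=
  {ae P, forall w, {within `[0, T], continuous (fun t => M t w)}} /\
  forall t, 0 <= t <= T -> is_ito_integral P F B H t (M t).

Definition martingale P F T M : Prop :=
  [/\ adapted F T M,
      forall t, 0 <= t <= T -> P.-integrable setT (fun w => (M t w)%:E) &
      forall s t, 0 <= s -> s <= t -> t <= T -> forall E, F s E ->
        (\int[P]_(w in E) (M t w)%:E = \int[P]_(w in E) (M s w)%:E)%E].

Definition stopping_time F T (tau : Omega -> R) : Prop :=
  (forall w, 0 <= tau w <= T) /\
  (forall t, 0 <= t <= T -> F t [set w | tau w <= t]).

(* On the compact horizon [0, T], localizing sequences are eventually T. *)
Definition local_martingale P F T M : Prop :=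
  [/\ adapted F T M,
      {ae P, forall w, cadlag T (fun t => M t w)} &
      exists tau : nat -> Omega -> R,
        [/\ forall n, stopping_time F T (tau n),
            forall n w, tau n w <= tau n.+1 w,
            {ae P, forall w, exists n, tau n w = T} &
            forall n, martingale P F T
              (fun t w => M (Num.min t (tau n w)) w - M 0 w)]].

Definition finite_variation_process P F T A : Prop :=
  [/\ adapted F T A,
      {ae P, forall w, cadlag T (fun t => A t w)} &
      {ae P, forall w, bounded_variation 0 T (fun t => A t w)}].

(* Z is, up to modification, the semimartingale M + A. *)
Definition semimartingale_decomposition P F T (Z M A : R -> Omega -> R) : Prop :=
  [/\ local_martingale P F T M,
      finite_variation_process P F T A &
      forall t, 0 <= t <= T -> {ae P, forall w, Z t w = M t w + A t w}].

Definition volterra_solution P F T B (x0 : R -> R)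
    (Kmu Ksigma mu sigma : R -> R -> R) X : Prop :=
  [/\ progressive F T X,
      (leb \x P)%E.-integrable (`[0, T] `*` setT) (fun p => (X p.1 p.2)%:E) &
      forall t, 0 <= t <= T ->
        {ae P, forall w, (\int[leb]_(s in `[0%R, t])
           (`|Kmu s t * mu s (X s w)| +
            `|Ksigma s t * sigma s (X s w)| ^+ 2)%:E < +oo)%E} /\
        exists I : Omega -> R,
          is_ito_integral P F B (fun s w => Ksigma s t * sigma s (X s w)) t I /\
          {ae P, forall w,
             X t w = x0 t + \int[leb]_(s in `[0, t]) (Kmu s t * mu s (X s w))
                     + I w}].

(* J is a progressively measurable version of the inner stochastic integral
   s |-> \int_0^s dK(u, s) sigma(u, X_u) dB_u, which for dK in L^2 of the
   triangle is defined for almost every s only. *)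
Definition inner_ito_integral P F T B (dK sigma : R -> R -> R) X
    (J : R -> Omega -> R) : Prop :=
  progressive F T J /\
  {ae leb, forall s, 0 <= s <= T ->
     is_ito_integral P F B (fun u w => dK u s * sigma u (X u w)) s (J s)}.

Definition drift_density (dKmu mu : R -> R -> R) X (J : R -> Omega -> R)
    (s : R) (w : Omega) : R :=
  \int[leb]_(u in `[0, s]) (dKmu u s * mu u (X u w)) + J s w.

Definition drift (Kmu dKmu mu : R -> R -> R) X (J : R -> Omega -> R)
    (t : R) (w : Omega) : R :=
  \int[leb]_(s in `[0, t]) (Kmu s s * mu s (X s w)) +
  \int[leb]_(s in `[0, t]) drift_density dKmu mu X J s w.

(* All the pathwise integrals in [drift] converge absolutely. *)
Definition drift_well_defined P T (Kmu dKmu mu : R -> R -> R) X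
    (J : R -> Omega -> R) : Prop :=
  {ae P, forall w,
    [/\ leb.-integrable `[0, T] (fun s => (Kmu s s * mu s (X s w))%:E),
        {ae leb, forall s, 0 <= s <= T ->
           leb.-integrable `[0, s] (fun u => (dKmu u s * mu u (X u w))%:E)} &
        leb.-integrable `[0, T]
          (fun s => (drift_density dKmu mu X J s w)%:E)]}.

End Processes.

(* Main.v *)
(* Write phi_u = sigma(u, X_u). By absolute continuity of Ksigma(u, .),
     Ksigma(u, t) phi_u = Ksigma(u, u) phi_u + (int_u^t dKsigma(u, s) ds) phi_u,
   and a stochastic Fubini theorem turns the Ito integral of the last term into
   int_0^t J_s ds, where J_s is the Ito integral of dKsigma(., s) phi over [0, s];
   the mu part is treated by the pathwise Fubini theorem.
   Everything about the Ito integral is derived from approximation in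
   probability by simple processes. The basic estimate is Lenglart's inequality,
   obtained for simple integrands by stopping the discrete martingale transform
   on a grid; it yields uniqueness, locality on arbitrary events and, with
   Borel-Cantelli along a dense set of times, a continuous version of the integral.
   Square integrable integrands give martingales because 1_E (M_t - M_s) is the
   integral of 1_E 1_]s, t] H, and locality reduces the general case to
   H 1{int_0^s H^2 <= n}.
   Stochastic Fubini: averaging dKsigma(u, .) over the preceding cell of a grid of
   step T/n makes J a step process built from finitely many Ito integrals, for which
   the exchange is linearity. As E phi^2 is bounded, both sides converge in L^2. *)
Require Import Defs.
From HB Require Import structures.
From mathcomp Require Import all_boot all_order all_algebra.
From mathcomp Require Import all_classical all_reals all_analysis.
From mathcomp Require Import measurable_realfun.
From mathcomp Require Import ring lra.

Set Implicit Arguments.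
Unset Strict Implicit.
Unset Printing Implicit Defensive.

Import Order.TTheory GRing.Theory Num.Theory.
Import numFieldNormedType.Exports.

Local Open Scope classical_set_scope.
Local Open Scope ring_scope.


(** * Measurability and convergence in probability *)

Section sub_sigma_algebras.
Context {d : measure_display} {T : measurableType d}.

(** Nothing is assumed about the size of the kernels on the diagonal, so
    [Ksigma s s * sigma s (X s)] is not known to be square integrable in expectation. It is so along
    almost every path: the definition of a solution at the terminal time gives this for
    [Ksigma s T], and the difference of the two kernels is a primitive of [dKsigma], controlled in
    L2 by the second moment of [X]. Hence the integral has to be built, compared and localized in
    probability; the moment bound on [X] acts only together with the derivatives of the kernels. A
    second obstacle is that the inner stochastic integral is determined, for each time separately,
    up to a null set. A version that is progressive in both variables comes from averaging over
    preceding cells, because the integral attached to a cell is complete when the cell starts. Along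
    a subsequence with summable L2 errors these step processes converge almost surely at almost
    every time. Independence of increments enters through the joint law of a past variable and an
    increment; conditional expectations are replaced by integrals over events of the past. *)

Lemma measurable_id_ambient (G : set_system T) : G `<=` measurable ->
  measurable_fun setT (id : T -> g_sigma_algebraType G).
Proof.
move=> GM _ Y mY; rewrite setTI.
exact: (smallest_sub (@sigma_algebra_measurable _ T) GM mY).
Qed.

Lemma measurable_id_sub (G G' : set_system T) : G `<=` G' ->
  measurable_fun setT (id : g_sigma_algebraType G' -> g_sigma_algebraType G).
Proof.
move=> GG' _ Y mY; rewrite setTI.
exact: (sub_smallest2r (@smallest_sigma_algebra _ setT G') GG' mY).
Qed.

End sub_sigma_algebras.

Section parametrized_integral.
Context {d : measure_display} {T : measurableType d} {R : realType}.
Local Notation leb := (@lebesgue_measure R).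
Local Open Scope ereal_scope.

(** No sign or integrability is required: the integral is by definition the difference of the
    integrals of the positive and negative parts, and Tonelli's measurability statement applies to
    each. *)
Lemma measurable_integral_section (D : set R) (f : R -> T -> \bar R) :
  measurable D ->
  measurable_fun (D `*` [set: T]) (fun p : R * T => f p.1 p.2) ->
  measurable_fun setT (fun w => \int[leb]_(s in D) f s w).
Proof.
move=> mD mf.
pose g : R * T -> \bar R := (fun p => f p.1 p.2) \_ (D `*` setT).
have mDT : measurable (D `*` [set: T]) by exact: measurableX.
have mg : measurable_fun setT g by apply/(measurable_restrictT _ _).1.
have gE s w : g (s, w) = ((f ^~ w) \_ D) s.
  rewrite /g /patch; case: ifPn => [/set_mem[/= Ds _]|nDs]; first by rewrite mem_set.
  by rewrite memNset// => Ds; move/negP: nDs; apply; apply/mem_set; split.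
have E w : \int[leb]_(s in D) f s w =
    \int[leb]_s g^\+ (s, w) - \int[leb]_s g^\- (s, w).
  rewrite integral_mkcond integralE.
  by congr (_ - _); apply: eq_integral => s _; rewrite ?funeposE ?funenegE gE.
rewrite (funext E); apply: emeasurable_funB.
- have := @measurable_fun_fubini_tonelli_G _ _ _ T R leb g^\+.
  apply; [exact: measurable_funepos|by move=> x; exact: funepos_ge0].
- have := @measurable_fun_fubini_tonelli_G _ _ _ T R leb g^\-.
  apply; [exact: measurable_funeneg|by move=> x; exact: funeneg_ge0].
Qed.

End parametrized_integral.

Section convergence_in_probability.
Context {R : realType} {d : measure_display} {Omega : measurableType d}.
Variable P : probability Omega R.
Local Open Scope ereal_scope.
Implicit Types Z : nat -> Omega -> \bar R.

(** The bound also forces a tail of [u] to be finite, so infinite values at the first indices do no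
    harm. *)
Lemma cvge0_leP (u : nat -> \bar R) : (forall n, 0 <= u n) ->
  u @ \oo --> 0 <->
  (forall e : R, (0 < e)%R -> exists N, forall n, (N <= n)%N -> u n <= e%:E).
Proof.
move=> u0; split=> [cu e e0|h].
- have /fine_cvgP[[N1 _ fN] /cvgrPdist_le /(_ _ e0)[N2 _ dN]] := cu.
  exists (maxn N1 N2) => n; rewrite geq_max => /andP[n1 n2].
  rewrite -(fineK (fN _ n1)) lee_fin.
  have := dN _ n2; rewrite /= sub0r normrN; apply: le_trans.
  exact: ler_norm.
- have fu : \forall n \near \oo, u n \is a fin_num.
    have [N hN] := h 1%R ltr01; exists N => // n /= /hN uN.
    by rewrite ge0_fin_numE// (le_lt_trans uN)// ltry.
  apply/fine_cvgP; split => //; apply/cvgrPdist_le => e e0.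
  have [N hN] := h e e0; near=> n.
  rewrite /= sub0r normrN ger0_norm ?fine_ge0// -lee_fin fineK; last first.
    by near: n.
  by apply: hN; near: n; exists N.
Unshelve. all: by end_near. Qed.

Lemma le_measure_ae (A B : set Omega) : measurable A -> measurable B ->
  {ae P, forall w, A w -> B w} -> P A <= P B.
Proof.
move=> mA mB [N [mN N0 hN]].
apply: (@le_trans _ _ (P (B `|` N))).
  rewrite le_measure ?inE//; first exact: measurableU.
  move=> w Aw; have [Nw|Nw] := pselect (N w); first by right.
  by left; apply: contrapT => nB; apply: Nw; apply: hN => /= h; apply: nB; exact: h.
by rewrite (le_trans (measureU2 _ mB mN))//= N0 adde0.
Qed.

Lemma markov_ereal (Z : Omega -> \bar R) (e : R) : (0 < e)%R ->
  measurable_fun setT Z -> (forall w, 0 <= Z w) ->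
  e%:E * P [set w | e%:E <= Z w] <= \int[P]_w Z w.
Proof.
move=> e0 mZ Z0.
have mA : measurable [set w | e%:E <= Z w].
  by rewrite -[X in measurable X]setTI; exact: emeasurable_fun_c_infty.
rewrite -integral_cst//.
apply: (@le_trans _ _ (\int[P]_(w in [set w | e%:E <= Z w]) Z w)).
  by apply: ge0_le_integral => //; [move=> ? _; rewrite lee_fin ltW|
     exact: measurable_funTS].
by apply: ge0_subset_integral => //; exact: measurable_funTS.
Qed.

Lemma measurable_ge_event (Z : Omega -> \bar R) (y : \bar R) :
  measurable_fun setT Z -> measurable [set w | y <= Z w].
Proof.
by move=> mZ; rewrite -[X in measurable X]setTI; exact: emeasurable_fun_c_infty.
Qed.

(** Dominated convergence for the indicators of the exceptional events, which are bounded by 1 and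
    vanish eventually on almost every path. *)
Lemma cvg0_prob_ae Z : (forall n, measurable_fun setT (Z n)) ->
  {ae P, forall w, Z ^~ w @ \oo --> 0} -> cvg0_in_probability P Z.
Proof.
move=> mZ hZ eps eps0.
pose A n := [set w | eps%:E <= Z n w].
have mA n : measurable (A n) by exact: measurable_ge_event.
rewrite (_ : (fun n => P _) = (fun n => \int[P]_w (\1_(A n) w)%:E)); last first.
  by apply/funext => n; rewrite integral_indic// setIT.
rewrite -[X in _ --> X](integral0 P setT).
have [] := @dominated_convergence _ Omega R P setT measurableT
  (fun n w => (\1_(A n) w)%:E) (cst 0) (cst 1).
- by move=> n; apply/measurable_EFinP; exact: measurable_indic.
- exact: measurable_cst.
- apply: filterS hZ => w cw _.
  have /fine_cvgP[_ /cvgrPdist_lt /(_ _ eps0)] := cw.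
  have /fine_cvgP[fw _] := cw.
  move=> lw; apply: cvg_near_cst; near=> n.
  rewrite /= indicE memNset//; apply/negP; rewrite -ltNge.
  have fn : Z n w \is a fin_num by near: n.
  rewrite -(fineK fn) lte_fin.
  have : (`|0 - fine (Z n w)| < eps)%R by near: n.
  by rewrite sub0r normrN; apply: le_lt_trans; exact: ler_norm.
- exact: finite_measure_integrable_cst.
- by apply: aeW => w n _; rewrite gee0_abs ?lee_fin// indicE; case: (_ \in _).
- by move=> _ _; apply.
Unshelve. all: by end_near. Qed.

Lemma cvg0_prob_le2 Z Z1 Z2 (c : R) : (0 < c)%R ->
  (forall n, measurable_fun setT (Z n)) ->
  (forall n, measurable_fun setT (Z1 n)) ->
  (forall n, measurable_fun setT (Z2 n)) ->
  (forall n, {ae P, forall w, Z n w <= c%:E * (Z1 n w + Z2 n w)}) ->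
  cvg0_in_probability P Z1 -> cvg0_in_probability P Z2 ->
  cvg0_in_probability P Z.
Proof.
move=> c0 mZ mZ1 mZ2 hZ h1 h2 eps eps0.
(* Half of [eps / c] for each of the two bounds: off both events their sum stays below [eps / c]. *)
pose dl := (eps / (c *+ 2))%R.
have dl0 : (0 < dl)%R by rewrite divr_gt0// pmulrn_lgt0.
have mA1 n : measurable [set w | dl%:E <= Z1 n w] by exact: measurable_ge_event.
have mA2 n : measurable [set w | dl%:E <= Z2 n w] by exact: measurable_ge_event.
have mA n : measurable [set w | eps%:E <= Z n w] by exact: measurable_ge_event.
apply: (@squeeze_cvge _ _ _ _ (cst 0) _ (fun n => P [set w | dl%:E <= Z1 n w]
   + P [set w | dl%:E <= Z2 n w])); last 2 first.
- exact: cvg_cst.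
- by rewrite -[X in _ --> X](adde0 0); apply: cvgeD => //; [exact: h1|exact: h2].
apply: nearW => n; rewrite measure_ge0/=.
apply: (@le_trans _ _ (P ([set w | dl%:E <= Z1 n w] `|`
  [set w | dl%:E <= Z2 n w]))); last exact: measureU2.
apply: le_measure_ae => //; first exact: measurableU.
apply: filterS (hZ n) => w hw /= epsw.
apply: contrapT => /not_orP[/negP + /negP]; rewrite -!ltNge => l1 l2.
suff : Z n w < eps%:E by rewrite ltNge epsw.
apply: (le_lt_trans hw); rewrite -lte_pdivlMl//.
rewrite -EFinM (_ : c^-1 * eps = dl + dl)%R; last first.
  by rewrite /dl; field; rewrite gt_eqF.
by rewrite EFinD lteD.
Qed.

End convergence_in_probability.

Lemma measurable_patchR (R : realType) (g : measurableTypeR R -> \bar R) (I : set R) :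
  measurable_fun setT g -> measurable I -> measurable_fun setT (g \_ I).
Proof.
move=> mg mI.
have mi : measurable (I : set (measurableTypeR R)) by exact: mI.
have h : measurable_fun (I : set (measurableTypeR R)) g.
  exact: (measurable_funS measurableT (@subsetT _ _) mg).
exact/(measurable_restrictT g mi).
Qed.

(** * Gaussian moments and independence of increments *)

Section normal_moments.
Context {R : realType}.
Local Notation leb := (@lebesgue_measure R).
Variable s : R.
Hypothesis s0 : s != 0.
Local Notation p := (normal_pdf 0 s).
Local Notation N := (normal_prob 0 s).

Let is_derive_pdf (x : R) : is_derive x 1 p (- (x / s ^+ 2) * p x).
Proof.
rewrite normal_pdfE// /normal_fun.
have -> : (fun x0 : R => normal_peak s * expR (- (x0 - 0) ^+ 2 / (s ^+ 2 *+ 2))) =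
  (fun x0 : R => normal_peak s * (expR \o (fun y => - (s ^+ 2 *+ 2)^-1 * (y * y))) x0).
  by apply/funext => y /=; congr (_ * expR _); rewrite subr0; ring.
apply: is_derive_eq.
rewrite /= !scaler1 /GRing.scale /=.
rewrite (_ : - (x - 0) ^+ 2 / (s ^+ 2 *+ 2) = - (s ^+ 2 *+ 2)^-1 * (x * x)); last first.
  by rewrite subr0; ring.
by field.
Qed.

Let continuous_pdf : continuous p.
Proof. exact: continuous_normal_pdf. Qed.

(** Integration by parts, written as explicit primitives: since [p' = - (x / s ^+ 2) * p], [G]
    serves for the first moment and [H] for the second. *)
Let G x := - s ^+ 2 * p x.
Let H x := - s ^+ 2 * (x * p x).

Let is_derive_G (x : R) : is_derive x 1 G (x * p x).
Proof.
rewrite /G; have dx := is_derive_pdf x; apply: is_derive_eq.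
by rewrite /GRing.scale /=; field.
Qed.

Let is_derive_H (x : R) : is_derive x 1 H (x ^+ 2 * p x - s ^+ 2 * p x).
Proof.
rewrite /H; have dx := is_derive_pdf x; apply: is_derive_eq.
by rewrite /GRing.scale /=; field.
Qed.

Let FTC (f F : R -> R) (a : R) : 0 < a -> continuous f ->
  (forall x : R, is_derive x (1 : R) (F : R -> R^o) (f x)) ->
  (\int[leb]_(x in `[(- a)%R, a]) (f x)%:E = (F a - F (- a))%R%:E)%E.
Proof.
move=> a0 cf dF.
have cF : continuous F.
  by move=> x; apply/differentiable_continuous/derivable1_diffP; have [] := dF x.
rewrite (continuous_FTC2 (F := F)) ?EFinB//; first by rewrite gtrN.
- by apply: continuous_subspaceT.
- split; [by move=> x _; have [] := dF x|exact/cvg_at_right_filter/cF|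
    exact/cvg_at_left_filter/cF].
- by move=> x _; rewrite derive1E; have [] := dF x.
Qed.

Let pdfN x : p (- x) = p x.
Proof. by rewrite normal_pdfE// /normal_fun !subr0 sqrrN. Qed.

Let continuous_xp : continuous (fun x : R => x * p x).
Proof. by move=> x; apply: cvgM; [exact: cvg_id|exact: continuous_pdf]. Qed.

Let continuous_xxp : continuous (fun x : R => x ^+ 2 * p x).
Proof.
move=> x; apply: cvgM; last exact: continuous_pdf.
by apply: exprn_continuous.
Qed.

Let integral_xp a : 0 < a -> (\int[leb]_(x in `[(- a)%R, a]) (x * p x)%:E = 0)%E.
Proof. by move=> a0; rewrite (FTC a0 continuous_xp is_derive_G) /G pdfN subrr. Qed.

Let integrable_continuous (f : R -> R) a : continuous f ->
  leb.-integrable `[- a, a] (EFin \o f).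
Proof.
move=> cf; apply: continuous_compact_integrable; first exact: segment_compact.
exact: continuous_subspaceT.
Qed.

(** The boundary term [H a - H (- a)] is nonpositive, so the inequality holds on every bounded
    interval and no boundary limit has to be computed. *)
Let integral_xxp_le a : 0 < a ->
  (\int[leb]_(x in `[(- a)%R, a]) (x ^+ 2 * p x)%:E <= (s ^+ 2)%:E)%E.
Proof.
move=> a0.
have cp : continuous (fun x : R => s ^+ 2 * p x).
  by move=> x; apply: cvgMl_tmp; exact: continuous_pdf.
have cd : continuous (fun x : R => x ^+ 2 * p x - s ^+ 2 * p x).
  by move=> x; apply: cvgB; [exact: continuous_xxp|exact: cp].
have := FTC a0 cd is_derive_H.
under eq_integral do rewrite EFinB.
rewrite integralB//=; last 2 first.
  exact: (integrable_continuous _ continuous_xxp).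
  exact: (integrable_continuous _ cp).
have : (\int[leb]_(x in `[(- a)%R, a]) (s ^+ 2 * p x)%:E <= (s ^+ 2)%:E)%E.
  under eq_integral do rewrite EFinM.
  rewrite integralZl//=; last exact: (integrable_continuous _ continuous_pdf).
  rewrite -[leRHS]mule1 lee_pmul//; first by rewrite lee_fin sqr_ge0.
    by apply: integral_ge0 => x _; rewrite lee_fin normal_pdf_ge0.
  rewrite -(integral_normal_pdf 0 s); apply: ge0_subset_integral => //.
    by apply/measurable_EFinP; exact: measurable_normal_pdf.
  by move=> x _; rewrite lee_fin normal_pdf_ge0.
have : (\int[leb]_(x in `[(- a)%R, a]) (s ^+ 2 * p x)%:E)%E \is a fin_num.
  exact: integrable_fin_num (integrable_continuous _ cp).
have : (\int[leb]_(x in `[(- a)%R, a]) (x ^+ 2 * p x)%:E)%E \is a fin_num.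
  exact: integrable_fin_num (integrable_continuous _ continuous_xxp).
move=> /fineK <- /fineK <-; rewrite -EFinB !lee_fin => h [].
have : H a - H (- a) <= 0.
  rewrite /H pdfN (_ : _ - _ = - (2 * s ^+ 2 * (a * p a))); last by ring.
  rewrite oppr_le0; have := normal_pdf_ge0 0 s a; have := sqr_ge0 s; move: (p a) (s ^+ 2) => u v v0 u0.
  by rewrite mulr_ge0 ?mulr_ge0// ltW.
by move: h; set u := fine _; set v := fine _; move=> *; lra.
Qed.

Let itvn (n : nat) : set R := `[(- n.+1%:R)%R, n.+1%:R].

Let bigcup_itvn : \bigcup_n itvn n = setT.
Proof.
apply/seteqP; split => // x _; exists (Num.truncn `|x|) => //=.
rewrite /itvn /= in_itv/= -ler_norml.
by have := Num.Theory.truncnS_gt `|x|; exact: ltW.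
Qed.

Let nd_itvn : nondecreasing_seq itvn.
Proof.
move=> m n mn; apply/subsetPset => x; rewrite /itvn /= !in_itv/= -!ler_norml.
by move/le_trans; apply; rewrite ler_nat.
Qed.

Let integral_xxpT_le : (\int[leb]_x (x ^+ 2 * p x)%:E <= (s ^+ 2)%:E)%E.
Proof.
have mf : measurable_fun setT (fun x : measurableTypeR R => (x ^+ 2 * p x)%:E).
  apply/measurable_EFinP; exact: continuous_measurable_fun continuous_xxp.
have f0 (x : measurableTypeR R) : (0 <= (x ^+ 2 * p x)%:E)%E.
  by rewrite lee_fin mulr_ge0 ?sqr_ge0 ?normal_pdf_ge0.
have mitv n : measurable (itvn n) by exact: measurable_itv.
have h : ((\int[leb]_(x in itvn n) (x ^+ 2 * p x)%:E)%E @[n --> \oo]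
   --> (\int[leb]_(x in \bigcup_n itvn n) (x ^+ 2 * p x)%:E)%E).
  apply: ge0_nondecreasing_set_cvg_integral => //.
  by move=> n; exact: measurable_funTS.
rewrite -bigcup_itvn -(cvg_lim _ h)//; apply: lime_le.
  by apply/cvg_ex; eexists; exact: h.
by apply: nearW => n; apply: integral_xxp_le; rewrite ltr0n.
Qed.

Import HBNNSimple.

Let integral_normal_nnsfun (f : {nnsfun measurableTypeR R >-> R}) :
  (\int[N]_x (f x)%:E = \int[leb]_x ((f x)%:E * (p x)%:E))%E.
Proof.
have mp : measurable_fun setT (fun x => (p x)%:E).
  by apply/measurable_EFinP; exact: measurable_normal_pdf.
have p0 x : (0 <= (p x)%:E)%E by rewrite lee_fin normal_pdf_ge0.
under [LHS]eq_integral do rewrite fimfunE -fsumEFin//.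
rewrite [LHS]ge0_integral_fsum//; last 2 first.
  - by move=> r; exact/measurable_EFinP/measurableT_comp.
  - by move=> n x _; rewrite EFinM nnfun_muleindic_ge0.
under [RHS]eq_integral.
  move=> x xD; rewrite fimfunE -fsumEFin// muleC ge0_mule_fsumr; last first.
    by move=> r; rewrite EFinM nnfun_muleindic_ge0.
  over.
rewrite [RHS]ge0_integral_fsum//; last 2 first.
  - move=> r; apply: emeasurable_funM => //.
    by apply/measurable_EFinP; apply/measurableT_comp => //.
  - by move=> n x _; rewrite EFinM mule_ge0// nnfun_muleindic_ge0.
apply: eq_fsbigr => r _.
have mr : measurable (f @^-1` [set r]) by [].
have [r0|r0] := ltP r 0.
  rewrite (_ : f @^-1` [set r] = set0); last first.
    apply/seteqP; split => // x /= fxr; have : 0 <= f x by [].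
    by rewrite fxr leNgt r0.
  by rewrite !integral0_eq// => x _; rewrite indicE in_set0 mulr0// mule0.
under [LHS]eq_integral do rewrite EFinM.
rewrite ge0_integralZl//; last first.
  by apply/measurable_EFinP; exact: measurable_indic.
rewrite integral_indic// setIT /normal_prob.
rewrite -ge0_integralZl//; last exact: measurable_funTS.
rewrite integral_mkcond; apply: eq_integral => x _.
rewrite patchE indicE; case: ifPn => _; last by rewrite mulr0 mule0.
by rewrite mulr1 muleC.
Qed.

(** Integration against the density, extended from simple functions by monotone convergence. *)
Lemma ge0_integral_normal (f : measurableTypeR R -> \bar R) : measurable_fun setT f ->
  (forall x, 0 <= f x)%E ->
  (\int[N]_x f x = \int[leb]_x (f x * (p x)%:E))%E.
Proof.
move=> mf f0; pose f_ := nnsfun_approx measurableT mf.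
have mp : measurable_fun setT (fun x => (p x)%:E).
  by apply/measurable_EFinP; exact: measurable_normal_pdf.
have p0 x : (0 <= (p x)%:E)%E by rewrite lee_fin normal_pdf_ge0.
transitivity (lim (\int[N]_x (f_ n x)%:E @[n --> \oo])%E).
  rewrite -monotone_convergence//=.
  - apply: eq_integral => ? /[!inE] xD; apply/esym/cvg_lim => //=.
    exact: cvg_nnsfun_approx.
  - by move=> n; exact/measurable_EFinP/measurable_funTS.
  - by move=> n ? _; rewrite lee_fin.
  - by move=> ? _ ? ? mn; rewrite lee_fin; exact/lefP/nd_nnsfun_approx.
transitivity (lim (\int[leb]_x ((f_ n x)%:E * (p x)%:E) @[n --> \oo])%E).
  by apply: congr_lim; apply/funext => n /=; exact: integral_normal_nnsfun.
rewrite -monotone_convergence//=.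
- apply: eq_integral => x /[!inE] xD; apply/cvg_lim => //=.
  apply: cvgeMr => //; exact: cvg_nnsfun_approx.
- move=> n; apply: emeasurable_funM => //; exact/measurable_EFinP/measurable_funTS.
- by move=> n ? _; rewrite mule_ge0// lee_fin.
- move=> ? _ ? ? mn; rewrite lee_wpmul2r// lee_fin; exact/lefP/nd_nnsfun_approx.
Qed.

Lemma integral_normal_sqr_le : (\int[N]_x (x ^+ 2)%:E <= (s ^+ 2)%:E)%E.
Proof.
have mf : measurable_fun setT (fun x : measurableTypeR R => (x ^+ 2)%:E).
  by apply/measurable_EFinP; exact: measurable_funX.
rewrite ge0_integral_normal//; last by move=> x; rewrite lee_fin sqr_ge0.
Qed.

Let abs_le (x : R) : `|x| <= 1 + x ^+ 2.
Proof. by case: (ger0P x); nra. Qed.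

Lemma integrable_normal_id : N.-integrable setT (fun x : R => x%:E).
Proof.
apply/integrableP; split; first exact/measurable_EFinP.
apply: (@le_lt_trans _ _ (\int[N]_x (1 + (x ^+ 2)%:E))%E).
  apply: ge0_le_integral => //=.
  - by apply: measurableT_comp => //; exact/measurable_EFinP.
  - apply: emeasurable_funD => //; apply/measurable_EFinP; exact: measurable_funX.
  - by move=> x _; rewrite -EFinD lee_fin abs_le.
rewrite ge0_integralD//; last 2 first.
  - by move=> x _; rewrite lee_fin sqr_ge0.
  - by apply/measurable_EFinP; exact: measurable_funX.
rewrite integral_cst// mul1e lte_add_pinfty//.
  by rewrite (le_lt_trans (probability_le1 _ _))// ltry.
exact: le_lt_trans integral_normal_sqr_le (ltry _).
Qed.

(** [G] is even, so the integral over each symmetric interval vanishes. Dominated convergence then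
    reaches the whole line; the dominating function is integrable by the second moment bound. *)
Lemma integral_normal_id : (\int[N]_x x%:E = 0)%E.
Proof.
have mx : measurable_fun setT (fun x : R => x%:E) by exact/measurable_EFinP.
have E : (\int[N]_x x%:E = \int[leb]_x (x * p x)%:E)%E.
  rewrite integralE [RHS]integralE; congr (_ - _)%E.
    rewrite ge0_integral_normal//; last exact: measurable_funepos.
    apply: eq_integral => x _; rewrite !funeposE /= -!EFin_max -EFinM.
    by rewrite maxr_pMl ?normal_pdf_ge0// mul0r.
  rewrite ge0_integral_normal//; last exact: measurable_funeneg.
  apply: eq_integral => x _; rewrite !funenegE.
  change (Order.max (- (x : R))%:E 0 * (p x)%:E = Order.max (- ((x : R) * p x))%:E 0)%E.
  by rewrite -!EFin_max -EFinM maxr_pMl ?normal_pdf_ge0// mul0r mulNr.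
have mxp : measurable_fun setT (fun x : measurableTypeR R => ((x : R) * p x)%:E).
  by apply/measurable_EFinP; exact: continuous_measurable_fun continuous_xp.
have ixp : leb.-integrable setT (fun x : measurableTypeR R => ((x : R) * p x)%:E).
  have /integrableP[_ fin] := integrable_normal_id.
  apply/integrableP; split => //; move: fin; rewrite ge0_integral_normal//; last first.
    exact: measurableT_comp.
  congr (_ < _)%E; apply: eq_integral => x _.
  by rewrite /= normrM EFinM (ger0_norm (normal_pdf_ge0 _ _ _)).
rewrite E.
have mitv n : measurable (itvn n) by exact: measurable_itv.
have [] := @dominated_convergence _ (measurableTypeR R) R leb setT measurableT
  (fun n => (fun x : measurableTypeR R => ((x : R) * p x)%:E) \_ (itvn n)) (fun x : measurableTypeR R => ((x : R) * p x)%:E)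
  (fun x : measurableTypeR R => `|((x : R) * p x)%:E|%E).
- by move=> n; exact: measurable_patchR.
- by [].
- apply: aeW => x _; apply: cvg_near_cst.
  have : (\bigcup_n itvn n) x by rewrite bigcup_itvn.
  move=> [n0 _ xn0]; exists n0 => // n /= n0n; rewrite patchE mem_set//.
  by have /subsetPset := nd_itvn n0n; apply.
- exact: integrable_abse.
- by apply: aeW => x n _; rewrite patchE; case: ifPn => // _; rewrite abse0.
move=> _ _ c.
have : [sequence (\int[leb]_x ((fun x : measurableTypeR R => ((x : R) * p x)%:E) \_ (itvn n)) x)%E]_n
   = cst 0%E.
  apply/funext => n /=; rewrite -integral_mkcond integral_xp//.
move=> e; move: c; rewrite e => /cvg_lim <-//.
by apply/cvg_lim => //; exact: cvg_cst.
Qed.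

End normal_moments.

Section independent_normal_factor.
Context {R : realType} {d : measure_display} {Omega : measurableType d}.
Variable P : probability Omega R.
Local Notation TR := (measurableTypeR R).
Variables (xi D : Omega -> R) (s : R).
Hypotheses (mxi : @measurable_fun _ _ Omega TR setT xi)
  (mD : @measurable_fun _ _ Omega TR setT D) (s0 : s != 0).
Hypothesis indep : forall U V : set TR, measurable U -> measurable V ->
  P (xi @^-1` U `&` D @^-1` V) = (P (xi @^-1` U) * normal_prob 0 s V)%E.
Local Open Scope ereal_scope.

Let X : {mfun Omega >-> TR} := @mfun_Sub _ _ Omega TR xi (mem_set mxi).
Let XD : {mfun Omega >-> (TR * TR)%type} :=
  @mfun_Sub _ _ Omega (TR * TR)%type (fun w => (xi w, D w))
    (mem_set (measurable_fun_pair mxi mD)).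

(** Independence turned into an identity of laws on the plane: a product measure is determined by
    its values on rectangles. *)
Let law_pair (A : set (TR * TR)) : measurable A ->
  (distribution P X \x normal_prob 0 s)%E A = distribution P XD A.
Proof.
move=> mA; apply: product_measure_unique => // U V mU mV.
Qed.

Let ge0_expectation_pair (f : TR * TR -> \bar R) : measurable_fun setT f ->
  (forall x, 0 <= f x) ->
  \int[P]_w f (xi w, D w) =
  \int[distribution P X]_x \int[normal_prob 0 s]_y f (x, y).
Proof.
move=> mf f0.
transitivity (\int[distribution P XD]_z f z).
  by rewrite ge0_integral_distribution.
transitivity (\int[(distribution P X \x normal_prob 0 s)%E]_z f z).
  apply: eq_measure_integral => A mA _; exact/esym/law_pair.
exact: fubini_tonelli1.
Qed.

Hypothesis xi2 : \int[P]_w ((xi w) ^+ 2)%:E < +oo.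

Lemma expectation_sqrM_normal_le :
  \int[P]_w ((xi w * D w) ^+ 2)%:E <= (s ^+ 2)%:E * \int[P]_w ((xi w) ^+ 2)%:E.
Proof.
have m2 : measurable_fun setT (fun x : TR => ((x : R) ^+ 2)%:E).
  by apply/measurable_EFinP; exact: measurable_funX.
rewrite (ge0_expectation_pair (f := fun z => (((z.1 : R) * (z.2 : R)) ^+ 2)%:E)); last 2 first.
- apply/measurable_EFinP; apply: measurable_funX; apply: measurable_funM.
    exact: measurable_fst.
  exact: measurable_snd.
- by move=> z; rewrite lee_fin sqr_ge0.
have -> : \int[P]_w ((xi w) ^+ 2)%:E = \int[distribution P X]_x ((x : R) ^+ 2)%:E.
  by rewrite ge0_integral_distribution// => x; rewrite lee_fin sqr_ge0.
rewrite -ge0_integralZl//; last 2 first.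
  by move=> x _; rewrite lee_fin sqr_ge0.
  by rewrite lee_fin sqr_ge0.
apply: ge0_le_integral => //.
- by move=> x _; apply: integral_ge0 => y _; rewrite lee_fin sqr_ge0.
- apply: (@measurable_fun_fubini_tonelli_F _ _ TR TR R (normal_prob 0 s)
    (fun z => (((z.1 : R) * (z.2 : R)) ^+ 2)%:E)).
  + apply/measurable_EFinP; apply: measurable_funX; apply: measurable_funM.
      exact: measurable_fst.
    exact: measurable_snd.
  + by move=> z; rewrite lee_fin sqr_ge0.
- by apply: emeasurable_funM.
move=> x _ /=; under eq_integral do rewrite exprMn EFinM.
rewrite ge0_integralZl//; last 2 first.
  by move=> y _; rewrite lee_fin sqr_ge0.
  by rewrite lee_fin sqr_ge0.
rewrite muleC lee_wpmul2r ?lee_fin ?sqr_ge0//.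
exact: integral_normal_sqr_le.
Qed.

Lemma integrableM_normal :
  P.-integrable setT (fun w => (xi w * D w)%:E).
Proof.
have mM : measurable_fun setT (fun w => xi w * D w)%R by exact: measurable_funM.
apply/integrableP; split; first exact/measurable_EFinP.
apply: (@le_lt_trans _ _ (\int[P]_w (1 + ((xi w * D w) ^+ 2)%:E))).
  apply: ge0_le_integral => //=.
  - by apply/measurable_EFinP; exact: measurableT_comp.
  - by apply: emeasurable_funD => //; apply/measurable_EFinP; exact: measurable_funX.
  - move=> w _; rewrite -EFinD lee_fin; set a := (_ * _)%R.
    by case: (ger0P a); nra.
rewrite ge0_integralD//; last 2 first.
  - by move=> x _; rewrite lee_fin sqr_ge0.
  - by apply/measurable_EFinP; exact: measurable_funX.
rewrite integral_cst// mul1e lte_add_pinfty//.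
  by rewrite (le_lt_trans (probability_le1 _ _))// ltry.
apply: le_lt_trans expectation_sqrM_normal_le _.
by rewrite lte_mul_pinfty// lee_fin sqr_ge0.
Qed.

(** Fubini under the product law: the inner integral is a constant times the mean of a centred
    normal variable. Integrability comes from the second moments. *)
Lemma expectationM_normal : \int[P]_w (xi w * D w)%:E = 0.
Proof.
pose f (z : TR * TR) := ((z.1 : R) * (z.2 : R))%:E.
have mf : measurable_fun setT f.
  apply/measurable_EFinP; apply: measurable_funM.
    exact: measurable_fst.
  exact: measurable_snd.
have fXD : P.-integrable setT (f \o XD) by exact: integrableM_normal.
transitivity (\int[distribution P XD]_z f z).
  by rewrite integral_distribution.
transitivity (\int[(distribution P X \x normal_prob 0 s)%E]_z f z).
  apply: eq_measure_integral => A mA _; exact/esym/law_pair.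
have fi : (distribution P X \x normal_prob 0 s)%E.-integrable setT f.
  apply/integrableP; split => //.
  rewrite (eq_measure_integral (distribution P XD)); last first.
    by move=> A mA _; exact/law_pair.
  rewrite ge0_integral_distribution//; last exact: measurableT_comp.
  by have /integrableP[_] := fXD.
rewrite -integral12_prod_meas1// integral0_eq// => x _.
rewrite /fubini_F /f /=; under eq_integral do rewrite EFinM.
by rewrite integralZl//= ?integral_normal_id ?mule0//; exact: integrable_normal_id.
Qed.

End independent_normal_factor.

Section filtered_space.
Context {R : realType} {d : measure_display} {Omega : measurableType d}.
Variables (P : probability Omega R) (T : R) (F : R -> set_system Omega).
Hypothesis usual : usual_conditions P F T.

Lemma filtration_measurable t : 0 <= t <= T -> F t `<=` measurable.
Proof. by case: usual => -[h _] _ _ /h[]. Qed.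

Lemma filtration_sigma t : 0 <= t <= T -> sigma_algebra setT (F t).
Proof. by case: usual => -[h _] _ _ /h[]. Qed.

Lemma filtration_le s t : 0 <= s -> s <= t -> t <= T -> F s `<=` F t.
Proof. by case: usual => -[_ h] _ _; exact: h. Qed.

Lemma measurable_wrt_ambient t (Y : Omega -> R) : 0 <= t <= T ->
  measurable_wrt (F t) Y -> measurable_fun setT Y.
Proof.
move=> t0T mY; apply: (measurableT_comp mY).
exact/measurable_id_ambient/filtration_measurable.
Qed.

Lemma measurable_wrt_le s t (Y : Omega -> R) : 0 <= s -> s <= t -> t <= T ->
  measurable_wrt (F s) Y -> measurable_wrt (F t) Y.
Proof.
move=> s0 st tT mY; apply: (measurableT_comp mY).
by apply: measurable_id_sub; exact: filtration_le.
Qed.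

Lemma measurable_wrt_event t (Y : Omega -> R) (V : set R) : 0 <= t <= T ->
  measurable_wrt (F t) Y -> measurable V -> F t (Y @^-1` V).
Proof.
move=> t0T mY mV; rewrite -(sigma_algebra_id (filtration_sigma t0T)).
by have := mY measurableT V mV; rewrite setTI.
Qed.

Lemma measurable_event_wrt t (E : set Omega) : 0 <= t <= T ->
  F t E -> measurable (E : set (g_sigma_algebraType (F t))).
Proof. by move=> t0T FE; exact: sub_sigma_algebra. Qed.

(** Completeness at work: null sets belong to [F 0], so a change on a null set preserves
    measurability at every time. Limits that exist only almost surely stay adapted for this
    reason. *)
Lemma measurable_wrt_ae t (Y Y' : Omega -> R) : 0 <= t <= T ->
  {ae P, forall w, Y w = Y' w} -> measurable_wrt (F t) Y -> measurable_wrt (F t) Y'.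
Proof.
move=> t0T hN mY _ V mV; rewrite setTI.
have t0 : 0 <= t by case/andP: t0T.
have neg (N : set Omega) : P.-negligible N -> F t N.
  case: usual => _ _ h /h; apply: filtration_le => //; by case/andP: t0T.
set N := ~` [set w | Y w = Y' w] in hN.
have -> : Y' @^-1` V = ((Y @^-1` V) `\` N) `|` (Y' @^-1` V `&` N).
  apply/seteqP; split => w /=.
    have [YY'|YY'] := pselect (Y w = Y' w); last by right.
    by move=> VY'; left; split; [rewrite YY'|rewrite /N/=; tauto].
  by move=> [[VY /contrapT <-]|[]].
apply: measurableU.
  apply: measurableD; first by have := mY measurableT V mV; rewrite setTI.
  by apply: (measurable_event_wrt t0T); exact: neg.
apply: (measurable_event_wrt t0T); apply: neg.
by apply: negligibleS hN => w [].
Qed.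

Lemma progressive_ambient t (H : R -> Omega -> R) : 0 <= t <= T ->
  progressive F T H ->
  measurable_fun (`[0, t] `*` setT) (fun p : R * Omega => H p.1 p.2).
Proof.
move=> t0T /(_ t t0T) mH.
pose f (p : R * Omega) : R * g_sigma_algebraType (F t) := (p.1, p.2).
have mf : measurable_fun setT f.
  apply: measurable_fun_pair; first exact: measurable_fst.
  apply: (measurableT_comp (f := (id : Omega -> g_sigma_algebraType (F t)))).
    exact/measurable_id_ambient/filtration_measurable.
  exact: measurable_snd.
move=> mD V mV.
have := mH (measurableX (measurable_itv _) measurableT) V mV.
move=> /(mf measurableT); rewrite setTI; congr (measurable _).
Qed.

Lemma progressive_at t (H : R -> Omega -> R) : 0 <= t <= T ->
  progressive F T H -> measurable_wrt (F t) (H t).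
Proof.
move=> t0T /(_ t t0T) mH.
have mD : measurable (`[0, t] `*` [set: g_sigma_algebraType (F t)]).
  by apply: measurableX => //; exact: measurable_itv.
move=> _ V mV; have := measurable_xsection t (mH mD V mV).
rewrite setTI; congr (measurable _); apply/seteqP; split => w /=.
  by rewrite /xsection/= inE => -[].
rewrite /xsection/= inE => Vw; split => //; split => //=.
by rewrite in_itv/= lexx; case/andP: t0T => ->.
Qed.

End filtered_space.

Section brownian_sums.
Context {R : realType} {d : measure_display} {Omega : measurableType d}.
Variables (P : probability Omega R) (T : R) (F : R -> set_system Omega).
Variable B : R -> Omega -> R.
Hypothesis usual : usual_conditions P F T.
Hypothesis bm : brownian_motion P F T B.
Local Open Scope ereal_scope.

(** The law of an increment is given only for [s < t]; in the two lemmas that follow the case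
    [s = t] is settled directly, the increment being 0. *)
Let increment_hyp s t (xi : Omega -> R) : (0 <= s)%R -> (s < t)%R -> (t <= T)%R ->
  measurable_wrt (F s) xi ->
  [/\ @measurable_fun _ _ Omega (measurableTypeR R) setT xi,
      @measurable_fun _ _ Omega (measurableTypeR R) setT (fun w => B t w - B s w)%R,
      Num.sqrt (t - s) != 0%R &
      forall U V : set (measurableTypeR R), measurable U -> measurable V ->
      P (xi @^-1` U `&` (fun w => B t w - B s w)%R @^-1` V) =
      (P (xi @^-1` U) * normal_prob 0 (Num.sqrt (t - s)) V)%E].
Proof.
move=> s0 st tT mxi.
have s0T : (0 <= s <= T)%R by rewrite s0 (le_trans (ltW st)).
have t0T : (0 <= t <= T)%R by rewrite tT (le_trans s0 (ltW st)).
case: bm => Bad _ _ /(_ s t s0 st tT)[law ind].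
split.
- exact: (measurable_wrt_ambient usual s0T).
- apply: measurable_funB; apply: (measurable_wrt_ambient usual).
  + exact: t0T.
  + exact: Bad.
  + exact: s0T.
  + exact: Bad.
- by rewrite gt_eqF// sqrtr_gt0 subr_gt0.
- move=> U V mU mV; rewrite ind//; last exact: (measurable_wrt_event usual).
  by rewrite law.
Qed.

Lemma increment_sqr_le s t (xi : Omega -> R) :
  (0 <= s)%R -> (s <= t)%R -> (t <= T)%R -> measurable_wrt (F s) xi ->
  \int[P]_w ((xi w * (B t w - B s w)) ^+ 2)%:E <=
  (t - s)%:E * \int[P]_w ((xi w) ^+ 2)%:E.
Proof.
move=> s0; rewrite le_eqVlt => /orP[/eqP->|st] tT mxi.
  rewrite subrr mul0e integral0_eq// => w _.
  by rewrite subrr mulr0 expr0n.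
have [m1 m2 m3 m4] := increment_hyp s0 st tT mxi.
have := expectation_sqrM_normal_le m1 m2 m3 m4.
by rewrite sqr_sqrtr// subr_ge0 ltW.
Qed.

Lemma increment_mean s t (xi : Omega -> R) :
  (0 <= s)%R -> (s <= t)%R -> (t <= T)%R -> measurable_wrt (F s) xi ->
  \int[P]_w ((xi w) ^+ 2)%:E < +oo ->
  P.-integrable setT (fun w => (xi w * (B t w - B s w))%:E) /\
  \int[P]_w (xi w * (B t w - B s w))%:E = 0.
Proof.
move=> s0; rewrite le_eqVlt => /orP[/eqP->|st] tT mxi xi2.
  have E : (fun w => (xi w * (B t w - B t w))%:E) = cst 0.
    by apply/funext => w; rewrite subrr mulr0.
  by rewrite E integral0; split => //; exact: integrable0.
have [m1 m2 m3 m4] := increment_hyp s0 st tT mxi.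
split; first exact: (integrableM_normal m1 m2 m3 m4 xi2).
exact: (expectationM_normal m1 m2 m3 m4 xi2).
Qed.

End brownian_sums.

(** * Martingale transforms on a grid and simple processes *)

Section grid_sums.
Context {R : realType} {d : measure_display} {Omega : measurableType d}.
Variables (P : probability Omega R) (T : R) (F : R -> set_system Omega).
Variable B : R -> Omega -> R.
Hypothesis usual : usual_conditions P F T.
Hypothesis bm : brownian_motion P F T B.
Local Open Scope ereal_scope.

Variables (g : nat -> R) (n : nat).
Hypothesis g_nd : forall i, (i < n)%N -> (g i <= g i.+1)%R.
Hypothesis g_itv : forall i, (i <= n)%N -> (0 <= g i <= T)%R.

Definition grid_sum (c : nat -> Omega -> R) (k : nat) (w : Omega) : R :=
  (\sum_(i < k) c i w * (B (g i.+1) w - B (g i) w))%R.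

(** The predictable bracket of [grid_sum], equal to the time integral of the squared step process
    with values [c]. *)
Definition grid_var (c : nat -> Omega -> R) (k : nat) (w : Omega) : R :=
  (\sum_(i < k) (c i w) ^+ 2 * (g i.+1 - g i))%R.

Definition grid_coef (c : nat -> Omega -> R) :=
  forall i, (i < n)%N -> measurable_wrt (F (g i)) (c i) /\
    exists C : R, forall w, (`|c i w| <= C)%R.

Let g_le i j : (i <= j)%N -> (j <= n)%N -> (g i <= g j)%R.
Proof.
elim: j => [|j IH]; first by rewrite leqn0 => /eqP->.
rewrite leq_eqVlt => /orP[/eqP->//|ij jn].
by apply: le_trans (g_nd jn); apply: IH => //; exact: ltnW.
Qed.

Let wrt_le i j (Y : Omega -> R) : (i <= j)%N -> (j <= n)%N ->
  measurable_wrt (F (g i)) Y -> measurable_wrt (F (g j)) Y.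
Proof.
move=> ij jn; apply: (measurable_wrt_le usual); last 2 first.
- exact: g_le.
- by have /andP[] := g_itv jn.
- by have /andP[] := g_itv (leq_trans ij jn).
Qed.

Let B_wrt i : (i <= n)%N -> measurable_wrt (F (g i)) (B (g i)).
Proof. by case: bm => Bad _ _ _ /g_itv; exact: Bad. Qed.

Lemma grid_sumS c k w : grid_sum c k.+1 w =
  (grid_sum c k w + c k w * (B (g k.+1) w - B (g k) w))%R.
Proof. by rewrite /grid_sum big_ord_recr. Qed.

Lemma grid_varS c k w : grid_var c k.+1 w =
  (grid_var c k w + (c k w) ^+ 2 * (g k.+1 - g k))%R.
Proof. by rewrite /grid_var big_ord_recr. Qed.

Lemma grid_var_ge0 c k w : (k <= n)%N -> (0 <= grid_var c k w)%R.
Proof.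
move=> kn; apply: sumr_ge0 => i _; rewrite mulr_ge0 ?sqr_ge0// subr_ge0.
by apply: g_nd; apply: leq_trans kn.
Qed.

Lemma grid_sum_wrt c k : grid_coef c -> (k <= n)%N ->
  measurable_wrt (F (g k)) (grid_sum c k).
Proof.
move=> hc; elim: k => [|k IH] kn.
  rewrite (_ : grid_sum c 0 = cst 0%R); first exact: measurable_cst.
  by apply/funext => w; rewrite /grid_sum big_ord0.
rewrite (_ : grid_sum c k.+1 = fun w =>
    grid_sum c k w + c k w * (B (g k.+1) w - B (g k) w))%R; last first.
  by apply/funext => w; rewrite grid_sumS.
have [mc _] := hc k kn.
apply: measurable_funD; first exact: wrt_le (IH (ltnW kn)).
apply: measurable_funM; first exact: wrt_le mc.
apply: measurable_funB; first exact: B_wrt.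
by apply: wrt_le (B_wrt (ltnW kn)).
Qed.

Let ambient k (Y : Omega -> R) : (k <= n)%N -> measurable_wrt (F (g k)) Y -> measurable_fun setT Y.
Proof. by move=> kn; apply: (measurable_wrt_ambient usual); exact: g_itv. Qed.

Lemma grid_sum_measurable c k : grid_coef c -> (k <= n)%N ->
  measurable_fun setT (grid_sum c k).
Proof. by move=> hc kn; apply: (ambient kn); exact: grid_sum_wrt. Qed.

(** The bracket after step [k] involves only the coefficients up to [k] and is therefore known one
    step earlier. This allows stopping before it exceeds a level. *)
Lemma grid_var_wrt c k : grid_coef c -> (k < n)%N ->
  measurable_wrt (F (g k)) (grid_var c k.+1).
Proof.
move=> hc kn.
apply: measurable_sum => i; apply: measurable_funM; last exact: measurable_cst.
have ik : (i <= k)%N by rewrite -ltnS.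
apply: measurable_funX; apply: (wrt_le ik (ltnW kn)).
by have [] := hc i (leq_ltn_trans ik kn).
Qed.

Lemma grid_var_measurable c k : grid_coef c -> (k <= n)%N ->
  measurable_fun setT (grid_var c k).
Proof.
case: k => [|k] hc kn; last by apply: (ambient (ltnW kn)); exact: grid_var_wrt.
rewrite (_ : grid_var c 0 = cst 0%R)//.
by apply/funext => w; rewrite /grid_var big_ord0.
Qed.

Let bounded_sqr_lty (Y : Omega -> R) (C : R) : measurable_fun setT Y ->
  (forall w, `|Y w| <= C)%R -> \int[P]_w ((Y w) ^+ 2)%:E < +oo.
Proof.
move=> mY hY; apply: (@le_lt_trans _ _ (\int[P]_w ((C ^+ 2)%:E))).
  apply: ge0_le_integral => //.
  - by move=> w _; rewrite lee_fin sqr_ge0.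
  - by apply/measurable_EFinP; exact: measurable_funX.
  - by move=> w _; rewrite lee_fin -real_normK ?num_real// lerXn2r ?nnegrE// (le_trans _ (hY w)).
rewrite integral_cst// lte_mul_pinfty ?lee_fin ?sqr_ge0//.
by rewrite (le_lt_trans (probability_le1 _ _))// ltry.
Qed.

Let sqrM_bounded_lty (Y c : Omega -> R) (C : R) : measurable_fun setT Y ->
  measurable_fun setT c -> (forall w, `|c w| <= C)%R ->
  \int[P]_w ((Y w) ^+ 2)%:E < +oo -> \int[P]_w ((Y w * c w) ^+ 2)%:E < +oo.
Proof.
move=> mY mc hc fY.
have m2 : measurable_fun setT (fun w => ((Y w) ^+ 2)%:E).
  by apply/measurable_EFinP; exact: measurable_funX.
apply: (@le_lt_trans _ _ (\int[P]_w ((C ^+ 2)%:E * ((Y w) ^+ 2)%:E))).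
  apply: ge0_le_integral => //.
  - by move=> w _; rewrite lee_fin sqr_ge0.
  - by apply/measurable_EFinP; apply: measurable_funX; exact: measurable_funM.
  - exact: emeasurable_funM.
  - move=> w _; rewrite -EFinM lee_fin exprMn mulrC ler_wpM2r ?sqr_ge0//.
    by rewrite -real_normK ?num_real// lerXn2r ?nnegrE// (le_trans _ (hc w)).
rewrite ge0_integralZl//; last 2 first.
- by move=> w _; rewrite lee_fin sqr_ge0.
- by rewrite lee_fin sqr_ge0.
by rewrite lte_mul_pinfty// lee_fin sqr_ge0.
Qed.

(** The Ito isometry as an inequality, by induction: the cross term is an increment times a variable
    of the past and has mean 0. Finiteness is carried along because the integrability of that cross
    term depends on it. *)
Lemma grid_sum_sqr_lty c k : grid_coef c -> (k <= n)%N ->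
  \int[P]_w ((grid_sum c k w) ^+ 2)%:E < +oo /\
  \int[P]_w ((grid_sum c k w) ^+ 2)%:E <= \int[P]_w (grid_var c k w)%:E.
Proof.
move=> hc; elim: k => [|k IH] kn.
  rewrite integral0_eq; last by move=> w _; rewrite /grid_sum big_ord0 expr0n.
  split => //; apply: integral_ge0 => w _; rewrite lee_fin; exact: grid_var_ge0.
have {IH}[fk lek] := IH (ltnW kn).
have [mck [C hC]] := hc k kn.
have mN := grid_sum_wrt hc (ltnW kn).
have mN' := grid_sum_measurable hc (ltnW kn).
have /andP[gk0 _] := g_itv (ltnW kn).
have gkk := g_nd kn.
have /andP[_ gkT] := g_itv kn.
have mck' := ambient (ltnW kn) mck.
have mB i : (i <= n)%N -> measurable_fun setT (B (g i)).
  by move=> iN; apply: (ambient iN); exact: B_wrt.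
set D := (fun w => B (g k.+1) w - B (g k) w)%R.
have mD : measurable_fun setT D by apply: measurable_funB; apply: mB => //; exact: ltnW.
have fcN : \int[P]_w ((grid_sum c k w * c k w) ^+ 2)%:E < +oo.
  exact: sqrM_bounded_lty hC fk.
have fc : \int[P]_w ((c k w) ^+ 2)%:E < +oo by exact: bounded_sqr_lty hC.
have [icross mcross] := increment_mean usual bm gk0 gkk gkT
  (measurable_funM mN mck : measurable_wrt (F (g k)) (fun w => grid_sum c k w * c k w)%R) fcN.
have sq := increment_sqr_le usual bm gk0 gkk gkT mck.
have mcD : measurable_fun setT (fun w => ((c k w * D w) ^+ 2)%:E).
  by apply/measurable_EFinP; apply: measurable_funX; exact: measurable_funM.
have mN2 : measurable_fun setT (fun w => ((grid_sum c k w) ^+ 2)%:E).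
  by apply/measurable_EFinP; exact: measurable_funX.
have fcD : \int[P]_w ((c k w * D w) ^+ 2)%:E < +oo.
  by apply: (le_lt_trans sq); rewrite lte_mul_pinfty// lee_fin subr_ge0.
have icD : P.-integrable setT (fun w => ((c k w * D w) ^+ 2)%:E).
  apply/integrableP; split => //; under eq_integral do rewrite gee0_abs ?lee_fin ?sqr_ge0//.
  by [].
have iN : P.-integrable setT (fun w => ((grid_sum c k w) ^+ 2)%:E).
  apply/integrableP; split => //; under eq_integral do rewrite gee0_abs ?lee_fin ?sqr_ge0//.
  by [].
have icr2 := integrableZl measurableT 2 icross.
have E : \int[P]_w ((grid_sum c k.+1 w) ^+ 2)%:E =
    \int[P]_w ((grid_sum c k w) ^+ 2)%:E + \int[P]_w ((c k w * D w) ^+ 2)%:E.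
  transitivity (\int[P]_w (((grid_sum c k w) ^+ 2)%:E +
     (2%:E * (grid_sum c k w * c k w * D w)%:E + ((c k w * D w) ^+ 2)%:E))).
    apply: eq_integral => w _; rewrite grid_sumS -!EFinM -!EFinD; congr EFin.
    by rewrite -/(D w); ring.
  rewrite integralD//; last exact: integrableD.
  rewrite integralD// integralZl//; rewrite [X in 2%:E * X]mcross.
  by rewrite mule0 add0e.
split; first by rewrite E lte_add_pinfty.
rewrite E; apply: (le_trans (leeD lek sq)).
rewrite (_ : (fun w => (grid_var c k.+1 w)%:E) = (fun w => (grid_var c k w)%:E +
    (g k.+1 - g k)%:E * ((c k w) ^+ 2)%:E)); last first.
  by apply/funext => w; rewrite grid_varS EFinD -EFinM mulrC.
have mc2 : measurable_fun setT (fun w => ((c k w) ^+ 2)%:E).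
  by apply/measurable_EFinP; exact: measurable_funX.
rewrite ge0_integralD//; last 4 first.
- by move=> w _; rewrite lee_fin; apply: grid_var_ge0; exact: ltnW.
- by apply/measurable_EFinP; apply: grid_var_measurable => //; exact: ltnW.
- by move=> w _; rewrite mule_ge0 ?lee_fin ?subr_ge0 ?sqr_ge0.
- exact: emeasurable_funM.
by rewrite ge0_integralZl// ?lee_fin ?subr_ge0// => w _; rewrite lee_fin sqr_ge0.
Qed.

Lemma grid_sum_mean c k : grid_coef c -> (k <= n)%N ->
  P.-integrable setT (fun w => (grid_sum c k w)%:E) /\
  \int[P]_w (grid_sum c k w)%:E = 0.
Proof.
move=> hc; elim: k => [|k IH] kn.
  have E : (fun w => (grid_sum c 0 w)%:E) = cst 0.
    by apply/funext => w; rewrite /grid_sum big_ord0.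
  by rewrite E integral0; split => //; exact: integrable0.
have [i0 m0] := IH (ltnW kn).
have [mck [C hC]] := hc k kn.
have /andP[gk0 _] := g_itv (ltnW kn).
have /andP[_ gkT] := g_itv kn.
have [ic mc] := increment_mean usual bm gk0 (g_nd kn) gkT mck
  (bounded_sqr_lty (ambient (ltnW kn) mck) hC).
have E : (fun w => (grid_sum c k.+1 w)%:E) = (fun w => (grid_sum c k w)%:E +
    (c k w * (B (g k.+1) w - B (g k) w))%:E).
  by apply/funext => w; rewrite grid_sumS EFinD.
rewrite E; split; first exact: integrableD.
by rewrite integralD// m0 mc adde0.
Qed.

End grid_sums.

Section grid_maximal.
Context {R : realType} {d : measure_display} {Omega : measurableType d}.
Variables (P : probability Omega R) (T : R) (F : R -> set_system Omega).
Variable B : R -> Omega -> R.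
Hypothesis usual : usual_conditions P F T.
Hypothesis bm : brownian_motion P F T B.

Variables (g : nat -> R) (n : nat).
Hypothesis g_nd : forall i, (i < n)%N -> g i <= g i.+1.
Hypothesis g_itv : forall i, (i <= n)%N -> 0 <= g i <= T.
Variable c : nat -> Omega -> R.
Hypothesis hc : grid_coef F g n c.
Variables (eps dl : R).
Hypotheses (eps0 : 0 < eps) (dl0 : 0 <= dl).

Local Notation N := (grid_sum B g c).
Local Notation V := (grid_var g c).

(** Up to time [g i] the transform stays below [eps], and the bracket stays at most [dl] even after
    the next step. By predictability of the bracket the event is known at time [g i]. *)
Let E i : set Omega :=
  [set w | (forall k, (k <= i)%N -> `|N k w| < eps) /\ V i.+1 w <= dl].

Let g_le i j : (i <= j)%N -> (j <= n)%N -> g i <= g j.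
Proof.
elim: j => [|j IH]; first by rewrite leqn0 => /eqP->.
rewrite leq_eqVlt => /orP[/eqP->//|ij jn].
by apply: le_trans (g_nd jn); apply: IH => //; exact: ltnW.
Qed.

Let measurable_E i : (i < n)%N ->
  measurable (E i : set (g_sigma_algebraType (F (g i)))).
Proof.
move=> ni; rewrite (_ : E i = \bigcap_(k in [set k | (k <= i)%N])
    [set w | `|N k w| < eps] `&` [set w | V i.+1 w <= dl]); last first.
  by apply/seteqP; split.
apply: measurableI.
  apply: bigcap_measurable; first by exists 0%N.
  move=> k /= ki.
  have mN : measurable_fun setT (N k : g_sigma_algebraType (F (g i)) -> R).
    apply: (measurable_wrt_le usual _ _ _ (grid_sum_wrt usual bm g_nd g_itv hc _)).
    - by have /andP[] := g_itv (leq_trans ki (ltnW ni)).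
    - exact: g_le (ltnW ni).
    - by have /andP[] := g_itv (ltnW ni).
    - exact: leq_trans ki (ltnW ni).
  have := measurable_fun_ltr (measurableT_comp (@normr_measurable R setT) mN)
    (measurable_cst eps).
  move=> /(_ measurableT [set true]); rewrite setTI; exact.
have mV : measurable_fun setT (V i.+1 : g_sigma_algebraType (F (g i)) -> R).
  exact: (grid_var_wrt usual g_nd g_itv hc).
have := measurable_fun_ler mV (measurable_cst dl).
by move=> /(_ measurableT [set true]); rewrite setTI; apply.
Qed.

(** The events [E i] decrease with [i], so this is [c] stopped at the first exit, without any
    explicit stopping time. *)
Let c' i w := c i w * \1_(E i) w.

Let hc' : grid_coef F g n c'.
Proof.
move=> i ni; have [mc [C hC]] := hc ni; split.
  by apply: measurable_funM => //; apply: measurable_indic; exact: measurable_E.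
exists C => w; rewrite /c' normrM indicE; case: (_ \in _) => /=.
  by rewrite normr1 mulr1.
by rewrite normr0 mulr0 (le_trans _ (hC w)).
Qed.

Let var_c'_le w k : (k <= n)%N -> grid_var g c' k w <= dl.
Proof.
have mono m : (m <= n)%N -> grid_var g c' m w <= V m w.
  move=> mn; apply: ler_sum => i _.
  rewrite ler_wpM2r ?subr_ge0 ?g_nd ?(leq_trans _ mn)//.
  rewrite /c' exprMn indicE; case: (_ \in _); first by rewrite expr1n mulr1.
  by rewrite expr0n mulr0 sqr_ge0.
elim: k => [|k IH] kn; first by rewrite /grid_var big_ord0.
have [Ek|nEk] := pselect (E k w).
  by apply: le_trans (mono _ kn) _; case: Ek.
rewrite grid_varS /c' indicE memNset// mulr0 expr0n mul0r addr0.
by apply: IH; exact: ltnW.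
Qed.

(** Discrete form of Lenglart's inequality. The stopped transform keeps, up to time [n], the value
    with which it first reaches [eps], so Chebyshev at the terminal time alone controls all times,
    and the exceptional event [Z] is common to all [k]. *)
Lemma grid_maximal : exists Z : set Omega, [/\ measurable Z,
  (P Z <= (dl / eps ^+ 2)%:E)%E &
  forall w k, (k <= n)%N -> eps <= `|N k w| -> dl < V n w \/ Z w].
Proof.
have mN' := grid_sum_measurable usual bm g_nd g_itv hc' (leqnn n).
have mN2 : measurable_fun setT (fun w => ((grid_sum B g c' n w) ^+ 2)%:E).
  by apply/measurable_EFinP; exact: measurable_funX.
exists [set w | ((eps ^+ 2)%:E <= ((grid_sum B g c' n w) ^+ 2)%:E)%E]; split.
- exact: measurable_ge_event.
- have e2 : 0 < eps ^+ 2 by rewrite exprn_gt0.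
  have := markov_ereal P e2 mN2 (fun w => _ : (0 <= _)%E).
  move=> /(_ (fun w => _)) h.
  have {}h := h (fun w => sqr_ge0 (grid_sum B g c' n w)).
  rewrite -(@lee_pmul2l _ (eps ^+ 2)%:E) ?lte_fin// -EFinM mulrCA divff ?gt_eqF//.
  rewrite mulr1; apply: (le_trans h).
  have [_ le1] := grid_sum_sqr_lty usual bm g_nd g_itv hc' (leqnn n).
  apply: (le_trans le1).
  apply: (@le_trans _ _ (\int[P]_w (dl%:E)))%E.
    apply: ge0_le_integral => //.
    + by move=> w _; rewrite lee_fin (grid_var_ge0 g_nd).
    + by apply/measurable_EFinP; exact: (grid_var_measurable usual g_nd g_itv).
    + by move=> w _; rewrite lee_fin var_c'_le.
  by rewrite integral_cst// -[leRHS]mule1 lee_wpmul2l ?lee_fin// probability_le1.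
- move=> w k kn epsk.
  have [|Vdl] := ltP dl (V n w); [by left|right].
  have ex : exists k, (k <= n)%N && (eps <= `|N k w|) by exists k; rewrite kn.
  (* [m] is the first passage index: up to it the stopped transform agrees with the original one,
     and from it on it is frozen. *)
  case: (ex_minnP ex) => m /andP[mn epsm] hmin.
  have mono j l : (j <= l)%N -> (l <= n)%N -> V j w <= V l w.
    elim: l => [|l IH]; first by rewrite leqn0 => /eqP->.
    rewrite leq_eqVlt => /orP[/eqP->//|jl ln].
    rewrite grid_varS; apply: (le_trans (IH jl (ltnW ln))).
    by rewrite lerDl mulr_ge0 ?sqr_ge0// subr_ge0 g_nd.
  have before i : (i < m)%N -> E i w.
    move=> im; split; last first.
      by apply: le_trans Vdl; apply: mono => //; exact: leq_trans im mn.
    move=> j ji; rewrite ltNge; apply/negP => epsj.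
    have := hmin j; rewrite epsj (leq_trans ji (ltnW (leq_trans im mn))) => /(_ isT).
    by rewrite leqNgt (leq_ltn_trans ji im).
  have after i : (m <= i)%N -> ~ E i w.
    by move=> mi [/(_ m mi)]; rewrite ltNge epsm.
  have eq1 j : (j <= m)%N -> grid_sum B g c' j w = N j w.
    move=> jm; apply: eq_bigr => i _; rewrite /c' indicE mem_set ?mulr1//.
    by apply: before; exact: leq_trans jm.
  have eq2 j : (m <= j)%N -> grid_sum B g c' j w = N m w.
    elim: j => [|j IH]; first by rewrite leqn0 => /eqP m0; rewrite -eq1 ?m0.
    rewrite leq_eqVlt => /orP[/eqP <-|]; first exact: eq1.
    rewrite ltnS => mj; rewrite grid_sumS IH// /c' indicE memNset.
      by rewrite mulr0 mul0r addr0.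
    exact: after.
  rewrite /= eq2// lee_fin -[leRHS]real_normK ?num_real//.
  by rewrite lerXn2r ?nnegrE// ltW.
Qed.

End grid_maximal.

Section simple_processes_on_grids.
Context {R : realType} {d : measure_display} {Omega : measurableType d}.
Local Notation leb := (@lebesgue_measure R).
Implicit Types S : @simple_process R d Omega.

Section grid.
Variables (g : nat -> R) (n : nat) (t : R).
Hypothesis g_nd : forall i, (i < n)%N -> g i <= g i.+1.
Hypothesis g0 : g 0%N = 0.
Hypothesis gn : g n = t.

Lemma grid_le i j : (i <= j)%N -> (j <= n)%N -> g i <= g j.
Proof.
elim: j => [|j IH]; first by rewrite leqn0 => /eqP->.
rewrite leq_eqVlt => /orP[/eqP->//|ij jn].
by apply: le_trans (g_nd jn); apply: IH => //; exact: ltnW.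
Qed.

(** The grid may contain repeated points. A cell beyond index [m] passes the test [g j.+1 <= g m]
    only if it is degenerate, and then its increment is 0. *)
Lemma grid_telescope (f : R -> R) (m k : nat) : (m <= n)%N -> (k <= n)%N ->
  \sum_(j < k) (g j.+1 <= g m)%R%:R * (f (g j.+1) - f (g j)) =
  f (g (minn m k)) - f 0.
Proof.
move=> mn; elim: k => [|k IH] kn; first by rewrite big_ord0 minn0 g0 subrr.
rewrite big_ord_recr /= IH ?(ltnW kn)//.
have [mk|km] := leqP m k.
  rewrite !(minn_idPl _) ?(leqW mk)//.
  have := grid_le mk (ltnW kn); have := g_nd kn.
  case: (leP (g k.+1) (g m)) => h h1 h2; last by rewrite mul0r addr0.
  have e1 : g k.+1 = g m by apply/eqP; rewrite eq_le h (le_trans h2).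
  have e2 : g k = g m by apply/eqP; rewrite eq_le -{1}e1 h1 h2.
  by rewrite e1 e2 subrr mulr0 addr0.
rewrite (minn_idPr km) (grid_le km mn) mul1r; ring.
Qed.

Lemma sum_grid_indic (k : nat) (s : R) : (k <= n)%N ->
  \sum_(j < k) \1_(`]g j, g j.+1]%classic) s = \1_(`]0, g k]%classic) s :> R.
Proof.
have E (a b : R) : a <= b ->
    \1_(`]a, b]%classic) s = (s <= b)%R%:R - (s <= a)%R%:R :> R.
  move=> ab; rewrite indicE mem_setE in_itv/=.
  case: (leP s a) => sa /=; first by rewrite (le_trans sa ab) subrr.
  by rewrite subr0.
have ge0 i : (i <= n)%N -> 0 <= g i by move=> ni; rewrite -g0 grid_le.
elim: k => [|k IH] kn; first by rewrite big_ord0 g0 E// subrr.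
rewrite big_ord_recr /= IH ?(ltnW kn)// !E ?ge0 ?(ltnW kn) ?g_nd//; ring.
Qed.

Lemma sp_val_cell S j s w :
  (forall i, (i <= sp_size S)%N -> exists2 m, (m <= n)%N & sp_time S i = g m) ->
  (j < n)%N -> g j < s <= g j.+1 -> sp_val S s w = sp_val S (g j.+1) w.
Proof.
move=> hS jn /andP[js sj]; apply: eq_bigr => i _; congr (_ * _).
rewrite !indicE !mem_setE !in_itv/=; congr (nat_of_bool _)%:R.
have key k : (k <= sp_size S)%N -> (sp_time S k < s) = (sp_time S k < g j.+1).
  move=> /hS[m mn ->]; have [mj|jm] := leqP m j.
    have := grid_le mj (ltnW jn) => h.
    by rewrite (le_lt_trans h js) (lt_le_trans (le_lt_trans h js) sj).
  have := grid_le jm mn => h.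
  by rewrite !ltNge h (le_trans sj h).
rewrite key ?(ltnW (ltn_ord i))//; congr (_ && _).
by rewrite !leNgt key.
Qed.

End grid.
End simple_processes_on_grids.

Section grid_representation.
Context {R : realType} {d : measure_display} {Omega : measurableType d}.
Local Notation leb := (@lebesgue_measure R).
Implicit Types S : @simple_process R d Omega.

(** Sorting the list and adding both ends of [[0, t]] gives a common refinement, on which several
    simple processes and finitely many sampling times can be treated at once. *)
Lemma exists_grid (t : R) (l : seq R) : 0 <= t ->
  (forall a, a \in l -> 0 <= a <= t) ->
  exists (g : nat -> R) (n : nat), [/\ forall i, (i < n)%N -> g i <= g i.+1,
    g 0%N = 0, g n = t, forall i, (i <= n)%N -> 0 <= g i <= t &
    forall a, a \in l -> exists2 m, (m <= n)%N & a = g m].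
Proof.
move=> t0 hl; pose s := rcons (sort <=%R l) t.
exists (nth 0 (0 :: s)), (size l).+1.
have ss : size s = (size l).+1 by rewrite size_rcons size_sort.
have nd i : (i < (size l).+1)%N -> nth 0 (0 :: s) i <= nth 0 (0 :: s) i.+1.
  have sp : path <=%R 0 s.
    rewrite /s rcons_path path_min_sorted ?sort_sorted//=; last first.
      by apply/allP => x; rewrite mem_sort => /hl/andP[].
    have := mem_last 0 (sort <=%R l); rewrite inE => /orP[/eqP->//|].
    by rewrite mem_sort => /hl/andP[].
  by move=> il; have /(pathP 0) := sp; apply; rewrite ss.
split => //.
- by rewrite /= /s nth_rcons size_sort ltnn eqxx.
- move=> i il; have: nth 0 (0 :: s) i \in 0 :: s by rewrite mem_nth//= ss.
  rewrite inE => /orP[/eqP->|]; first by rewrite lexx.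
  rewrite /s mem_rcons inE => /orP[/eqP->|]; first by rewrite t0 lexx.
  by rewrite mem_sort => /hl.
- move=> a al; have asl : a \in 0 :: s.
    by rewrite inE /s mem_rcons inE mem_sort al !orbT.
  exists (index a (0 :: s)); last by rewrite nth_index.
  by rewrite -ltnS -ss -[X in (_ < X)%N]/(size (0 :: s)) index_mem.
Qed.

(** The integral of [S] over [[0, q]], obtained by stopping the integrator and not the integrand; as
    a function of [q] it inherits continuity from the paths of [B]. *)
Definition stopped_integral (B : R -> Omega -> R) S (q : R) : Omega -> R :=
  sp_integral (fun s => B (Num.min s q)) S.

Section fixed_grid.
Variables (F : R -> set_system Omega) (t : R).
Variables (g : nat -> R) (n : nat).
Hypothesis g_nd : forall i, (i < n)%N -> g i <= g i.+1.
Hypothesis g0 : g 0%N = 0.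
Hypothesis gn : g n = t.
Variable S : @simple_process R d Omega.
Hypothesis S_simple : is_simple F t S.
Hypothesis Sg : forall i, (i <= sp_size S)%N ->
  exists2 m, (m <= n)%N & sp_time S i = g m.

Let indicE' (a b s : R) : a <= b ->
  \1_(`]a, b]%classic) s = (s <= b)%R%:R - (s <= a)%R%:R :> R.
Proof.
move=> ab; rewrite indicE mem_setE in_itv/=.
case: (leP s a) => sa /=; first by rewrite (le_trans sa ab) subrr.
by rewrite subr0.
Qed.

(** Cells are open on the left, so the value of [S] on cell [j] is read at its right end [g j.+1].
    Each increment over an interval of [S] telescopes along the grid. *)
Lemma sp_integral_grid (B : R -> Omega -> R) w :
  sp_integral B S w = grid_sum B g (fun j => sp_val S (g j.+1)) n w.
Proof.
case: S_simple => _ mono _.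
rewrite /grid_sum /sp_val.
under eq_bigr do rewrite mulr_suml.
rewrite exchange_big/=; apply: eq_bigr => i _.
have [m1 m1n e1] := Sg (ltnW (ltn_ord i)).
have [m2 m2n e2] := Sg (ltn_ord i).
have T1 := grid_telescope g_nd g0 (fun s => B s w) m1n (leqnn n).
have T2 := grid_telescope g_nd g0 (fun s => B s w) m2n (leqnn n).
rewrite (minn_idPl m1n) in T1; rewrite (minn_idPl m2n) in T2.
rewrite e1 e2 (_ : B (g m2) w - B (g m1) w =
  (B (g m2) w - B 0 w) - (B (g m1) w - B 0 w)); last by ring.
rewrite -T1 -T2 -sumrB mulr_sumr; apply: eq_bigr => j _.
have := mono i (ltn_ord i); rewrite e1 e2 => le12.
by rewrite indicE'//; ring.
Qed.

Lemma sp_val_out s w : ~~ (0 < s <= t) -> sp_val S s w = 0.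
Proof.
case: S_simple => hS _ _ hs; apply: big1 => i _.
rewrite indicE mem_setE in_itv/=.
have /andP[a1 _] := hS i (ltnW (ltn_ord i)).
have /andP[_ a2] := hS i.+1 (ltn_ord i).
case: ltP => //= h1; last by rewrite mulr0.
case: leP => //= h2; last by rewrite mulr0.
by move: hs; rewrite (le_lt_trans a1 h1) (le_trans h2 a2).
Qed.

Lemma sp_val_grid s w : sp_val S s w =
  \sum_(j < n) sp_val S (g j.+1) w * \1_(`]g j, g j.+1]%classic) s.
Proof.
transitivity (\sum_(j < n) sp_val S s w * \1_(`]g j, g j.+1]%classic) s).
  rewrite -mulr_sumr (sum_grid_indic g_nd g0 _ (leqnn n)) gn indicE mem_setE in_itv/=.
  by case: (boolP (0 < s <= t)) => [_|/sp_val_out ->]; rewrite ?mulr1// mul0r.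
apply: eq_bigr => j _; rewrite indicE mem_setE in_itv/=.
case: (boolP (g j < s <= g j.+1)) => [h|]; last by rewrite !mulr0.
by rewrite (sp_val_cell g_nd w Sg (ltn_ord j) h).
Qed.

Lemma sp_val_sqr_grid s w : (sp_val S s w) ^+ 2 =
  \sum_(j < n) (sp_val S (g j.+1) w) ^+ 2 * \1_(`]g j, g j.+1]%classic) s.
Proof.
transitivity (\sum_(j < n) (sp_val S s w) ^+ 2 * \1_(`]g j, g j.+1]%classic) s).
  rewrite -mulr_sumr (sum_grid_indic g_nd g0 _ (leqnn n)) gn indicE mem_setE in_itv/=.
  by case: (boolP (0 < s <= t)) => [_|/sp_val_out ->]; rewrite ?mulr1// expr0n mul0r.
apply: eq_bigr => j _; rewrite indicE mem_setE in_itv/=.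
case: (boolP (g j < s <= g j.+1)) => [h|]; last by rewrite !mulr0.
by rewrite (sp_val_cell g_nd w Sg (ltn_ord j) h).
Qed.

Lemma integral_sp_val_sqr w :
  (\int[leb]_(s in `[0%R, t]) ((sp_val S s w) ^+ 2)%:E =
   (grid_var g (fun j => sp_val S (g j.+1)) n w)%:E)%E.
Proof.
under eq_integral do rewrite sp_val_sqr_grid -sumEFin.
rewrite ge0_integral_sum//; last first.
- by move=> i s _; rewrite lee_fin mulr_ge0// sqr_ge0.
- by move=> i; apply/measurable_EFinP; apply: measurable_funM.
rewrite /grid_var -sumEFin; apply: eq_bigr => j _.
under eq_integral do rewrite EFinM.
rewrite ge0_integralZl//; last 2 first.
- by apply/measurable_EFinP; exact: measurable_indic.
- by rewrite lee_fin sqr_ge0.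
rewrite integral_indic// [RHS]EFinM; congr (_ * _)%E.
rewrite setIidl; last first.
  move=> s /=; rewrite !in_itv/= => /andP[h1 h2].
  rewrite -gn -g0 (le_trans _ (ltW h1))/=; last by rewrite (grid_le g_nd)// ltnW.
  by rewrite (le_trans h2)// (grid_le g_nd).
apply: (etrans (lebesgue_measure_itv `]g j, g j.+1])); rewrite /= lte_fin.
have := g_nd (ltn_ord j); rewrite le_eqVlt => /orP[/eqP->|->].
  by rewrite ltxx subrr.
by rewrite -EFinB.
Qed.

(** The value is read at [g j.+1] but known at [g j]: a term that contributes started strictly
    before [g j.+1], hence, its start being a grid point, no later than [g j]. *)
Lemma sp_val_grid_coef (P : probability Omega R) (T : R) :
  usual_conditions P F T -> t <= T ->
  grid_coef F g n (fun j => sp_val S (g j.+1)).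
Proof.
move=> usual tT j jn; case: S_simple => hS mono hc; split.
- rewrite /sp_val; apply: measurable_sum => i.
  have [mi _] := hc i (ltn_ord i).
  rewrite indicE mem_setE in_itv/=; case: (boolP (_ && _)) => [/andP[h1 _]|_]; last first.
    by rewrite (_ : (fun _ => _) = cst 0%R)//; apply/funext => w; rewrite mulr0.
  have [m mn em] := Sg (ltnW (ltn_ord i)).
  apply: measurable_funM; last exact: measurable_cst.
  apply: (measurable_wrt_le usual _ _ _ mi).
  + by have /andP[] := hS i (ltnW (ltn_ord i)).
  + move: h1; rewrite em; have [mj _|jm] := leqP m j; first exact: (grid_le g_nd) (ltnW jn).
    by move=> /lt_le_trans/(_ (grid_le g_nd jm mn)); rewrite ltxx.
  + by rewrite (le_trans _ tT)// -gn (grid_le g_nd)// ltnW.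
- have hb (i : 'I_(sp_size S)) : {C : R | forall w, `|sp_coef S i w| <= C}.
    by apply: cid; have [] := hc i (ltn_ord i).
  exists (\sum_(i < sp_size S) sval (hb i)) => w.
  apply: (le_trans (ler_norm_sum _ _ _)); apply: ler_sum => i _.
  rewrite normrM indicE; case: (_ \in _) => /=.
    by rewrite normr1 mulr1; exact: (svalP (hb i)).
  by rewrite normr0 mulr0; apply: le_trans (svalP (hb i) w).
Qed.

Lemma stopped_integral_grid (B : R -> Omega -> R) m w : (m <= n)%N ->
  stopped_integral B S (g m) w = grid_sum B g (fun j => sp_val S (g j.+1)) m w.
Proof.
move=> mn; rewrite /stopped_integral sp_integral_grid /grid_sum.
rewrite -(big_mkord xpredT (fun j => sp_val S (g j.+1) w *
   (B (Num.min (g j.+1) (g m)) w - B (Num.min (g j) (g m)) w))).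
rewrite (big_cat_nat (n := m))//= [X in _ + X]big_nat_cond [X in _ + X]big1 ?addr0.
  rewrite big_mkord; apply: eq_bigr => j _.
  by rewrite !min_l// (grid_le g_nd)// ltnW.
move=> j /andP[/andP[mj jn] _].
by rewrite (min_r (grid_le g_nd mj (ltnW jn))) (min_r (grid_le g_nd (leqW mj) jn)) subrr mulr0.
Qed.

End fixed_grid.
End grid_representation.

(** * Progressive processes, their square integrals, and operations on simple processes *)

Section progressive_processes.
Context {R : realType} {d : measure_display} {Omega : measurableType d}.
Local Notation leb := (@lebesgue_measure R).
Variables (P : probability Omega R) (T : R) (F : R -> set_system Omega).
Hypothesis usual : usual_conditions P F T.
Implicit Types (H : R -> Omega -> R) (t s u a : R).

Definition sqint H (t : R) (w : Omega) : \bar R :=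
  (\int[leb]_(s in `[0%R, t]) ((H s w) ^+ 2)%:E)%E.

Lemma sqint_ge0 H t w : (0 <= sqint H t w)%E.
Proof. by apply: integral_ge0 => s _; rewrite lee_fin sqr_ge0. Qed.

Lemma progressive_le H (s t : R) : s <= t -> progressive F t H -> progressive F s H.
Proof. by move=> st pH u /andP[u0 us]; apply: pH; rewrite u0 (le_trans us). Qed.

Let mstrip (u : R) :
  measurable (`[0, u] `*` [set: g_sigma_algebraType (F u)]).
Proof. by apply: measurableX => //; exact: measurable_itv. Qed.

Lemma progressiveD H H' t : progressive F t H -> progressive F t H' ->
  progressive F t (fun s w => H s w + H' s w).
Proof. by move=> h h' u ut; apply: measurable_funD; [exact: h|exact: h']. Qed.

Lemma progressiveB H H' t : progressive F t H -> progressive F t H' ->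
  progressive F t (fun s w => H s w - H' s w).
Proof. by move=> h h' u ut; apply: measurable_funB; [exact: h|exact: h']. Qed.

Lemma progressiveM H H' t : progressive F t H -> progressive F t H' ->
  progressive F t (fun s w => H s w * H' s w).
Proof. by move=> h h' u ut; apply: measurable_funM; [exact: h|exact: h']. Qed.

Lemma progressive_deterministic (f : R -> R) t :
  measurable_fun `[0, t] f -> progressive F t (fun s _ => f s).
Proof.
move=> mf u /andP[u0 ut].
apply: (@measurable_comp _ _ _ _ _ _ `[0, u] f _ (fst : R * g_sigma_algebraType (F u) -> R)).
- exact: measurable_itv.
- by move=> _ [[s w] /= [su _] <-].
- apply: (measurable_funS _ _ mf); first exact: measurable_itv.
  by move=> s /=; rewrite !in_itv/= => /andP[-> /le_trans ->].
- by apply: measurable_funTS; exact: measurable_fst.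
Qed.

Lemma progressive_indic (I : set R) t : measurable I ->
  progressive F t (fun s _ => \1_I s).
Proof. by move=> mI; apply: progressive_deterministic; exact: measurable_indic. Qed.

Lemma progressive_Z (a : R) H t : progressive F t H ->
  progressive F t (fun s w => a * H s w).
Proof.
by move=> h; apply: progressiveM h; apply: progressive_deterministic; exact: measurable_cst.
Qed.

Lemma progressive_sum n (H : nat -> R -> Omega -> R) t :
  (forall i, (i < n)%N -> progressive F t (H i)) ->
  progressive F t (fun s w => \sum_(i < n) H i s w).
Proof.
move=> h u ut; apply: measurable_sum => i; exact: (h i (ltn_ord i) u ut).
Qed.

Lemma progressive_start (a : R) (Y : Omega -> R) t : 0 <= a -> t <= T ->
  measurable_wrt (F a) Y ->
  progressive F t (fun s w => Y w * \1_(`]a, +oo[%classic) s).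
Proof.
move=> a0 tT mY u /andP[u0 ut].
have [ua|au] := leP u a.
  apply: eq_measurable_fun; last exact: (measurable_cst (0 : R)).
  move=> [s w] /=; rewrite inE/= => -[]; rewrite in_itv/= => /andP[_ su] _.
  by rewrite indicE mem_setE in_itv/= andbT ltNge (le_trans su ua) mulr0.
apply: measurable_funM; last first.
  by apply: (@progressive_indic _ t) => //; rewrite u0.
apply: measurable_funTS.
have mYu : measurable_wrt (F u) Y.
  by apply: (measurable_wrt_le usual a0 _ _ mY); [exact: ltW|exact: le_trans tT].
exact: (measurableT_comp mYu (@measurable_snd _ _ _ _)).
Qed.

Lemma progressive_section H t w : 0 <= t -> progressive F t H ->
  measurable_fun `[0, t] (fun s => H s w).
Proof.
move=> t0 /(_ t); rewrite t0 lexx => /(_ isT) mH _ V mV.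
have mA := mH (@mstrip t) V mV.
have := measurable_ysection (w : g_sigma_algebraType (F t)) mA.
congr (measurable _); apply/seteqP; split => s /=.
  by rewrite /ysection/= inE => -[] -[].
by rewrite /ysection/= inE => -[].
Qed.

Lemma measurable_integral_progressive (f : R -> Omega -> \bar R) t (D : set R) :
  0 <= t -> measurable D -> D `<=` `[0, t] ->
  @measurable_fun _ _ (R * g_sigma_algebraType (F t))%type _
    (`[0, t] `*` setT) (fun p => f p.1 p.2) ->
  @measurable_fun _ _ (g_sigma_algebraType (F t)) _ setT
    (fun w => \int[leb]_(s in D) f s w)%E.
Proof.
move=> t0 mD Dt mf; apply: measurable_integral_section => //.
apply: (measurable_funS _ _ mf); first exact: mstrip.
by move=> [s w] [/= Ds _]; split => //; exact: Dt.
Qed.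

Lemma measurable_wrt_sqint H t : 0 <= t -> progressive F t H ->
  @measurable_fun _ _ (g_sigma_algebraType (F t)) _ setT (sqint H t).
Proof.
move=> t0 pH; apply: measurable_integral_progressive => //.
  by apply/measurable_EFinP; apply: measurable_funX; apply: pH; rewrite t0 lexx.
Qed.

Lemma measurable_ambientE (t : R) (f : Omega -> \bar R) : 0 <= t <= T ->
  @measurable_fun _ _ (g_sigma_algebraType (F t)) _ setT f ->
  measurable_fun setT f.
Proof.
move=> t0T mf; apply: (measurableT_comp mf).
by apply: measurable_id_ambient; exact: (filtration_measurable usual).
Qed.

Lemma measurable_sqint H t : 0 <= t <= T -> progressive F t H ->
  measurable_fun setT (sqint H t).
Proof.
move=> t0T pH; apply: (measurable_ambientE t0T); apply: measurable_wrt_sqint => //.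
by case/andP: t0T.
Qed.

Lemma measurable_sqr_section H t w : 0 <= t -> progressive F t H ->
  measurable_fun `[0, t] (fun s => ((H s w) ^+ 2)%:E).
Proof.
by move=> t0 pH; apply/measurable_EFinP; apply: measurable_funX; exact: progressive_section.
Qed.

Lemma sqint_le2 H H1 H2 t w (c : R) : 0 <= c -> 0 <= t -> progressive F t H ->
  progressive F t H1 -> progressive F t H2 ->
  (forall s, 0 <= s <= t -> (H s w) ^+ 2 <= c * ((H1 s w) ^+ 2 + (H2 s w) ^+ 2)) ->
  (sqint H t w <= c%:E * (sqint H1 t w + sqint H2 t w))%E.
Proof.
move=> c0 t0 pH p1 p2 h.
have mt : measurable (`[0, t] : set R) by exact: measurable_itv.
rewrite /sqint -ge0_integralD//; last 4 first.
- by move=> s _; rewrite lee_fin sqr_ge0.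
- exact: measurable_sqr_section.
- by move=> s _; rewrite lee_fin sqr_ge0.
- exact: measurable_sqr_section.
rewrite -ge0_integralZl//; last 2 first.
- by apply: emeasurable_funD; exact: measurable_sqr_section.
- by move=> s _; rewrite adde_ge0// lee_fin sqr_ge0.
apply: ge0_le_integral => //.
- by move=> s _; rewrite lee_fin sqr_ge0.
- exact: measurable_sqr_section.
- apply: emeasurable_funM => //.
  by apply: emeasurable_funD; exact: measurable_sqr_section.
Qed.

Lemma sqint_le H H1 t w : 0 <= t -> progressive F t H -> progressive F t H1 ->
  (forall s, 0 <= s <= t -> (H s w) ^+ 2 <= (H1 s w) ^+ 2) ->
  (sqint H t w <= sqint H1 t w)%E.
Proof.
move=> t0 pH p1 h; apply: ge0_le_integral => //.
- by move=> s _; rewrite lee_fin sqr_ge0.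
- exact: measurable_sqr_section.
- exact: measurable_sqr_section.
Qed.

Lemma sqint_eq0 H t w : (forall s, 0 <= s <= t -> H s w = 0) -> sqint H t w = 0%E.
Proof.
move=> h; apply: integral0_eq => s; rewrite /= in_itv/= => /h ->.
by rewrite expr0n.
Qed.

Lemma eq_sqint H H' t w : (forall s, 0 <= s <= t -> H s w = H' s w) ->
  sqint H t w = sqint H' t w.
Proof.
by move=> h; apply: eq_integral => s; rewrite inE/= in_itv/= => /h ->.
Qed.

Lemma progressive_sp_val t S : 0 <= t <= T -> is_simple F t S ->
  progressive F t (sp_val S).
Proof.
move=> /andP[t0 tT] [hS mono hc]; apply: (@progressive_sum (sp_size S) (fun i s w => sp_coef S i w *
  \1_(`]sp_time S i, sp_time S i.+1]%classic) s)) => i iS.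
have [mc _] := hc i iS.
have /andP[a0 at_] := hS i (ltnW iS).
(* The indicator is split so that the random coefficient starts at a time when it is known, while
   the end of the interval is a deterministic factor. *)
rewrite (_ : (fun s w => _) = (fun s w =>
   (sp_coef S i w * \1_(`]sp_time S i, +oo[%classic) s) *
   \1_(`]-oo, sp_time S i.+1]%classic) s)); last first.
  apply/funext => s; apply/funext => w; rewrite -mulrA; congr (_ * _).
  by rewrite !indicE !mem_setE !in_itv/= andbT; 
    case: (sp_time S i < s); case: (s <= sp_time S i.+1);
    rewrite /= ?(mulr0, mul0r, mulr1, mul1r).
apply: progressiveM; first exact: progressive_start.
by apply: progressive_indic; exact: measurable_itv.
Qed.

End progressive_processes.

Section continuity_on_segments.
Context {R : realType}.

Lemma within_continuousP (T : R) (f : R -> R) :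
  {within `[0, T], continuous f} <->
  (forall x, 0 <= x <= T -> forall e, 0 < e -> exists2 dl, 0 < dl &
     forall y, 0 <= y <= T -> `|x - y| < dl -> `|f x - f y| < e).
Proof.
split.
- move/subspace_continuousP => h x xT e e0.
  have xI : `[0, T]%classic x by rewrite /= in_itv.
  have /cvgrPdist_lt /(_ _ e0) := h x xI.
  rewrite near_withinE => -[dl dl0 hdl]; exists dl => // y yT xy.
  by apply: hdl => //=; rewrite in_itv.
- move=> h; apply/subspace_continuousP => x; rewrite /= in_itv/= => xT.
  apply/cvgrPdist_lt => e e0; have [dl dl0 hdl] := h x xT e e0.
  rewrite near_withinE; exists dl => //= y xy; rewrite in_itv/= => yT.
  exact: hdl.
Qed.

Lemma within_continuous_sum (T : R) n (f : nat -> R -> R) :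
  (forall i, (i < n)%N -> {within `[0, T], continuous (f i)}) ->
  {within `[0, T], continuous (fun x => \sum_(i < n) f i x)}.
Proof.
elim: n => [_|n IH h].
  rewrite (_ : (fun _ => _) = cst 0); first by apply/continuous_subspaceT => x; exact: cvg_cst.
  by apply/funext => x; rewrite big_ord0.
rewrite (_ : (fun _ => _) = fun x => \sum_(i < n) f i x + f n x); last first.
  by apply/funext => x; rewrite big_ord_recr.
apply/subspace_continuousP => x xI; apply: cvgD.
  by apply: (subspace_continuousP _ _).1 x xI; apply: IH => i iN; apply: h; exact: ltnW.
by apply: (subspace_continuousP _ _).1 x xI; exact: h.
Qed.

Lemma within_continuous_stop (T a : R) (f : R -> R) : 0 <= a ->
  {within `[0, T], continuous f} ->
  {within `[0, T], continuous (fun x => f (Num.min a x))}.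
Proof.
move=> a0 /within_continuousP h; apply/within_continuousP => x /andP[x0 xT] e e0.
have mT z : 0 <= z -> z <= T -> 0 <= Num.min a z <= T.
  by move=> z0 zT; rewrite le_min a0 z0 ge_min zT orbT.
have [dl dl0 hdl] := h _ (mT x x0 xT) e e0; exists dl => // y /andP[y0 yT] xy.
apply: hdl; first exact: mT.
apply: le_lt_trans xy; rewrite /Num.min.
by case: ltP => ax; case: ltP => ay; rewrite ?subrr ?normr_ge0//;
  rewrite ler_norml; case: (lerP x y) => xy; lra.
Qed.

End continuity_on_segments.

Section simple_process_operations.
Context {R : realType} {d : measure_display} {Omega : measurableType d}.
Variables (P : probability Omega R) (T : R) (F : R -> set_system Omega).
Variable B : R -> Omega -> R.
Hypothesis usual : usual_conditions P F T.
Hypothesis bm : brownian_motion P F T B.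
Implicit Types (S : @simple_process R d Omega) (t q s : R).

Definition sp_times S : seq R := [seq sp_time S i | i <- iota 0 (sp_size S).+1].

Lemma sp_timesP S i : (i <= sp_size S)%N -> sp_time S i \in sp_times S.
Proof. by move=> iS; apply/map_f; rewrite mem_iota add0n. Qed.

Lemma sp_times_itv t S a : is_simple F t S -> a \in sp_times S -> 0 <= a <= t.
Proof.
by move=> [h _ _] /mapP[i]; rewrite mem_iota add0n => iS ->; exact: h.
Qed.

(** Both processes are rewritten on a common refinement. The identity of integrals is stated for
    every integrator [B'], so that it covers the Brownian motion stopped at [q]. *)
Lemma simple_add S S' t (a : R) : 0 <= t <= T -> is_simple F t S ->
  is_simple F t S' -> exists S'', [/\ is_simple F t S'',
    forall s w, sp_val S'' s w = sp_val S s w + a * sp_val S' s w &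
    forall B' w, sp_integral B' S'' w = sp_integral B' S w + a * sp_integral B' S' w].
Proof.
move=> /andP[t0 tT] sS sS'.
have [|g [n [g_nd g0 gn g_itv gl]]] := exists_grid (l := sp_times S ++ sp_times S') t0.
  by move=> x; rewrite mem_cat => /orP[] /sp_times_itv; apply; eassumption.
have SG i : (i <= sp_size S)%N -> exists2 m, (m <= n)%N & sp_time S i = g m.
  by move=> iS; apply: gl; rewrite mem_cat sp_timesP.
have SG' i : (i <= sp_size S')%N -> exists2 m, (m <= n)%N & sp_time S' i = g m.
  by move=> iS; apply: gl; rewrite mem_cat sp_timesP// orbT.
pose v j w := sp_val S (g j.+1) w + a * sp_val S' (g j.+1) w.
exists (SimpleProcess n g v); split.
- split => //= i iN.
  have [m1 [c1 h1]] := sp_val_grid_coef g_nd gn sS SG usual tT iN.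
  have [m2 [c2 h2]] := sp_val_grid_coef g_nd gn sS' SG' usual tT iN.
  split.
    apply: measurable_funD => //; apply: measurable_funM => //; exact: measurable_cst.
  exists (c1 + `|a| * c2) => w; rewrite (le_trans (ler_normD _ _))//.
  by rewrite lerD// normrM ler_wpM2l.
- move=> s w; rewrite (sp_val_grid g_nd g0 gn sS SG s w).
  rewrite (sp_val_grid g_nd g0 gn sS' SG' s w) mulr_sumr -big_split/=.
  by apply: eq_bigr => j _; rewrite /v/=; ring.
- move=> B' w; rewrite (sp_integral_grid g_nd g0 sS SG B' w).
  rewrite (sp_integral_grid g_nd g0 sS' SG' B' w) mulr_sumr -big_split/=.
  by apply: eq_bigr => j _; rewrite /v/=; ring.
Qed.

(** Intervals starting after [q] collapse to the point [q]. Their coefficients are set to 0, since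
    they would not be measurable at time [q]. *)
Definition sp_restrict S q : simple_process := SimpleProcess (sp_size S)
  (fun i => Num.min (sp_time S i) q)
  (fun i w => if sp_time S i <= q then sp_coef S i w else 0).

Lemma sp_restrict_simple S t q : is_simple F t S -> 0 <= q ->
  is_simple F q (sp_restrict S q).
Proof.
move=> [h mono hc] q0; split => /= i iS.
- by have /andP[h0 _] := h i iS; rewrite le_min h0 q0 ge_min lexx orbT.
- have := mono i iS.
  by case: (ltP (sp_time S i) q) => ?; case: (ltP (sp_time S i.+1) q) => ? ?; lra.
- have [mc [c hb]] := hc i iS; case: (leP (sp_time S i) q) => [iq|_].
    by split => //; exists c.
  by split; [exact: measurable_cst|exists 0 => w; rewrite normr0].
Qed.

Lemma sp_restrict_val S t q s w : is_simple F t S -> s <= q ->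
  sp_val (sp_restrict S q) s w = sp_val S s w.
Proof.
move=> [h mono hc] sq; apply: eq_bigr => /= i _.
rewrite !indicE !mem_setE !in_itv/= gt_min le_min sq andbT.
by case: (leP (sp_time S i) q) => iq; case: (ltP (sp_time S i) s) => si;
  rewrite ?(ltNge q s) ?sq ?orbF ?andbT/= ?mulr0 ?mul0r//; lra.
Qed.

Lemma sp_restrict_integral S t q w : is_simple F t S ->
  sp_integral B (sp_restrict S q) w = stopped_integral B S q w.
Proof.
move=> [h mono hc]; apply: eq_bigr => /= i _.
case: (leP (sp_time S i) q) => iq //.
have iq' : q <= sp_time S i.+1 by rewrite (le_trans (ltW iq))// mono.
by rewrite (min_r iq') subrr !mulr0.
Qed.

Lemma stopped_integral_wrt S t q : is_simple F t S -> 0 <= q <= T ->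
  measurable_wrt (F q) (stopped_integral B S q).
Proof.
move=> [h mono hc] /andP[q0 qT]; apply: measurable_sum => i.
have [mc _] := hc i (ltn_ord i).
have /andP[ti0 _] := h i (ltnW (ltn_ord i)).
have /andP[tj0 _] := h i.+1 (ltn_ord i).
have mB a : 0 <= a -> measurable_wrt (F q) (B (Num.min a q)).
  move=> a0; have m0 : 0 <= Num.min a q by rewrite le_min a0 q0.
  have mq : Num.min a q <= q by rewrite ge_min lexx orbT.
  apply: (measurable_wrt_le usual m0 mq qT).
  by case: bm => Bad _ _ _; apply: Bad; rewrite m0 (le_trans mq).
have [iq|qi] := leP (sp_time S i) q.
  apply: measurable_funM; first exact: (measurable_wrt_le usual ti0 iq qT mc).
  by apply: measurable_funB; [exact: mB|have := mB _ ti0; rewrite min_l].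
rewrite (_ : (fun _ => _) = cst 0); first exact: measurable_cst.
apply/funext => w; have iq' : q <= sp_time S i.+1.
  by rewrite (le_trans (ltW qi))// mono.
by rewrite (min_r iq') subrr mulr0.
Qed.

Lemma stopped_integral_end S t w : is_simple F t S ->
  stopped_integral B S t w = sp_integral B S w.
Proof.
move=> [h mono hc]; apply: eq_bigr => i _.
have /andP[_ a1] := h i (ltnW (ltn_ord i)).
by have /andP[_ a2] := h i.+1 (ltn_ord i); rewrite !min_l.
Qed.

Lemma continuous_stopped_integral S t w : is_simple F t S ->
  {within `[0, T], continuous (fun s => B s w)} ->
  {within `[0, T], continuous (fun q => stopped_integral B S q w)}.
Proof.
move=> [h mono hc] cB.
apply: (@within_continuous_sum _ T (sp_size S) (fun i q => sp_coef S i w *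
  (B (Num.min (sp_time S i.+1) q) w - B (Num.min (sp_time S i) q) w))) => i iS.
have /andP[a1 _] := h i (ltnW iS).
have /andP[a2 _] := h i.+1 iS.
have /subspace_continuousP c1 := within_continuous_stop a1 cB.
have /subspace_continuousP c2 := within_continuous_stop a2 cB.
apply/subspace_continuousP => x xI.
apply: cvgMl_tmp; apply: cvgB; [exact: c2|exact: c1].
Qed.

Lemma simple_maximal S t (qs : nat -> R) (m : nat) (eps dl : R) :
  0 <= t <= T -> is_simple F t S -> (forall i, 0 <= qs i <= t) ->
  0 < eps -> 0 <= dl -> exists Z : set Omega, [/\ measurable Z,
    (P Z <= (dl / eps ^+ 2)%:E)%E & forall w i, (i < m)%N ->
     eps <= `|stopped_integral B S (qs i) w| ->
     (dl%:E < sqint (sp_val S) t w)%E \/ Z w].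
Proof.
move=> /andP[t0 tT] sS hq eps0 dl0.
have [|g [n [g_nd g0 gn g_itv gl]]] :=
    exists_grid (l := sp_times S ++ map qs (iota 0 m)) t0.
  by move=> x; rewrite mem_cat => /orP[/sp_times_itv|/mapP[i _ ->]//]; apply.
have SG i : (i <= sp_size S)%N -> exists2 k, (k <= n)%N & sp_time S i = g k.
  by move=> iS; apply: gl; rewrite mem_cat sp_timesP.
have g_itvT i : (i <= n)%N -> 0 <= g i <= T.
  by move=> /g_itv/andP[-> /le_trans ->].
have hc := sp_val_grid_coef g_nd gn sS SG usual tT.
have [Z [mZ PZ hZ]] := grid_maximal usual bm g_nd g_itvT hc eps0 dl0.
exists Z; split => // w i im.
have [k kn ->] : exists2 k, (k <= n)%N & qs i = g k.
  by apply: gl; rewrite mem_cat map_f ?orbT// mem_iota add0n.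
rewrite (stopped_integral_grid g_nd g0 sS SG B w kn) => /(hZ w k kn)[h|]; last by right.
by left; rewrite /sqint (integral_sp_val_sqr g_nd g0 gn sS SG w) lte_fin.
Qed.

(** The bound for finitely many sampling times does not depend on their number, so it passes to the
    increasing union of the events. *)
Lemma simple_maximal_countable S t (qs : nat -> R) (eps dl : R) :
  0 <= t <= T -> is_simple F t S -> (forall i, 0 <= qs i <= t) ->
  0 < eps -> 0 <= dl -> exists Z : set Omega, [/\ measurable Z,
    (P Z <= (dl / eps ^+ 2)%:E)%E & forall w i,
     eps <= `|stopped_integral B S (qs i) w| ->
     (dl%:E < sqint (sp_val S) t w)%E \/ Z w].
Proof.
move=> t0T sS hq eps0 dl0; have /andP[t0 tT] := t0T.
pose G := [set w | (sqint (sp_val S) t w <= dl%:E)%E].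
have mG : measurable G.
  rewrite /G -[X in measurable X]setTI; apply: emeasurable_fun_infty_c => //.
  apply: (measurable_sqint usual t0T).
  exact: (progressive_sp_val usual t0T sS).
pose D i := [set w | eps <= `|stopped_integral B S (qs i) w|].
have mD i : measurable (D i).
  have := @measurable_ge_event _ _ _ (fun w => (`|stopped_integral B S (qs i) w|)%:E) eps%:E.
  apply; apply/measurable_EFinP; apply: measurableT_comp => //.
  apply: (measurable_wrt_ambient usual (t := qs i)).
    by have /andP[-> /le_trans ->] := hq i.
  by apply: (stopped_integral_wrt sS); have /andP[-> /le_trans ->] := hq i.
pose A m := (\bigcup_(i in [set i | (i < m)%N]) D i) `&` G.
have mA m : measurable (A m).
  by apply: measurableI => //; apply: bigcup_measurable.
have PA m : (P (A m) <= (dl / eps ^+ 2)%:E)%E.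
  have [Z [mZ PZ hZ]] := simple_maximal m t0T sS hq eps0 dl0.
  apply: le_trans PZ; rewrite le_measure ?inE//.
  move=> w [[i /= im Di] Gw]; have [|//] := hZ w i im Di.
  by rewrite ltNge Gw.
exists (\bigcup_m A m); split.
- exact: bigcup_measurable.
- have nd : nondecreasing_seq A.
    move=> k l kl; apply/subsetPset => w [[i /= ik Di] Gw]; split => //.
    by exists i => //=; exact: leq_trans kl.
  have mU : measurable (\bigcup_m A m) by exact: bigcup_measurable.
  have c := nondecreasing_cvg_mu (mu := P) mA mU nd.
  rewrite -(cvg_lim _ c)//; apply: lime_le; first by apply/cvg_ex; eexists; exact: c.
  by apply: nearW => m; exact: PA.
- move=> w i Di; have [|Gw] := ltP dl%:E (sqint (sp_val S) t w); [by left|right].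
  by exists i.+1 => //; split => //; exists i => /=.
Qed.

End simple_process_operations.

Section almost_everywhere.
Context {d : measure_display} {T : measurableType d} {R : realType}.
Variable mu : {measure set T -> \bar R}.
Implicit Types A B C : T -> Prop.

Lemma ae_mono A B : (forall x, A x -> B x) ->
  {ae mu, forall x, A x} -> {ae mu, forall x, B x}.
Proof. by move=> AB; apply: filterS. Qed.

Lemma ae_mono2 A B C : (forall x, A x -> B x -> C x) ->
  {ae mu, forall x, A x} -> {ae mu, forall x, B x} -> {ae mu, forall x, C x}.
Proof. by move=> AB; apply: filterS2. Qed.

End almost_everywhere.

(** * Step functions, averages over the preceding cell, and approximation by simple processes *)

Section step_functions.
Context {R : realType}.
Local Notation leb := (@lebesgue_measure R).

Definition step_fun (g : nat -> R) (n : nat) (c : nat -> R) (s : R) : R :=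
  \sum_(j < n) c j * \1_(`]g j, g j.+1]%classic) s.

Variables (g : nat -> R) (n : nat).
Hypothesis g_nd : forall i, (i < n)%N -> g i <= g i.+1.

Lemma step_fun_at c j s : (j < n)%N -> g j < s <= g j.+1 -> step_fun g n c s = c j.
Proof.
move=> jn /andP[js sj]; rewrite /step_fun (bigD1 (Ordinal jn))//= big1 ?addr0.
  by rewrite indicE mem_set ?mulr1//= in_itv/= js.
move=> i /eqP ij; rewrite indicE memNset ?mulr0//= in_itv/= => /andP[is_ si].
have : (i != j :> nat) by apply/eqP => e; apply: ij; apply/val_inj.
rewrite neq_ltn => /orP[lij|lji].
  by have := le_lt_trans (grid_le g_nd lij (ltnW jn)) js; rewrite ltNge si.
by have := le_lt_trans (grid_le g_nd lji (ltnW (ltn_ord i))) is_; rewrite ltNge sj.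
Qed.

Lemma step_fun_out c s : (forall j, (j < n)%N -> ~~ (g j < s <= g j.+1)) ->
  step_fun g n c s = 0.
Proof.
move=> h; apply: big1 => j _; rewrite indicE mem_setE in_itv/=.
by rewrite (negbTE (h j (ltn_ord j))) mulr0.
Qed.

Lemma step_fun_map (phi : R -> R) c s : phi 0 = 0 ->
  phi (step_fun g n c s) = step_fun g n (phi \o c) s.
Proof.
move=> phi0.
have [[j jn hj]|h] := pselect (exists2 j, (j < n)%N & g j < s <= g j.+1).
  by rewrite !(step_fun_at _ jn hj).
rewrite !step_fun_out// => j jn; apply/negP => hj; apply: h; by exists j.
Qed.

Lemma measurable_step_fun c : measurable_fun setT (step_fun g n c).
Proof.
apply: measurable_sum => i; apply: measurable_funM; first exact: measurable_cst.
exact: measurable_indic.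
Qed.

Lemma integral_step_fun_sqr c : g 0%N = 0 ->
  (\int[leb]_(s in `[0%R, g n]) ((step_fun g n c s) ^+ 2)%:E =
   (\sum_(j < n) (c j) ^+ 2 * (g j.+1 - g j))%:E)%E.
Proof.
move=> g0.
under eq_integral do rewrite (@step_fun_map (fun x => x ^+ 2)) ?expr0n// /step_fun -sumEFin.
rewrite ge0_integral_sum//; last first.
- by move=> i s _; rewrite lee_fin mulr_ge0// sqr_ge0.
- by move=> i; apply/measurable_EFinP; apply: measurable_funM.
rewrite -sumEFin; apply: eq_bigr => j _.
under eq_integral do rewrite EFinM.
rewrite ge0_integralZl//; last 2 first.
- by apply/measurable_EFinP; exact: measurable_indic.
- by rewrite lee_fin sqr_ge0.
rewrite integral_indic// [RHS]EFinM; congr (_ * _)%E.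
rewrite setIidl; last first.
  move=> s /=; rewrite !in_itv/= => /andP[h1 h2].
  rewrite -g0 (le_trans _ (ltW h1))/=; last by rewrite (grid_le g_nd)// ltnW.
  by rewrite (le_trans h2)// (grid_le g_nd).
apply: (etrans (lebesgue_measure_itv `]g j, g j.+1])); rewrite /= lte_fin.
have := g_nd (ltn_ord j); rewrite le_eqVlt => /orP[/eqP->|->].
  by rewrite ltxx subrr.
by rewrite -EFinB.
Qed.

End step_functions.

Section previous_cell_average.
Context {R : realType}.
Local Notation leb := (@lebesgue_measure R).
Local Notation TR := (measurableTypeR R).
Implicit Types (f : TR -> R) (h t : R).

(** The cell that ends at [j h], one to the left of []j h, (j + 1) h]]. For [j = 0] it lies at
    nonpositive times, and the functions to be averaged are extended by 0 there. *)
Definition cell h (j : nat) : set R := `](j%:R - 1) * h, j%:R * h]%classic.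

Definition cell_avg h f (j : nat) : R :=
  h^-1 * \int[leb]_(r in cell h j) f r.

(* The value on ]j h, (j + 1) h] is the average over the preceding cell, so that
   averaging a progressive process gives an adapted one. *)
Definition avg_fun h (n : nat) f : R -> R :=
  step_fun (fun j => j%:R * h) n (cell_avg h f).

Lemma measurable_cell h j : measurable (cell h j : set TR).
Proof. exact: measurable_itv. Qed.

Lemma lebesgue_cell h j : 0 < h -> leb (cell h j) = h%:E.
Proof.
move=> h0; apply: (etrans (lebesgue_measure_itv `](j%:R - 1) * h, j%:R * h])).
rewrite /= lte_fin ltr_pM2r// ltrBlDl ltrDr ltr01 -EFinB; congr EFin; ring.
Qed.

Lemma integrable_sqr (D : set TR) f : measurable D -> (leb D < +oo)%E ->
  measurable_fun D f ->
  (\int[leb]_(r in D) ((f r) ^+ 2)%:E < +oo)%E ->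
  leb.-integrable D (fun r => (f r)%:E).
Proof.
move=> mD fD mf fin; apply/integrableP; split; first exact/measurable_EFinP.
apply: (@le_lt_trans _ _ (\int[leb]_(r in D) (1%:E + ((f r) ^+ 2)%:E))%E).
  apply: ge0_le_integral => //.
  - by apply/measurable_EFinP; exact: measurableT_comp.
  - by apply: emeasurable_funD => //; apply/measurable_EFinP; exact: measurable_funX.
  - by move=> r _; rewrite -EFinD lee_fin; case: (ger0P (f r)); nra.
rewrite ge0_integralD//; last 2 first.
- by move=> r _; rewrite lee_fin sqr_ge0.
- by apply/measurable_EFinP; exact: measurable_funX.
by rewrite integral_cst// mul1e lte_add_pinfty.
Qed.

(** Expansion of the nonnegative integral of [(f - m) ^+ 2] over the cell, [m] being the average; if
    the right-hand side is infinite the bound is trivial. *)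
Lemma cell_avg_jensen h f j : 0 < h -> measurable_fun setT f ->
  (((cell_avg h f j) ^+ 2 * h)%:E <= \int[leb]_(r in cell h j) ((f r) ^+ 2)%:E)%E.
Proof.
move=> h0 mf; set I := (X in (_ <= X)%E).
have mC := measurable_cell h j.
have mfC : measurable_fun (cell h j : set TR) f by exact: measurable_funTS.
have [Ify|] := ltP I +oo%E; last by move=> /(le_trans _); apply; rewrite leey.
have fC : (leb (cell h j) < +oo)%E by rewrite lebesgue_cell// ltry.
have fi := integrable_sqr mC fC mfC Ify.
set m := cell_avg h f j.
have Im : (\int[leb]_(r in cell h j) (f r)%:E = (m * h)%:E)%E.
  rewrite /m /cell_avg mulrC mulrA divff ?gt_eqF// mul1r /Rintegral fineK//.
  exact: integrable_fin_num.
have m2 : measurable_fun (cell h j : set TR) (fun r => ((f r) ^+ 2)%:E).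
  by apply/measurable_EFinP; exact: measurable_funX.
have f2i : leb.-integrable (cell h j) (fun r => ((f r) ^+ 2)%:E).
  apply/integrableP; split => //.
  by under eq_integral do rewrite gee0_abs ?lee_fin ?sqr_ge0//.
have ci : leb.-integrable (cell h j) (fun r => (m ^+ 2)%:E).
  apply/integrableP; split; first exact: measurable_cst.
  by rewrite integral_cst//= lebesgue_cell// -EFinM ltry.
have fi2 := integrableZl mC (- 2 * m) fi.
have : (0 <= \int[leb]_(r in cell h j) ((f r - m) ^+ 2)%:E)%E.
  by apply: integral_ge0 => r _; rewrite lee_fin sqr_ge0.
rewrite (eq_integral (fun r => ((f r) ^+ 2)%:E +
   (((- 2 * m)%:E * (f r)%:E) + (m ^+ 2)%:E))%E); last first.
  by move=> r _; rewrite -EFinM -!EFinD; congr EFin; ring.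
rewrite integralD//; last exact: integrableD.
rewrite integralD// integralZl// Im integral_cst//= lebesgue_cell//.
have If : I \is a fin_num by exact: integrable_fin_num.
rewrite -/I -(fineK If) -!EFinM -!EFinD !lee_fin; move: (fine I) => i; nra.
Qed.

Lemma step_grid_nd h n : 0 <= h ->
  forall i, (i < n)%N -> i%:R * h <= i.+1%:R * h.
Proof. by move=> h0 i _; rewrite ler_wpM2r// ler_nat. Qed.

(** Averaging is a contraction of L2: Jensen on each cell, and the cells are disjoint. The
    right-hand side runs over the whole line because the cell of index 0 lies to the left of 0. *)
Lemma avg_fun_sqr_le h n f : 0 < h -> measurable_fun setT f ->
  (\int[leb]_(s in `[0%R, (n%:R * h)%R]) ((avg_fun h n f s) ^+ 2)%:E <=
   \int[leb]_r ((f r) ^+ 2)%:E)%E.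
Proof.
move=> h0 mf.
have m2 : measurable_fun setT (fun r : TR => ((f r) ^+ 2)%:E).
  by apply/measurable_EFinP; exact: measurable_funX.
rewrite (integral_step_fun_sqr (step_grid_nd (n := n) (ltW h0))) ?mul0r//.
apply: (@le_trans _ _ (\sum_(j < n) \int[leb]_(r in cell h j) ((f r) ^+ 2)%:E)%E).
  rewrite -sumEFin; apply: lee_sum => j _.
  rewrite -mulrBl -natrB// subSnn mul1r; exact: cell_avg_jensen.
(* The averaging cells form the grid shifted by one step to the left; their indicators add up to at
   most 1. *)
pose g' j := (j%:R - 1) * h.
have g'_nd i : (i < n)%N -> g' i <= g' i.+1.
  move=> _; rewrite /g' ler_wpM2r ?ltW//.
  have : i%:R <= i.+1%:R :> R by rewrite ler_nat.
  lra.
have cellE j : cell h j = `]g' j, g' j.+1]%classic.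
  by rewrite /cell /g' -natr1 addrK.
under eq_bigr do rewrite integral_mkcond.
rewrite -ge0_integral_sum//; last 2 first.
- move=> j; apply/(measurable_restrictT _ (measurable_cell h j)).
  exact: measurable_funTS.
- by move=> j r _; rewrite patchE; case: ifP => // _; rewrite lee_fin sqr_ge0.
have sumE r : (\sum_(j < n) ((fun x : TR => ((f x) ^+ 2)%:E) \_ (cell h j)) r =
    (step_fun g' n (fun=> (f r) ^+ 2) r)%:E)%E.
  rewrite /step_fun -sumEFin; apply: eq_bigr => j _.
  by rewrite patchE cellE indicE; case: ifP => _; rewrite ?mulr1 ?mulr0.
apply: ge0_le_integral => //.
- by move=> r _; apply: sume_ge0 => j _; rewrite patchE; case: ifP => // _; rewrite lee_fin sqr_ge0.
- apply: emeasurable_sum => j; apply/(measurable_restrictT _ (measurable_cell h j)).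
  exact: measurable_funTS.
move=> r _; rewrite sumE lee_fin.
have [[j jn hj]|nh] := pselect (exists2 j, (j < n)%N & g' j < r <= g' j.+1).
  by rewrite (step_fun_at g'_nd _ jn hj).
rewrite step_fun_out ?sqr_ge0// => j jn; apply/negP => hj; apply: nh; by exists j.
Qed.

Lemma cell_avgB h f f' j : leb.-integrable (cell h j) (fun r => (f r)%:E) ->
  leb.-integrable (cell h j) (fun r => (f' r)%:E) ->
  cell_avg h (fun r => f r - f' r) j = cell_avg h f j - cell_avg h f' j.
Proof.
move=> i i'; rewrite /cell_avg -mulrBr; congr (_ * _).
by rewrite RintegralB//; exact: measurable_cell.
Qed.

Lemma avg_funB h n f f' s :
  (forall j, leb.-integrable (cell h j) (fun r => (f r)%:E)) ->
  (forall j, leb.-integrable (cell h j) (fun r => (f' r)%:E)) ->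
  avg_fun h n (fun r => f r - f' r) s = avg_fun h n f s - avg_fun h n f' s.
Proof.
move=> i i'; rewrite /avg_fun /step_fun -sumrB; apply: eq_bigr => j _.
by rewrite cell_avgB// mulrBl.
Qed.

Lemma cell_avg_bounded h f j (c : R) : 0 < h -> measurable_fun setT f ->
  (forall r, `|f r| <= c) -> `|cell_avg h f j| <= c.
Proof.
move=> h0 mf hc.
have mC := measurable_cell h j.
have fi : leb.-integrable (cell h j) (fun r => (f r)%:E).
  apply: measurable_bounded_integrable => //.
  - by rewrite /= lebesgue_cell// ltry.
  - exact: measurable_funTS.
  - exists c; split; first by rewrite num_real.
    by move=> M cM r _ /=; apply: (le_trans (hc r)); exact: ltW.
rewrite /cell_avg normrM gtr0_norm ?invr_gt0// ler_pdivrMl// mulrC.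
have -> : c * h = \int[leb]_(r in cell h j) c.
  by rewrite Rintegral_cst//= lebesgue_cell.
apply: (le_trans (le_normr_Rintegral mC fi)).
apply: le_Rintegral => //.
- have := integrable_abse fi; congr (integrable _ _ _).
- apply/integrableP; split; first exact: measurable_cst.
  by rewrite integral_cst//= lebesgue_cell// -EFinM ltry.
Qed.

(** Lebesgue differentiation: the preceding cell does not contain [s], but it stays within a
    distance proportional to its length, which is all that a nicely shrinking family requires. *)
Lemma cvg_avg_fun_ae (t : R) f : 0 < t -> leb.-integrable setT (fun r => (f r)%:E) ->
  {ae leb, forall s, 0 < s <= t ->
    avg_fun (t / k.+1%:R) k.+1 f s @[k --> \oo] --> f s}.
Proof.
move=> t0 fi.
pose h k : R := t / k.+1%:R.
have h0 k : 0 < h k by rewrite divr_gt0.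
(* For [x] outside the grid an arbitrary interval of the same length keeps the family nicely
   shrinking at every point. *)
pose E (x : R) (k : nat) : set R :=
  if [pick j : 'I_k.+1 | (j%:R * h k < x <= j.+1%:R * h k)] is Some j
  then cell (h k) j else `]x - h k, x]%classic.
have measE x k : lebesgue_measure (E x k) = (h k)%:E.
  rewrite /E; case: pickP => [j _|_]; first exact: lebesgue_cell.
  apply: (etrans (lebesgue_measure_itv `]x - h k, x])).
  by rewrite /= lte_fin gtrBl h0 -EFinB; congr EFin; ring.
have cvgh : h k @[k --> \oo] --> (0 : R).
  rewrite -(mulr0 t); apply: cvgMl_tmp; exact: cvg_harmonic.
have nice x : nicely_shrinking x (E x).
  split.
    by move=> k; rewrite /E; case: pickP => *; exact: measurable_itv.
  have h3 k : 0 < 3 * h k by rewrite mulr_gt0.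
  (* The preceding cell lies within distance [2 h] of [x], hence in the ball of radius [3 h], whose
     measure [6 h] is 6 times that of the cell. *)
  exists (6, fun k => PosNum (h3 k)); split => //=.
  - by rewrite -[X in _ --> X](mulr0 3); apply: cvgMl_tmp.
  - move=> k; rewrite /E; case: pickP => [j /andP[jx xj]|_] r /=.
      rewrite /cell /= in_itv/= ball_itv/= in_itv/= => /andP[r1 r2].
      have : j.+1%:R = j%:R + 1 :> R by rewrite -natr1.
      by move=> e; rewrite e in xj; apply/andP; split; have := h0 k; nra.
    rewrite ball_itv/= !in_itv/= => /andP[r1 r2].
    by apply/andP; split; have := h0 k; lra.
  - move=> k; rewrite measE.
    have -> : lebesgue_measure (ball x (3 * h k)) = ((3 * h k) *+ 2)%:E.
      by rewrite lebesgue_measure_ball// ltW.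
    rewrite [leRHS](_ : _ = (6 * h k)%:E) ?EFinM// lee_fin.
    by rewrite -/(h k) -mulr_natr; move: (h k) => u; lra.
have loc : locally_integrable setT f.
  by apply: open_integrable_locally => //; exact: openT.
apply: ae_mono (lebesgue_differentiation loc) => s ps /andP[s0 st].
have := nice_lebesgue_differentiation nice loc ps.
move=> /fine_cvgP[_].
suff -> : (fine \o (fun k => (lebesgue_measure (E s k))^-1 *
    \int[lebesgue_measure]_(y in E s k) (f y)%:E)%E) =
    (fun k => avg_fun (t / k.+1%:R) k.+1 f s) by [].
apply/funext => k /=; rewrite measE inver gt_eqF//.
rewrite /E; case: pickP => [j hj|]; last first.
  (* s lies in the cell of index ceil (s / h) - 1 *)
  have : exists j : nat, s <= j.+1%:R * h k.
    exists k; rewrite /h; apply: (le_trans st).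
    by rewrite mulrC divfK// pnatr_eq0.
  move=> ex; case: (ex_minnP ex) => j sj hmin.
  have jk : (j < k.+1)%N.
    rewrite ltnS; apply: hmin; apply: (le_trans st).
    by rewrite /h mulrC divfK// pnatr_eq0.
  move=> /(_ (Ordinal jk))/= /negbT; rewrite sj andbT -leNgt => js.
  exfalso; case: j sj hmin jk js => [|j] sj hmin jk js.
    by move: js; rewrite mul0r leNgt s0.
  by have := hmin j js; rewrite ltnn.
rewrite /avg_fun (step_fun_at (step_grid_nd (ltW (h0 k))) _ (ltn_ord j) hj).
rewrite /cell_avg -/(h k) /Rintegral.
have : (\int[lebesgue_measure]_(y in cell (h k) j) (f y)%:E)%E \is a fin_num.
  apply: integrable_fin_num; first exact: measurable_cell.
  by apply: (integrableS measurableT _ _ fi) => //; exact: measurable_cell.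
by move=> /fineK <-.
Qed.

End previous_cell_average.

Lemma sqrD_le2 (R : realType) (a b : R) : (a + b) ^+ 2 <= 2 * (a ^+ 2 + b ^+ 2).
Proof. by rewrite -subr_ge0 (_ : _ - _ = (a - b) ^+ 2) ?sqr_ge0//; ring. Qed.

Lemma sqrB_le2 (R : realType) (a b c : R) :
  (a - c) ^+ 2 <= 2 * ((a - b) ^+ 2 + (b - c) ^+ 2).
Proof. by rewrite (_ : a - c = (a - b) + (b - c)) ?sqrD_le2//; ring. Qed.

Section L2_approximation.
Context {R : realType}.
Local Notation leb := (@lebesgue_measure R).
Local Notation TR := (measurableTypeR R).
Implicit Types (f : TR -> R) (h t : R) (D : set TR).

Lemma L2_le2 D f f1 f2 (c : R) : 0 <= c -> measurable D ->
  measurable_fun D f -> measurable_fun D f1 -> measurable_fun D f2 ->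
  (forall s, D s -> (f s) ^+ 2 <= c * ((f1 s) ^+ 2 + (f2 s) ^+ 2)) ->
  (\int[leb]_(s in D) ((f s) ^+ 2)%:E <=
   c%:E * (\int[leb]_(s in D) ((f1 s) ^+ 2)%:E + \int[leb]_(s in D) ((f2 s) ^+ 2)%:E))%E.
Proof.
move=> c0 mD mf m1 m2 h.
have ms (u : TR -> R) : measurable_fun D u -> measurable_fun D (fun s => ((u s) ^+ 2)%:E).
  by move=> mu; apply/measurable_EFinP; exact: measurable_funX.
have s0 (u : TR -> R) s : D s -> (0 <= ((u s) ^+ 2)%:E :> \bar R)%E.
  by move=> _; rewrite lee_fin sqr_ge0.
rewrite -ge0_integralD//; [|exact: s0|exact: ms|exact: s0|exact: ms].
rewrite -ge0_integralZl//; last 2 first.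
- by apply: emeasurable_funD; exact: ms.
- by move=> s _; rewrite adde_ge0// lee_fin sqr_ge0.
apply: ge0_le_integral => //.
- exact: s0.
- exact: ms.
- by apply: emeasurable_funM => //; apply: emeasurable_funD; exact: ms.
Qed.

(** Truncation to [[- c, c]]. The coefficients of a simple process must be bounded, while cell
    averages of square integrable paths are not bounded uniformly in the path. *)
Definition clip (c x : R) : R := Num.max (- c) (Num.min c x).

Lemma clip0 c : 0 <= c -> clip c 0 = 0.
Proof. by move=> c0; rewrite /clip min_r// max_r// oppr_le0. Qed.

Lemma clip_bound c x : 0 <= c -> `|clip c x| <= c.
Proof.
move=> c0; rewrite ler_norml /clip le_max lexx/= ge_max ge_min lexx.
by rewrite andbT (le_trans _ c0)// oppr_le0.
Qed.

Lemma clip_id c x : `|x| <= c -> clip c x = x.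
Proof.
by rewrite ler_norml => /andP[cx xc]; rewrite /clip min_r// max_r.
Qed.

Lemma clip_lip c x y : `|clip c x - clip c y| <= `|x - y|.
Proof.
have h1 : x - y <= `|x - y| by exact: ler_norm.
have h2 : y - x <= `|x - y| by rewrite distrC; exact: ler_norm.
rewrite /clip ler_norml; move: (`|x - y|) h1 h2 => d h1 h2.
by case: (leP c x) => cx; case: (leP c y) => cy;
  [case: (leP (- c) c)|case: (leP (- c) c); case: (leP (- c) y)|
   case: (leP (- c) c); case: (leP (- c) x)|
   case: (leP (- c) x); case: (leP (- c) y)] => *; apply/andP; split; lra.
Qed.

Lemma clip_sqr_le c x : 0 <= c -> (clip c x) ^+ 2 <= x ^+ 2.
Proof.
move=> c0; rewrite -[leLHS]real_normK ?num_real// -[leRHS]real_normK ?num_real//.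
rewrite lerXn2r ?nnegrE//.
by have := clip_lip c x 0; rewrite clip0// !subr0.
Qed.

Lemma clip_sub_sqr_le c x : 0 <= c -> (clip c x - x) ^+ 2 <= x ^+ 2.
Proof.
move=> c0; rewrite /clip /Num.max /Num.min.
by case: (ltP c x) => ?; case: ltP => ?; nra.
Qed.

Lemma measurable_clip c : measurable_fun setT (clip c : R -> R).
Proof.
apply: measurable_maxr; first exact: measurable_cst.
by apply: measurable_minr; [exact: measurable_cst|exact: measurable_id].
Qed.

Lemma cvg_clip_L2 D f : measurable D -> measurable_fun D f ->
  (\int[leb]_(s in D) ((f s) ^+ 2)%:E < +oo)%E ->
  ((\int[leb]_(s in D) ((clip k%:R (f s) - f s) ^+ 2)%:E)%E @[k --> \oo] --> 0%E).
Proof.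
move=> mD mf fin.
have mf2 : measurable_fun D (fun s => ((f s) ^+ 2)%:E).
  by apply/measurable_EFinP; exact: measurable_funX.
have := @dominated_convergence _ TR R leb D mD
  (fun k s => ((clip k%:R (f s) - f s) ^+ 2)%:E) (cst 0%E) (fun s => ((f s) ^+ 2)%:E).
move=> /(_ _ _ _ _ _) h.
rewrite -[X in _ --> X](integral0 leb D); have [] := h => //.
- move=> k; apply/measurable_EFinP; apply: measurable_funX; apply: measurable_funB => //.
  by apply: measurableT_comp mf; exact: measurable_clip.
- apply: aeW => s Ds; apply: cvg_near_cst.
  have [N hN] : exists N : nat, `|f s| <= N%:R.
    by exists (Num.truncn `|f s|).+1; apply/ltW/truncnS_gt.
  exists N => // k /= Nk; rewrite clip_id ?subrr ?expr0n//.
  by rewrite (le_trans hN)// ler_nat.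
- apply/integrableP; split => //.
  by under eq_integral do rewrite gee0_abs ?lee_fin ?sqr_ge0//.
- by apply: aeW => s k Ds; rewrite gee0_abs ?lee_fin ?sqr_ge0// clip_sub_sqr_le.
Qed.

Section fixed_horizon.
Variables (t : R) (f : TR -> R).
Hypotheses (t0 : 0 < t) (mf : measurable_fun setT f).
Hypothesis f_supp : forall r, ~~ (0 <= r <= t) -> f r = 0.
Hypothesis f_L2 : (\int[leb]_r ((f r) ^+ 2)%:E < +oo)%E.

Let D : set TR := `[0, t]%classic.
Let mD : measurable D. Proof. exact: measurable_itv. Qed.
Let Dfin : (leb D < +oo)%E.
Proof.
rewrite /D (_ : leb _ = (t - 0)%:E) ?ltry//.
by apply: (etrans (lebesgue_measure_itv `[0, t])); rewrite /= lte_fin t0 -EFinB.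
Qed.

Let h k : R := t / k.+1%:R.
Let h0 k : 0 < h k. Proof. by rewrite divr_gt0. Qed.
Let hk k : k.+1%:R * h k = t.
Proof. by rewrite mulrC divfK// pnatr_eq0. Qed.

Let A k (u : TR -> R) := avg_fun (h k) k.+1 u.

Let mA k u : measurable_fun setT (A k u : TR -> R).
Proof. exact: measurable_step_fun. Qed.

Let A_sqr_le k u : measurable_fun setT u ->
  (\int[leb]_(s in D) ((A k u s) ^+ 2)%:E <= \int[leb]_r ((u r) ^+ 2)%:E)%E.
Proof. by move=> mu; have := avg_fun_sqr_le k.+1 (h0 k) mu; rewrite hk. Qed.

Let integrable_supp (u : TR -> R) : measurable_fun setT u ->
  (forall r, ~~ (0 <= r <= t) -> u r = 0) ->
  (\int[leb]_r ((u r) ^+ 2)%:E < +oo)%E ->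
  leb.-integrable setT (fun r => (u r)%:E).
Proof.
move=> mu us u2.
have uD : leb.-integrable D (fun r => (u r)%:E).
  apply: integrable_sqr => //; first exact: measurable_funTS.
  apply: le_lt_trans u2; apply: ge0_subset_integral => //.
    by apply/measurable_EFinP; exact: measurable_funX.
  by move=> r _; rewrite lee_fin sqr_ge0.
have := (integrable_mkcond (fun r => (u r)%:E) mD).1 uD.
congr (integrable _ _ _); apply/funext => r; rewrite patchE.
case: ifPn => // /negP rD; rewrite us//; apply/negP => rt; apply: rD.
by apply/mem_set; rewrite /D/= in_itv.
Qed.

Let cvg_A_bounded (u : TR -> R) (c : R) : measurable_fun setT u ->
  (forall r, ~~ (0 <= r <= t) -> u r = 0) -> (forall r, `|u r| <= c) ->
  leb.-integrable setT (fun r => (u r)%:E) ->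
  ((\int[leb]_(s in D) ((A k u s - u s) ^+ 2)%:E)%E @[k --> \oo] --> 0%E).
Proof.
move=> mu us uc ui.
have c0 : 0 <= c by apply: le_trans (uc 0).
have := @dominated_convergence _ TR R leb D mD
  (fun k s => ((A k u s - u s) ^+ 2)%:E) (cst 0%E) (fun s => ((2 * c) ^+ 2)%:E).
move=> /(_ _ _ _ _ _) hh.
rewrite -[X in _ --> X](integral0 leb D); have [] := hh => //.
- move=> k; apply/measurable_EFinP; apply: measurable_funX; apply: measurable_funTS.
  by apply: measurable_funB => //; exact: mA.
(* The point 0 belongs to no cell, the cells being open on the left. *)
- have ne0 : {ae leb, forall s : TR, s != 0 :> R}.
    exists [set 0]; split; [exact: measurable_set1|exact: lebesgue_measure_set1|].
    by move=> s /= /negP; rewrite negbK => /eqP.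
  apply: (ae_mono2 _ ne0 (cvg_avg_fun_ae t0 ui)) => s sn0 hs.
  rewrite /D/= in_itv/= => /andP[s0 st].
  have {}hs := hs _; rewrite lt_neqAle eq_sym sn0 s0 st in hs.
  have {}hs := hs isT.
  apply/fine_cvgP; split; first by apply: nearW.
  rewrite /= (_ : 0 = (u s - u s) ^+ 2); last by rewrite subrr expr0n.
  rewrite /comp/=; under eq_fun do rewrite expr2; rewrite expr2.
  by apply: cvgM; (apply: cvgB; [exact: hs|exact: cvg_cst]).
- apply/integrableP; split; first exact: measurable_cst.
  by rewrite integral_cst// lte_mul_pinfty// lee_fin normr_ge0.
- apply: aeW => s k Ds; rewrite gee0_abs ?lee_fin ?sqr_ge0//.
  have Ac : `|A k u s| <= c.
    have nd := step_grid_nd (n := k.+1) (ltW (h0 k)).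
    rewrite /A /avg_fun.
    have [[j jn hj]|nh] := pselect (exists2 j, (j < k.+1)%N & j%:R * h k < s <= j.+1%:R * h k).
      by rewrite (step_fun_at nd _ jn hj) cell_avg_bounded.
    rewrite step_fun_out ?normr0// => j jn; apply/negP => hj; apply: nh; by exists j.
  rewrite -real_normK ?num_real// lerXn2r ?nnegrE ?mulr_ge0//.
  by rewrite (le_trans (ler_normB _ _))// mulr_natl lerD.
Qed.

(** Density argument: almost everywhere convergence gives L2 convergence for bounded functions only.
    So [f] is first truncated, and the contraction property controls the average of the remainder
    uniformly in [k]. *)
Lemma cvg_avg_fun_L2 :
  ((\int[leb]_(s in D) ((A k f s - f s) ^+ 2)%:E)%E @[k --> \oo] --> 0%E).
Proof.
apply/cvge0_leP => [k|e e0].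
  by apply: integral_ge0 => s _; rewrite lee_fin sqr_ge0.
(* Three errors of size at most [e'] are combined by two applications of [sqrD_le2], at a cost of
   [10 e']. *)
pose e' := e / 12.
have e'0 : 0 < e' by rewrite divr_gt0.
have mc N : measurable_fun setT (fun r : TR => clip N%:R (f r)).
  by apply: measurableT_comp mf; exact: measurable_clip.
have := cvg_clip_L2 measurableT mf f_L2 => /cvge0_leP h1.
have /h1 h1' : forall n, (0 <= \int[leb]_s ((clip n%:R (f s) - f s) ^+ 2)%:E)%E.
  by move=> n; apply: integral_ge0 => s _; rewrite lee_fin sqr_ge0.
have [N hN] := h1' e' e'0; have {}hN := hN N (leqnn N).
pose u (r : TR) := clip N%:R (f r).
have us r : ~~ (0 <= r <= t) -> u r = 0.
  by move=> /f_supp; rewrite /u => ->; rewrite clip0// ler0n.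
have u2 : (\int[leb]_r ((u r) ^+ 2)%:E < +oo)%E.
  apply: le_lt_trans f_L2; apply: ge0_le_integral => //.
  - by move=> r _; rewrite lee_fin sqr_ge0.
  - by apply/measurable_EFinP; apply: measurable_funX; exact: mc.
  - by apply/measurable_EFinP; exact: measurable_funX.
  - by move=> r _; rewrite lee_fin clip_sqr_le// ler0n.
have ui := integrable_supp (mc N) us u2.
have fi := integrable_supp mf f_supp f_L2.
have := @cvg_A_bounded u N%:R (mc N) us _ ui.
move=> /(_ (fun r => clip_bound (f r) (ler0n _ N))) /cvge0_leP h2.
have /h2 h2' : forall n, (0 <= \int[leb]_(s in D) ((A n u s - u s) ^+ 2)%:E)%E.
  by move=> n; apply: integral_ge0 => s _; rewrite lee_fin sqr_ge0.
have [K hK] := h2' e' e'0; exists K => k /hK{}hK.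
pose v (r : TR) := u r - f r.
have mv : measurable_fun setT v by apply: measurable_funB => //; exact: mc.
have mu : measurable_fun setT u by exact: mc.
have icell (w : TR -> R) : leb.-integrable setT (fun r => (w r)%:E) ->
    forall j, leb.-integrable (cell (h k) j) (fun r => (w r)%:E).
  by move=> wi j; apply: (integrableS measurableT _ _ wi) => //; exact: measurable_cell.
have Av s : A k v s = A k u s - A k f s.
  by rewrite /A avg_funB//; exact: icell.
have vD : (\int[leb]_(s in D) ((v s) ^+ 2)%:E <= e'%:E)%E.
  apply: le_trans hN; apply: ge0_subset_integral => //.
    by apply/measurable_EFinP; exact: measurable_funX.
  by move=> r _; rewrite lee_fin sqr_ge0.
have AvD : (\int[leb]_(s in D) ((A k v s) ^+ 2)%:E <= e'%:E)%E.
  exact: le_trans (A_sqr_le k mv) hN.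
have mT w : measurable_fun setT w -> measurable_fun D (w : TR -> R).
  by move=> mw; exact: measurable_funTS.
have step1 : (\int[leb]_(s in D) ((A k u s - u s + v s) ^+ 2)%:E <=
    2%:E * (e'%:E + e'%:E))%E.
  apply: (le_trans (L2_le2 (f1 := fun s => A k u s - u s) (f2 := v) (c := 2) _ mD _ _ _ _)) => //.
  - apply: mT; apply: measurable_funD => //; apply: measurable_funB => //; exact: mA.
  - apply: mT; apply: measurable_funB => //; exact: mA.
  - exact: mT.
  - by move=> s _; exact: sqrD_le2.
  by rewrite lee_wpmul2l ?lee_fin// leeD.
apply: (le_trans (L2_le2 (f1 := fun s => A k u s - u s + v s) (f2 := A k v) (c := 2) _ mD _ _ _ _)) => //.
- apply: mT; apply: measurable_funB => //; exact: mA.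
- apply: mT; apply: measurable_funD => //; apply: measurable_funB => //; exact: mA.
- apply: mT; exact: mA.
- move=> s _; rewrite (_ : A k f s - f s = (A k u s - u s + v s) + - A k v s).
    by rewrite (le_trans (sqrD_le2 _ _))// sqrrN.
  by rewrite Av /v; ring.
apply: (@le_trans _ _ (2%:E * (2%:E * (e'%:E + e'%:E) + e'%:E))%E).
  by rewrite lee_wpmul2l ?lee_fin// leeD.
change ((2 * (2 * (e' + e') + e'))%:E <= e%:E)%E; rewrite lee_fin /e'; lra.
Qed.

(** Mesh and clipping level are driven by the same index. As [clip] is 1-Lipschitz, clipping the
    average differs from clipping [f] by at most the error of averaging. *)
Lemma cvg_clip_avg_fun_L2 :
  ((\int[leb]_(s in D) ((clip k%:R (A k f s) - f s) ^+ 2)%:E)%E @[k --> \oo] --> 0%E).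
Proof.
have mfD : measurable_fun D f by exact: measurable_funTS.
have f2D : (\int[leb]_(s in D) ((f s) ^+ 2)%:E < +oo)%E.
  apply: le_lt_trans f_L2; apply: ge0_subset_integral => //.
    by apply/measurable_EFinP; exact: measurable_funX.
  by move=> r _; rewrite lee_fin sqr_ge0.
have c1 := cvg_clip_L2 mD mfD f2D.
have c2 := cvg_avg_fun_L2.
apply: (@squeeze_cvge _ _ _ _ (cst 0%E) _ (fun k => 2%:E *
  (\int[leb]_(s in D) ((A k f s - f s) ^+ 2)%:E +
   \int[leb]_(s in D) ((clip k%:R (f s) - f s) ^+ 2)%:E))%E); last 2 first.
- exact: cvg_cst.
- rewrite -(mule0 2%:E) -[X in (_ * X)%E](adde0 0%E).
  by apply: cvgeZl => //; apply: cvgeD.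
apply: nearW => k; apply/andP; split.
  by apply: integral_ge0 => s _; rewrite lee_fin sqr_ge0.
have mcl (w : TR -> R) : measurable_fun D w -> measurable_fun D (fun s => clip k%:R (w s)).
  by move=> mw; apply: measurableT_comp mw; exact: measurable_clip.
have mAD : measurable_fun D (A k f : TR -> R) by apply: measurable_funTS; exact: mA.
apply: L2_le2 => //.
- by apply: measurable_funB => //; exact: mcl.
- by apply: measurable_funB.
- by apply: measurable_funB => //; exact: mcl.
move=> s _; have := clip_lip k%:R (A k f s) (f s).
rewrite -ler_sqr ?nnegrE// !real_normK ?num_real// => lip.
by apply: (le_trans (sqrB_le2 _ (clip k%:R (f s)) _)); rewrite ler_wpM2l// lerD2r.
Qed.

Lemma clip_avg_fun_sqr_le k :
  (\int[leb]_(s in D) ((clip k%:R (A k f s)) ^+ 2)%:E <= \int[leb]_r ((f r) ^+ 2)%:E)%E.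
Proof.
apply: le_trans (A_sqr_le k mf); apply: ge0_le_integral => //.
- by move=> r _; rewrite lee_fin sqr_ge0.
- apply/measurable_EFinP; apply: measurable_funX; apply: measurable_funTS.
  by apply: measurableT_comp (mA k f); exact: measurable_clip.
- by apply/measurable_EFinP; apply: measurable_funX; apply: measurable_funTS; exact: mA.
- by move=> r _; rewrite lee_fin clip_sqr_le// ler0n.
Qed.

End fixed_horizon.
End L2_approximation.

Section simple_approximation.
Context {R : realType} {d : measure_display} {Omega : measurableType d}.
Local Notation leb := (@lebesgue_measure R).
Local Notation TR := (measurableTypeR R).
Variable F : R -> set_system Omega.
Variables (H : R -> Omega -> R) (t : R).
Hypotheses (t0 : 0 < t) (pH : progressive F t H).

Let path (w : Omega) (r : TR) : R := if (0 <= r <= t)%R then H r w else 0.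

Let pathE w : path w = ((fun r => H r w) \_ (`[0, t]%classic)).
Proof.
by apply/funext => r; rewrite /path patchE mem_setE in_itv.
Qed.

Let measurable_path w : measurable_fun setT (path w).
Proof.
have mD : measurable (`[0, t]%classic : set TR) by exact: measurable_itv.
rewrite pathE; apply/(measurable_restrictT _ mD).
exact: (progressive_section w (ltW t0) pH).
Qed.

Let path_supp w r : ~~ (0 <= r <= t) -> path w r = 0.
Proof. by rewrite /path => /negbTE ->. Qed.

Let path_sqr w : (\int[leb]_r ((path w r) ^+ 2)%:E = sqint H t w)%E.
Proof.
rewrite /sqint [RHS]integral_mkcond; apply: eq_integral => r _.
rewrite patchE mem_setE in_itv/= /path.
by case: ifP => //; rewrite expr0n.
Qed.

Let h k : R := t / k.+1%:R.
Let h0 k : 0 < h k. Proof. by rewrite divr_gt0. Qed.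
Let hk k : k.+1%:R * h k = t.
Proof. by rewrite mulrC divfK// pnatr_eq0. Qed.

Let time_itv k j : (j <= k.+1)%N -> 0 <= j%:R * h k <= t.
Proof.
move=> jk; rewrite mulr_ge0//= ?(ltW (h0 k))//.
by rewrite -(hk k) ler_wpM2r ?ler_nat// ltW.
Qed.

(** The cell of index [j] ends at [j h], so only values of [H] up to that time enter; the averages
    of an adapted process are known when they are put to use. *)
Let measurable_cell_avg k j : (j <= k.+1)%N ->
  measurable_wrt (F (j%:R * h k)) (fun w => cell_avg (h k) (path w) j).
Proof.
move=> jk; have /andP[u0 ut] := time_itv jk.
set u := j%:R * h k in u0 ut *.
apply: measurable_funM; first exact: measurable_cst.
pose D : set TR := cell (h k) j `&` `[0, u]%classic.
have mD : measurable D by apply: measurableI; [exact: measurable_cell|exact: measurable_itv].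
rewrite (_ : (fun w => _) = fun w => fine (\int[leb]_(r in D) (H r w)%:E)%E); last first.
  apply/funext => w; rewrite /Rintegral; congr fine.
  rewrite integral_mkcond [RHS]integral_mkcond; apply: eq_integral => r _.
  rewrite !patchE /D in_setI; case: ifPn => //= rc.
  have ru : r <= u by move: rc; rewrite inE /cell/= in_itv/= => /andP[].
  rewrite mem_setE in_itv/= ru andbT /path (le_trans ru ut) andbT.
  by case: ifP.
apply: measurableT_comp; first exact: (@fine_measurable R setT measurableT).
apply: (measurable_integral_progressive (t := u)) => //.
- by move=> r [].
- by apply/measurable_EFinP; apply: pH; rewrite u0.
Qed.

Let S k : @simple_process R d Omega := SimpleProcess k.+1 (fun j => j%:R * h k)
  (fun j w => clip k%:R (cell_avg (h k) (path w) j)).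

Let S_simple k : is_simple F t (S k).
Proof.
split => /= i ik; first exact: time_itv.
- by rewrite ler_wpM2r ?ler_nat// ltW.
- split.
    apply: (measurableT_comp (measurable_clip k%:R)).
    by apply: measurable_cell_avg; exact: ltnW.
  by exists k%:R => w; apply: clip_bound; rewrite ler0n.
Qed.

Let S_val k s w : sp_val (S k) s w = clip k%:R (avg_fun (h k) k.+1 (path w) s).
Proof.
rewrite /avg_fun (@step_fun_map _ _ _ (step_grid_nd (ltW (h0 k))) (clip k%:R))//.
by rewrite clip0// ler0n.
Qed.

(** Convergence holds for each path of finite square integral. The last bound, a consequence of the
    contraction property, provides the domination used for second moments and means. *)
Lemma simple_approximation_gt0 : exists S : nat -> @simple_process R d Omega,
  [/\ forall k, is_simple F t (S k),
      forall w, (sqint H t w < +oo)%E ->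
        (fun k => sqint (fun s w => sp_val (S k) s w - H s w) t w) @ \oo --> 0%E &
      forall k w, (sqint (sp_val (S k)) t w <= sqint H t w)%E].
Proof.
exists S; split => // [w fw|k w].
- have fw' : (\int[leb]_r ((path w r) ^+ 2)%:E < +oo)%E by rewrite path_sqr.
  have c := cvg_clip_avg_fun_L2 t0 (measurable_path w) (@path_supp w) fw'.
  apply: cvg_trans c; apply: near_eq_cvg; apply: nearW => k.
  apply: eq_integral => s; rewrite inE/= in_itv/= => st.
  by rewrite S_val /path st.
- have := clip_avg_fun_sqr_le t0 (measurable_path w) k.
  rewrite path_sqr; apply: le_trans; rewrite le_eqVlt; apply/orP; left; apply/eqP.
  by apply: eq_integral => s _; rewrite S_val.
Qed.

End simple_approximation.

Lemma simple_approximation (R : realType) (d : measure_display)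
    (Omega : measurableType d) (F : R -> set_system Omega) (H : R -> Omega -> R) (t : R) :
  0 <= t -> progressive F t H ->
  exists S : nat -> @simple_process R d Omega,
  [/\ forall k, is_simple F t (S k),
      forall w, (sqint H t w < +oo)%E ->
        (fun k => sqint (fun s w => sp_val (S k) s w - H s w) t w) @ \oo --> 0%E &
      forall k w, (sqint (sp_val (S k)) t w <= sqint H t w)%E].
Proof.
(* For [t = 0] the mesh would degenerate, but every square integral over a point is 0 and the empty
   simple process serves. *)
rewrite le_eqVlt => /orP[/eqP <- pH|]; last first.
  by move=> t0 pH; exact: (simple_approximation_gt0 t0 pH).
have z (G : R -> Omega -> R) w : sqint G 0 w = 0%E.
  by rewrite /sqint set_itv1 integral_set1.
exists (fun=> SimpleProcess 0 (fun=> 0) (fun=> cst 0)); split.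
- by move=> k; split => //= i _; rewrite lexx.
- move=> w _; rewrite (_ : (fun k => _) = cst 0%E); first exact: cvg_cst.
  by apply/funext => k; rewrite z.
- by move=> k w; rewrite !z.
Qed.

(** * The Ito integral *)

Section ito_calculus.
Context {R : realType} {d : measure_display} {Omega : measurableType d}.
Local Notation leb := (@lebesgue_measure R).
Variables (P : probability Omega R) (T : R) (F : R -> set_system Omega).
Variable B : R -> Omega -> R.
Hypothesis usual : usual_conditions P F T.
Hypothesis bm : brownian_motion P F T B.
Implicit Types (H : R -> Omega -> R) (t s : R) (I : Omega -> R).

Local Notation ito := (is_ito_integral P F B).

Lemma ito_progressive H t I : ito H t I -> progressive F t H.
Proof. by case. Qed.

Lemma ito_sqint_lty H t I : ito H t I -> {ae P, forall w, (sqint H t w < +oo)%E}.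
Proof. by case. Qed.

Lemma ito_wrt H t I : ito H t I -> measurable_wrt (F t) I.
Proof. by case. Qed.

Lemma ito_measurable H t I : 0 <= t <= T -> ito H t I -> measurable_fun setT I.
Proof. by move=> t0T /ito_wrt; exact: (measurable_wrt_ambient usual). Qed.

Lemma sp_integral_wrt (S : simple_process) t : 0 <= t <= T -> is_simple F t S ->
  measurable_wrt (F t) (sp_integral B S).
Proof.
move=> t0T sS; have := stopped_integral_wrt usual bm sS t0T.
congr (measurable_wrt _ _); apply/funext => w; exact: (stopped_integral_end B w sS).
Qed.

Let measurable_dist_sp H t (S : simple_process) : 0 <= t <= T ->
  progressive F t H -> is_simple F t S ->
  measurable_fun setT (sqint (fun s w => sp_val S s w - H s w) t).
Proof.
move=> t0T pH sS; apply: (measurable_sqint usual t0T); apply: progressiveB => //.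
exact: (progressive_sp_val usual t0T).
Qed.

Let measurable_dist_int t (S : simple_process) I : 0 <= t <= T ->
  measurable_fun setT I -> is_simple F t S ->
  measurable_fun setT (fun w => (`|sp_integral B S w - I w|)%:E).
Proof.
move=> t0T mI sS; apply/measurable_EFinP; apply: measurableT_comp => //.
apply: measurable_funB => //; apply: (measurable_wrt_ambient usual t0T).
exact: sp_integral_wrt.
Qed.

(* Lenglart's inequality. Restricting it to an event D is what makes the integral
   local, see [ito_eq_on]. *)
Lemma ito_tail_le H t I (D : set Omega) (eps dl : R) : 0 <= t <= T ->
  ito H t I -> measurable D -> 0 < eps -> 0 < dl ->
  (P (D `&` [set w | (2 * eps)%:E <= (`|I w|)%:E]) <=
   P (D `&` [set w | dl%:E <= sqint H t w]) + (4 * dl / eps ^+ 2)%:E)%E.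
Proof.
move=> t0T [pH _ mIt [S [sS cS cI]]] mD eps0 dl0.
have mI := measurable_wrt_ambient usual t0T mIt.
have t0 : 0 <= t by case/andP: t0T.
have mA : measurable [set w | (2 * eps)%:E <= (`|I w|)%:E]%E.
  by apply: measurable_ge_event; apply/measurable_EFinP; exact: measurableT_comp.
have mQ : measurable [set w | dl%:E <= sqint H t w]%E.
  by apply: measurable_ge_event; exact: (measurable_sqint usual t0T).
apply/lee_addgt0Pr => e e0.
have e20 : 0 < e / 2 by rewrite divr_gt0.
have := cS dl dl0 => /cvge0_leP h1.
have := cI eps eps0 => /cvge0_leP h2.
have [N1 hN1] := h1 (fun=> measure_ge0 _ _) _ e20.
have [N2 hN2] := h2 (fun=> measure_ge0 _ _) _ e20.
pose n := maxn N1 N2.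
have {}hN1 := hN1 n (leq_maxl _ _).
have {}hN2 := hN2 n (leq_maxr _ _).
pose G s w := sp_val (S n) s w - H s w.
have m1 : measurable [set w | dl%:E <= sqint G t w]%E.
  by apply: measurable_ge_event; exact: measurable_dist_sp.
have m2 : measurable [set w | eps%:E <= (`|sp_integral B (S n) w - I w|)%:E]%E.
  by apply: measurable_ge_event; exact: (measurable_dist_int t0T mI (sS n)).
(* Off the bad events both [H] and the approximation error have square integral below [dl], so that
   of the simple process is at most [2 (dl + dl)]. *)
have dl40 : 0 <= 4 * dl by rewrite mulr_ge0// ltW.
have qs0 : forall i : nat, 0 <= (fun _ : nat => t) i <= t by move=> _; rewrite t0 lexx.
have [Z [mZ PZ hZ]] := simple_maximal usual bm 1 t0T (sS n) qs0 eps0 dl40.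
set A1 := [set w | (2 * eps)%:E <= _]%E in mA *.
set Q := [set w | dl%:E <= sqint H t w]%E in mQ *.
set E1 := [set w | dl%:E <= _]%E in m1.
set E2 := [set w | eps%:E <= _]%E in m2.
have sub : D `&` A1 `<=` (D `&` Q) `|` Z `|` (E1 `|` E2).
  move=> w [Dw Aw]; have [E2w|nE2] := pselect (E2 w); first by right; right.
  have [E1w|nE1] := pselect (E1 w); first by right; left.
  left; have [Zw|nZ] := pselect (Z w); first by right.
  left; split => //.
  have [] := hZ w 0%N isT; last by [].
    rewrite (stopped_integral_end B w (sS n)).
    move: nE2 Aw; rewrite /E2 /A1 /= => /negP; rewrite -ltNge lte_fin lee_fin => l1 l2.
    have := ler_normB (sp_integral B (S n) w) (sp_integral B (S n) w - I w).
    rewrite [X in `|X| <= _](_ : _ = I w); last by ring.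
    by move=> l3; clear - l1 l2 l3; lra.
  move=> hS; rewrite /Q/=; move: nE1; rewrite /E1/= => /negP; rewrite -ltNge => l1.
  have l2 : (sqint (sp_val (S n)) t w <= 2%:E *
      (sqint G t w + sqint H t w))%E.
    apply: (sqint_le2 (F := F)) => //.
    - exact: (progressive_sp_val usual t0T).
    - by apply: progressiveB => //; exact: (progressive_sp_val usual t0T).
    - move=> s _; rewrite [X in X ^+ 2 <= _](_ : _ = (sp_val (S n) s w - H s w) + H s w).
        exact: sqrD_le2.
      by rewrite subrK.
  rewrite leNgt; apply/negP => l3.
  have := lt_le_trans hS l2; apply/negP; rewrite -leNgt.
  rewrite (_ : (4 * dl)%:E = (2%:E * (dl%:E + dl%:E))%E); last first.
    by rewrite -EFinD -EFinM; congr EFin; ring.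
  by rewrite lee_wpmul2l// leeD// ltW.
have mDQ : measurable (D `&` Q) by exact: measurableI.
have mU : measurable ((D `&` Q) `|` Z) by exact: measurableU.
have mE : measurable (E1 `|` E2) by exact: measurableU.
apply: (@le_trans _ _ (P ((D `&` Q) `|` Z `|` (E1 `|` E2)))).
  by apply: le_measure sub; rewrite inE; [exact: measurableI|exact: measurableU].
apply: (le_trans (measureU2 _ mU mE)); apply: leeD.
  by apply: (le_trans (measureU2 _ mDQ mZ)); apply: leeD.
apply: (le_trans (measureU2 _ m1 m2)).
rewrite (_ : e%:E = ((e / 2)%:E + (e / 2)%:E)%E); first exact: leeD.
by rewrite -EFinD; congr EFin; field.
Qed.

Lemma ito_add H H' t I I' (a : R) : 0 <= t <= T -> ito H t I -> ito H' t I' ->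
  ito (fun s w => H s w + a * H' s w) t (fun w => I w + a * I' w).
Proof.
move=> t0T [pH fH mI [S [sS cS cI]]] [pH' fH' mI' [S' [sS' cS' cI']]].
have t0 : 0 <= t by case/andP: t0T.
have mIa := measurable_wrt_ambient usual t0T mI.
have mIa' := measurable_wrt_ambient usual t0T mI'.
have pZ : progressive F t (fun s w => a * H' s w) by exact: progressive_Z.
have pD : progressive F t (fun s w => H s w + a * H' s w) by exact: progressiveD.
have mId : measurable_wrt (F t) (fun w => I w + a * I' w).
  apply: measurable_funD => //; apply: measurable_funM => //; exact: measurable_cst.
have /choice[S'' hS''] n : exists S'', [/\ is_simple F t S'',
    forall s w, sp_val S'' s w = sp_val (S n) s w + a * sp_val (S' n) s w &
    forall B' w, sp_integral B' S'' w =
      sp_integral B' (S n) w + a * sp_integral B' (S' n) w].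
  exact: (simple_add usual a t0T (sS n) (sS' n)).
(* From [(x + a y)^2 <= 2 (x^2 + a^2 y^2) <= 2 (1 + a^2) (x^2 + y^2)]. *)
have c0 : 0 < 2 * (1 + a ^+ 2).
  by rewrite mulr_gt0// ltr_pwDl// sqr_ge0.
have c0' : 0 < 1 + `|a| by rewrite ltr_pwDl.
have sS'' n : is_simple F t (S'' n) by case: (hS'' n).
split => //.
- apply: (ae_mono2 _ fH fH') => w f1 f2.
  change (sqint (fun s w => H s w + a * H' s w)%R t w < +oo)%E.
  apply: (@le_lt_trans _ _ ((2 * (1 + a ^+ 2))%:E * (sqint H t w + sqint H' t w))%E).
    apply: (sqint_le2 (F := F)) => //; first exact: ltW.
    move=> s _; apply: (le_trans (sqrD_le2 _ _)).
    rewrite -mulrA ler_wpM2l// exprMn.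
    by have := sqr_ge0 (H s w); have := sqr_ge0 (H' s w); have := sqr_ge0 a; nra.
  by rewrite lte_mul_pinfty// ?lee_fin ?ltW// lte_add_pinfty.
- exists S''; split => //.
  + apply: (cvg0_prob_le2 c0 _ _ _ _ cS cS').
    * by move=> n; exact: measurable_dist_sp.
    * by move=> n; exact: measurable_dist_sp.
    * by move=> n; exact: measurable_dist_sp.
    move=> n; apply: aeW => w.
    have [_ eS _] := hS'' n.
    change (sqint (fun s w => sp_val (S'' n) s w - (H s w + a * H' s w))%R t w <=
      (2 * (1 + a ^+ 2))%:E * (sqint (fun s w => sp_val (S n) s w - H s w)%R t w +
      sqint (fun s w => sp_val (S' n) s w - H' s w)%R t w))%E.
    apply: (sqint_le2 (F := F)) => //; first exact: ltW.
    * by apply: progressiveB => //; exact: (progressive_sp_val usual t0T).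
    * by apply: progressiveB => //; exact: (progressive_sp_val usual t0T).
    * by apply: progressiveB => //; exact: (progressive_sp_val usual t0T).
    move=> s _; rewrite eS.
    rewrite [X in X ^+ 2 <= _](_ : _ = (sp_val (S n) s w - H s w) +
      a * (sp_val (S' n) s w - H' s w)); last by ring.
    apply: (le_trans (sqrD_le2 _ _)); rewrite -mulrA ler_wpM2l// exprMn.
    set x := _ - _; set y := _ - _.
    by have := sqr_ge0 x; have := sqr_ge0 y; have := sqr_ge0 a; nra.
  + apply: (cvg0_prob_le2 c0' _ _ _ _ cI cI').
    * move=> n; apply: (measurable_dist_int t0T _ (sS'' n)).
      exact: (measurable_wrt_ambient usual t0T).
    * by move=> n; exact: (measurable_dist_int t0T mIa (sS n)).
    * by move=> n; exact: (measurable_dist_int t0T mIa' (sS' n)).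
    move=> n; apply: aeW => w; have [_ _ eI] := hS'' n.
    rewrite eI -EFinD -EFinM lee_fin.
    rewrite (_ : _ - _ = (sp_integral B (S n) w - I w) +
      a * (sp_integral B (S' n) w - I' w)); last by ring.
    apply: (le_trans (ler_normD _ _)); rewrite normrM.
    set x := `|_ - _|; set y := `|_ - _|.
    have x0 : 0 <= x by exact: normr_ge0.
    have y0 : 0 <= y by exact: normr_ge0.
    by have := normr_ge0 a; nra.
Qed.

(** Linearity reduces the claim to an integrand whose square integral vanishes on [D]. There the
    first term of [ito_tail_le] is 0 and the second is arbitrarily small. The event [D] need not
    belong to any [F s]. *)
Lemma ito_eq_on H H' t I I' (D : set Omega) : 0 <= t <= T -> measurable D ->
  ito H t I -> ito H' t I' ->
  {ae P, forall w, D w -> sqint (fun s w => H s w - H' s w) t w = 0%E} ->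
  {ae P, forall w, D w -> I w = I' w}.
Proof.
move=> t0T mD iH iH' hD.
have := ito_add (-1) t0T iH iH'.
set G := (fun s w => H s w + -1 * H' s w); set Y := (fun w => I w + -1 * I' w).
move=> iG.
have mY : measurable_fun setT Y by exact: ito_measurable t0T iG.
have pG := ito_progressive iG.
have mA (e : R) : measurable (D `&` [set w | e%:E <= (`|Y w|)%:E]%E).
  apply: measurableI => //; apply: measurable_ge_event.
  by apply/measurable_EFinP; exact: measurableT_comp.
have null (e : R) : 0 < e -> P (D `&` [set w | e%:E <= (`|Y w|)%:E]%E) = 0%E.
  move=> e0; apply/eqP; rewrite eq_le measure_ge0 andbT.
  apply/lee_addgt0Pr => r r0; rewrite add0e.
  have e20 : 0 < e / 2 by rewrite divr_gt0.
  (* Chosen so that the second term of Lenglart's bound at level [e / 2] equals [r]. *)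
  pose dl := r * (e / 2) ^+ 2 / 4.
  have dl0 : 0 < dl by rewrite divr_gt0// mulr_gt0// exprn_gt0.
  have := ito_tail_le t0T iG mD e20 dl0.
  rewrite (_ : 2 * (e / 2) = e); last by field.
  move=> /le_trans; apply.
  rewrite (_ : 4 * dl / (e / 2) ^+ 2 = r); last first.
    by rewrite /dl; field; rewrite gt_eqF.
  rewrite -[leRHS]add0e leeD// -(measure0 P).
  apply: le_measure_ae => //.
    apply: measurableI => //; apply: measurable_ge_event.
    exact: (measurable_sqint usual t0T).
  apply: ae_mono hD => w hw [Dw]; have := hw Dw.
  rewrite (@eq_sqint _ _ _ _ G); last by move=> s _; rewrite /G mulN1r.
  by move=> /= ->; rewrite lee_fin leNgt dl0.
apply: (@negligibleS _ _ _ _ (\bigcup_n (D `&` [set w | (n.+1%:R^-1)%:E <= (`|Y w|)%:E]%E))).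
  move=> w /= /not_implyP[Dw neq].
  have Y0 : 0 < `|Y w|.
    by rewrite normr_gt0 /Y mulN1r subr_eq0; apply/eqP.
  have [n hn] : exists n : nat, `|Y w|^-1 <= n.+1%:R.
    by exists (Num.truncn `|Y w|^-1); apply/ltW/truncnS_gt.
  exists n => //; split => //=; rewrite lee_fin.
  by rewrite -[leRHS]invrK lef_pV2// ?posrE// invr_gt0.
apply: negligible_bigcup => n; apply/(negligibleP P (mA _)); apply: null.
by rewrite invr_gt0.
Qed.

Lemma ito_unique H t I I' : 0 <= t <= T -> ito H t I -> ito H t I' ->
  {ae P, forall w, I w = I' w}.
Proof.
move=> t0T iH iH'; have := @ito_eq_on H H t I I' setT t0T measurableT iH iH'.
move=> h; apply: (ae_mono (A := fun w => setT w -> I w = I' w)); first by move=> w; apply.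
apply: h; apply: aeW => w _; apply: sqint_eq0 => s _; by rewrite subrr.
Qed.

End ito_calculus.

Section almost_everywhere_tools.
Context {d : measure_display} {X : measurableType d} {R : realType}.
Variable mu : {measure set X -> \bar R}.
Local Open Scope ereal_scope.

Lemma cvg0_summable (u : nat -> \bar R) : (forall n, 0 <= u n) ->
  \sum_(0 <= n <oo) u n < +oo -> u @ \oo --> 0.
Proof.
move=> u0 us.
apply: (@squeeze_cvge _ _ _ _ (cst 0) _ (fun N => \sum_(N <= k <oo) u k)).
- apply: nearW => n; rewrite u0/=.
  by have := @nneseries_lim_ge _ u xpredT n n.+1 (fun i _ _ => u0 i); rewrite big_nat1.
- exact: cvg_cst.
- exact: nneseries_tail_cvg.
Qed.

Lemma cvg0_ext (u v : nat -> \bar R) : (forall n, u n = v n) ->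
  u @ \oo --> 0 -> v @ \oo --> 0.
Proof. by move=> /funext ->. Qed.

Lemma summable_geometric (u : nat -> \bar R) (c : R) : (0 <= c)%R ->
  (forall n, 0 <= u n) -> (forall n, u n <= (c / (2 ^ n.+1)%:R)%:E) ->
  \sum_(0 <= n <oo) u n < +oo.
Proof.
move=> c0 u0 uc; apply: (@le_lt_trans _ _ c%:E); last exact: ltry.
by apply: le_trans (epsilon_trick0 xpredT c0); apply: lee_nneseries.
Qed.

(** By monotone convergence the sum has a finite integral, hence is finite almost everywhere. This
    extracts pointwise convergence from summable L2 errors. *)
Lemma ae_summable (D : set X) (g : nat -> X -> \bar R) : measurable D ->
  (forall n, measurable_fun D (g n)) -> (forall n x, D x -> 0 <= g n x) ->
  \sum_(0 <= n <oo) \int[mu]_(x in D) g n x < +oo ->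
  {ae mu, forall x, D x -> \sum_(0 <= n <oo) g n x < +oo}.
Proof.
move=> mD mg g0 gs.
have : mu.-integrable D (fun x => \sum_(0 <= n <oo) g n x).
  apply/integrableP; split.
    by apply: (@ge0_emeasurable_sum _ _ _ D g xpredT) => // k x Dx _; exact: g0.
  rewrite (eq_integral (fun x => \sum_(0 <= n <oo) g n x)); last first.
    move=> x; rewrite inE => Dx; rewrite gee0_abs//.
    by apply: nneseries_ge0 => n _ _; exact: g0.
  by rewrite integral_nneseries.
move=> /(integrable_ae mD); apply: ae_mono => x /[apply] /fin_numPlt/andP[]//.
Qed.

Lemma ae_lty_integral (f : X -> \bar R) : measurable_fun setT f ->
  (forall x, 0 <= f x) -> \int[mu]_x f x < +oo -> {ae mu, forall x, f x < +oo}.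
Proof.
move=> mf f0 hf.
have iH : mu.-integrable setT f.
  by apply/integrableP; split => //; rewrite (eq_integral f)// => x _; rewrite gee0_abs.
apply: ae_mono (integrable_ae measurableT iH) => x /(_ Logic.I).
by rewrite ge0_fin_numE.
Qed.

Lemma ae_eventually_notin (A : nat -> set X) : (forall n, measurable (A n)) ->
  \sum_(0 <= n <oo) mu (A n) < +oo ->
  {ae mu, forall x, exists N, forall n, (N <= n)%N -> ~ A n x}.
Proof.
move=> mA sA; exists (lim_sup_set A); split.
- by apply: bigcapT_measurable => n; exact: bigcup_measurable.
- exact: lim_sup_set_cvg0.
move=> x /= h n _; apply: contrapT => h'; apply: h; exists n => k nk Ak.
by apply: h'; exists k.
Qed.

End almost_everywhere_tools.

Section probability_tools.
Context {R : realType} {d : measure_display} {Omega : measurableType d}.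
Variable P : probability Omega R.
Local Open Scope ereal_scope.

Lemma cvg0_prob_subseq (Z : nat -> Omega -> \bar R) (eps : nat -> R) :
  (forall n, 0 < eps n)%R -> cvg0_in_probability P Z -> exists phi : nat -> nat,
  forall k, P [set w | (eps k)%:E <= Z (phi k) w] <= ((2 ^ k.+1)%:R^-1)%:E.
Proof.
move=> eps0 cZ; suff /choice[phi hphi] k : exists m,
    P [set w | (eps k)%:E <= Z m w] <= ((2 ^ k.+1)%:R^-1)%:E by exists phi.
have /cvge0_leP h := cZ _ (eps0 k).
have p0 : (0 < (2 ^ k.+1)%:R^-1 :> R)%R by rewrite invr_gt0 ltr0n expn_gt0.
have [N hN] := h (fun _ => measure_ge0 _ _) _ p0.
by exists N; exact: hN.
Qed.

Lemma cvg0_prob_ae_subseq (Z : nat -> Omega -> \bar R) :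
  (forall n, measurable_fun setT (Z n)) -> (forall n w, 0 <= Z n w) ->
  cvg0_in_probability P Z -> exists phi : nat -> nat,
  {ae P, forall w, Z (phi n) w @[n --> \oo] --> 0}.
Proof.
move=> mZ Z0 cZ; pose eps (k : nat) : R := (k.+1%:R^-1)%R.
have eps0 k : (0 < eps k)%R by rewrite invr_gt0.
have [phi hphi] := cvg0_prob_subseq eps0 cZ; exists phi.
pose A k := [set w | (eps k)%:E <= Z (phi k) w].
have mA k : measurable (A k) by exact: measurable_ge_event.
have sA : \sum_(0 <= n <oo) P (A n) < +oo.
  by apply: (@summable_geometric _ _ 1) => // n; rewrite div1r; exact: hphi.
apply: ae_mono (ae_eventually_notin mA sA) => w [N hN].
apply/cvge0_leP => // e e0; exists (maxn N (Num.truncn e^-1)) => n.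
rewrite geq_max => /andP[/hN/negP + en]; rewrite -ltNge => /ltW/le_trans; apply.
rewrite lee_fin /eps -[leRHS]invrK lef_pV2 ?posrE ?invr_gt0//.
by apply/ltW/(lt_le_trans (truncnS_gt _)); rewrite ler_nat.
Qed.

Lemma expectation_sqr_fatou (N : nat -> Omega -> R) (I : Omega -> R) (c : \bar R) :
  (forall k, measurable_fun setT (N k)) -> measurable_fun setT I ->
  {ae P, forall w, (`|N k w - I w|%R)%:E @[k --> \oo] --> 0} ->
  (forall k, \int[P]_w ((N k w) ^+ 2)%:E <= c) ->
  \int[P]_w ((I w) ^+ 2)%:E <= c.
Proof.
move=> mN mI cN hc.
have mN2 k : measurable_fun setT (fun w => ((N k w) ^+ 2)%:E).
  by apply/measurable_EFinP; exact: measurable_funX.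
rewrite (ae_eq_integral (fun w => limn_einf (fun k => ((N k w) ^+ 2)%:E)))//; last 3 first.
- by apply/measurable_EFinP; exact: measurable_funX.
(* The lower limit is minus the upper limit of the opposites, whose measurability is
   [measurable_fun_limn_esup]. *)
- rewrite (_ : (fun w => _) = (fun w => - limn_esup (fun k => - ((N k w) ^+ 2)%:E))); last first.
    by apply/funext => w; rewrite (limn_esupN (fun k => ((N k w) ^+ 2)%:E)) oppeK.
  apply: measurableT_comp => //.
  by apply: measurable_fun_limn_esup => k; exact: measurableT_comp.
- apply: ae_mono cN => w cw _.
  have : ((N k w) ^+ 2)%:E @[k --> \oo] --> ((I w) ^+ 2)%:E.
    apply: cvg_EFin; first exact: nearW.
    suff cI : N k w @[k --> \oo] --> I w by have := cvgM cI cI; rewrite -expr2; exact.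
    apply/cvgrPdist_le => e e0.
    have /cvge0_leP h := cw; have [|M hM] := h _ e e0; first by move=> k; rewrite lee_fin.
    by exists M => // k /= /hM; rewrite lee_fin distrC.
  by move=> /cvg_limn_einf_sup[->].
apply: (le_trans (fatou _ _ _ _)) => //; first by move=> *; rewrite lee_fin sqr_ge0.
rewrite limn_einf_lim; apply: lime_le; first exact: is_cvg_einfs.
apply: nearW => n; apply: le_trans (hc n); apply: ereal_inf_lbound.
by exists n => /=.
Qed.

Lemma integrable_sqr_lty (Y : Omega -> R) : measurable_fun setT Y ->
  \int[P]_w ((Y w) ^+ 2)%:E < +oo -> P.-integrable setT (fun w => (Y w)%:E).
Proof.
move=> mY Y2.
have i2 : P.-integrable setT (fun w => ((Y w) ^+ 2)%:E).
  apply/integrableP; split; first by apply/measurable_EFinP; exact: measurable_funX.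
  by rewrite (eq_integral (fun w => ((Y w) ^+ 2)%:E))// => w _; rewrite gee0_abs// lee_fin sqr_ge0.
have i3 : P.-integrable setT (fun w => 1 + ((Y w) ^+ 2)%:E).
  by apply: integrableD => //; exact: finite_measure_integrable_cst.
apply: le_integrable i3 => //; first exact/measurable_EFinP.
move=> w _; rewrite -EFinD !abse_EFin lee_fin [leRHS]ger0_norm ?addr_ge0 ?sqr_ge0//.
by rewrite -(real_normK (num_real (Y w))); have := normr_ge0 (Y w); nra.
Qed.

(** Young's inequality [|y| <= e + y^2 / e], a substitute for Cauchy-Schwarz that makes the mean
    small with the second moment. *)
Lemma expectation_le_sqr (Y : Omega -> R) (e : R) : (0 < e)%R -> measurable_fun setT Y ->
  \int[P]_w ((Y w) ^+ 2)%:E < +oo ->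
  `|\int[P]_w (Y w)%:E| <= e%:E + (e^-1)%:E * \int[P]_w ((Y w) ^+ 2)%:E.
Proof.
move=> e0 mY Y2; have iY := integrable_sqr_lty mY Y2.
have m2 : measurable_fun setT (fun w => ((Y w) ^+ 2)%:E).
  by apply/measurable_EFinP; exact: measurable_funX.
have p2 w : 0 <= ((Y w) ^+ 2)%:E by rewrite lee_fin sqr_ge0.
apply: (le_trans (le_abse_integral _ _ _)) => //; first exact/measurable_EFinP.
rewrite -ge0_integralZl//; last by rewrite lee_fin invr_ge0 ltW.
rewrite -[e%:E](_ : \int[P]_w e%:E = _); last first.
  by rewrite integral_cst// [X in _ * X]probability_setT mule1.
have ei0 : (0 <= e^-1)%R by rewrite invr_ge0 ltW.
rewrite -ge0_integralD//; last 3 first.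
- by move=> w _; rewrite lee_fin ltW.
- by move=> w _; rewrite mule_ge0.
- exact: measurable_funeM.
apply: ge0_le_integral => //.
- by apply: measurableT_comp => //; exact/measurable_EFinP.
- by apply: emeasurable_funD => //; exact: measurable_funeM.
move=> w _; rewrite abse_EFin -EFinM -EFinD lee_fin.
rewrite -(real_normK (num_real (Y w))); set y := `|Y w|%R.
have y0 : (0 <= y)%R by exact: normr_ge0.
rewrite -(ler_pM2l e0) mulrDr mulrA mulfV ?gt_eqF// mul1r.
by have := sqr_ge0 (y - e); nra.
Qed.

End probability_tools.

Section ito_isometry.
Context {R : realType} {d : measure_display} {Omega : measurableType d}.
Local Notation leb := (@lebesgue_measure R).
Variables (P : probability Omega R) (T : R) (F : R -> set_system Omega).
Variable B : R -> Omega -> R.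
Hypothesis usual : usual_conditions P F T.
Hypothesis bm : brownian_motion P F T B.
Implicit Types (H : R -> Omega -> R) (t s : R) (I : Omega -> R) (S : @simple_process R d Omega).

Local Notation ito := (is_ito_integral P F B).

Lemma sp_integral_measurable S t : 0 <= t <= T -> is_simple F t S ->
  measurable_fun setT (sp_integral B S).
Proof.
move=> t0T sS; apply: (measurable_wrt_ambient usual t0T).
exact: (sp_integral_wrt usual bm).
Qed.

Lemma sqint_sp_val_lty S t w : 0 <= t -> is_simple F t S ->
  (sqint (sp_val S) t w < +oo)%E.
Proof.
move=> t0 sS.
have [|g [n [g_nd g0 gn g_itv gl]]] := exists_grid (l := sp_times S) t0.
  by move=> a; exact: (sp_times_itv sS).
have SG i : (i <= sp_size S)%N -> exists2 m, (m <= n)%N & sp_time S i = g m.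
  by move=> iS; apply: gl; exact: sp_timesP.
by rewrite /sqint (integral_sp_val_sqr g_nd g0 gn sS SG w) ltry.
Qed.

Lemma sp_integral_moments S t : 0 <= t <= T -> is_simple F t S ->
  [/\ (\int[P]_w ((sp_integral B S w) ^+ 2)%:E < +oo)%E,
      (\int[P]_w ((sp_integral B S w) ^+ 2)%:E <= \int[P]_w sqint (sp_val S) t w)%E,
      P.-integrable setT (fun w => (sp_integral B S w)%:E) &
      (\int[P]_w (sp_integral B S w)%:E = 0)%E].
Proof.
move=> /andP[t0 tT] sS.
have [|g [n [g_nd g0 gn g_itv gl]]] := exists_grid (l := sp_times S) t0.
  by move=> a; exact: (sp_times_itv sS).
have SG i : (i <= sp_size S)%N -> exists2 m, (m <= n)%N & sp_time S i = g m.
  by move=> iS; apply: gl; exact: sp_timesP.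
have g_itvT i : (i <= n)%N -> 0 <= g i <= T.
  by move=> /g_itv/andP[-> /le_trans ->].
have hc := sp_val_grid_coef g_nd gn sS SG usual tT.
have eS : sp_integral B S = grid_sum B g (fun j => sp_val S (g j.+1)) n.
  by apply/funext => w; exact: (sp_integral_grid g_nd g0 sS SG B w).
have [h1 h2] := grid_sum_sqr_lty usual bm g_nd g_itvT hc (leqnn n).
have [h3 h4] := grid_sum_mean usual bm g_nd g_itvT hc (leqnn n).
rewrite eS; split => //; apply: le_trans h2 _.
by under [leRHS]eq_integral do rewrite /sqint (integral_sp_val_sqr g_nd g0 gn sS SG _).
Qed.

Lemma ito_simple S t : 0 <= t <= T -> is_simple F t S ->
  ito (sp_val S) t (sp_integral B S).
Proof.
move=> t0T sS; have t0 : 0 <= t by case/andP: t0T.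
split.
- exact: (progressive_sp_val usual t0T).
- by apply: aeW => w; exact: sqint_sp_val_lty.
- exact: (sp_integral_wrt usual bm).
exists (fun=> S); split => // e e0; apply: cvg_near_cst; apply: nearW => _.
- rewrite (_ : [set w | _] = set0) ?measure0//; apply/seteqP; split => // w /=.
  rewrite -/(sqint (fun s w => sp_val S s w - sp_val S s w) t w) sqint_eq0; last first.
    by move=> s _; rewrite subrr.
  by rewrite lee_fin leNgt e0.
- rewrite (_ : [set w | _] = set0) ?measure0//; apply/seteqP; split => // w /=.
  by rewrite subrr normr0 lee_fin leNgt e0.
Qed.

Definition sp_zero : @simple_process R d Omega :=
  SimpleProcess 0 (fun=> 0) (fun _ _ => 0).

Lemma ito_zero t : 0 <= t <= T -> ito (fun _ _ => 0) t (fun _ => 0).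
Proof.
move=> t0T; have sz : is_simple F t sp_zero by split => //= i; case/andP: t0T => ->; rewrite lexx.
have := ito_simple t0T sz.
by congr (is_ito_integral _ _ _ _ _ _); apply/funext => s; [apply/funext => w|];
  rewrite /sp_val/= /sp_integral/= big_ord0.
Qed.

Lemma ito_scale (a : R) H t I : 0 <= t <= T -> ito H t I ->
  ito (fun s w => a * H s w) t (fun w => a * I w).
Proof.
move=> t0T iH; have := ito_add usual bm a t0T (ito_zero t0T) iH.
by congr (is_ito_integral _ _ _ _ _ _); apply/funext => s; [apply/funext => w|];
  rewrite add0r.
Qed.

(** The new version is still measurable at time [t] because null sets belong to [F 0]. *)
Lemma ito_ae H t I I' : 0 <= t <= T -> ito H t I ->
  {ae P, forall w, I w = I' w} -> ito H t I'.
Proof.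
move=> t0T iH e; have [pH fH mI [S [sS cS cI]]] := iH.
have mI' : measurable_wrt (F t) I' by exact: (measurable_wrt_ae usual t0T e mI).
have mA (J : Omega -> R) : measurable_fun setT J -> forall n, measurable_fun setT (fun w => (`|sp_integral B (S n) w - J w|)%:E).
  move=> mJ n; apply/measurable_EFinP; apply: measurableT_comp => //.
  by apply: measurable_funB => //; exact: sp_integral_measurable t0T (sS n).
have mJ := measurable_wrt_ambient usual t0T mI.
have mJ' := measurable_wrt_ambient usual t0T mI'.
split => //; exists S; split => // eps eps0.
apply: (cvg0_ext _ (cI _ eps0)) => n.
apply/eqP; rewrite eq_le; apply/andP; split; apply: le_measure_ae;
  try (by apply: measurable_ge_event; exact: mA); by apply: ae_mono e => w /= ->.
Qed.

Lemma ito_eq H H' t I : 0 <= t <= T -> ito H t I ->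
  (forall s w, 0 <= s <= t -> H s w = H' s w) -> ito H' t I.
Proof.
move=> t0T [pH fH mI [S [sS cS cI]]] e; split => //.
- move=> u /andP[u0 ut]; apply: eq_measurable_fun; last by apply: pH; rewrite u0.
  move=> [s w] /=; rewrite inE/= in_itv/= => -[/andP[s0 su] _].
  by apply: e; rewrite s0 (le_trans su).
- apply: ae_mono fH => w; change (sqint H t w < +oo -> sqint H' t w < +oo)%E.
  by rewrite (_ : sqint H t w = sqint H' t w)//; apply: eq_sqint => s; exact: e.
- exists S; split => //; move=> eps eps0; apply: (cvg0_ext _ (cS _ eps0)) => n.
  congr (P _); apply/funext => w /=.
  congr (_ <= _)%E; apply: (@eq_sqint _ _ _ (fun s w => sp_val (S n) s w - H s w)
    (fun s w => sp_val (S n) s w - H' s w)) => s /e ->//.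
Qed.

(** [H] is known to be progressive up to [s] only. On [[0, min s u]] it is measurable for a
    sub-sigma-algebra of [F u], and beyond [s] the product is 0. *)
Lemma progressive_stop H s t : 0 <= s -> progressive F s H -> t <= T ->
  progressive F t (fun u w => H u w * \1_(`[0, s]%classic) u).
Proof.
move=> s0 pH tT u /andP[u0 ut].
pose m := Num.min s u.
have m0 : 0 <= m by rewrite le_min s0.
have mu_ : m <= u by rewrite ge_min lexx orbT.
have ms : m <= s by rewrite ge_min lexx.
have mE (G : set_system Omega) (a : R) :
    measurable (`[0, a] `*` setT : set (R * g_sigma_algebraType G)).
  by apply: measurableX => //; exact: measurable_itv.
have mH : @measurable_fun _ _ (R * g_sigma_algebraType (F u))%type R
    (`[0, m] `*` setT) (fun p => H p.1 p.2).
  have pm := pH m; rewrite m0 ms in pm.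
  apply: (@measurable_comp _ _ _ _ _ _ (`[0, m] `*` setT)
    (fun p : R * g_sigma_algebraType (F m) => H p.1 p.2) _
    (fun p : R * g_sigma_algebraType (F u) => (p.1, p.2 : g_sigma_algebraType (F m)))).
  - exact: mE.
  - by move=> _ [[a w] /= [am _] <-].
  - exact: pm.
  - apply: measurable_funTS; apply/measurable_fun_pairP; split => /=; first exact: measurable_fst.
    apply: (measurableT_comp (f := (id : g_sigma_algebraType (F u) -> g_sigma_algebraType (F m)))).
      by apply: measurable_id_sub; apply: (filtration_le usual) => //; exact: le_trans ut tT.
    exact: measurable_snd.
apply: (eq_measurable_fun ((fun p : R * g_sigma_algebraType (F u) => H p.1 p.2) \_ (`[0, m] `*` setT))).
  move=> [a w] /=; rewrite inE/= in_itv/= => -[/andP[a0 au] _].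
  rewrite patchE indicE; have -> : ((a, w) \in `[0, m]%classic `*` setT) = (a \in `[0, s]%classic).
    by apply/idP/idP; rewrite !inE/= !in_itv/= a0/= /m le_min au andbT; [case|].
  by case: (_ \in _); rewrite ?mulr1 ?mulr0.
apply: (measurable_restrict _ _ _).1; [exact: mE|exact: mE|].
by apply: (measurable_funS _ _ mH); [exact: mE|move=> x []].
Qed.

Lemma sqint_stop (G G' : R -> Omega -> R) s t w : s <= t ->
  (forall u, 0 <= u <= s -> G' u w = G u w) ->
  (forall u, s < u <= t -> G' u w = 0) -> sqint G' t w = sqint G s w.
Proof.
move=> st h1 h2; rewrite /sqint integral_mkcond [RHS]integral_mkcond.
apply: eq_integral => u _; rewrite !patchE !mem_setE !in_itv/=.
case: (leP 0 u) => u0 //=; case: (leP u s) => us.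
  by rewrite (le_trans us st) h1// u0.
by case: (leP u t) => ut//; rewrite h2 ?us// expr0n.
Qed.

Lemma is_simple_le S s t : s <= t -> is_simple F s S -> is_simple F t S.
Proof.
by move=> st [h m c]; split => // i /h/andP[-> /le_trans ->].
Qed.

(** The same simple processes approximate, since they vanish after [s]. Integrals over different
    horizons can thus be compared on a common one by linearity and locality. *)
Lemma ito_extend H s t I : 0 <= s -> s <= t -> t <= T -> ito H s I ->
  ito (fun u w => H u w * \1_(`[0, s]%classic) u) t I.
Proof.
move=> s0 st tT [pH fH mI [S [sS cS cI]]].
have i1 u : 0 <= u <= s -> \1_(`[0, s]%classic) u = 1 :> R.
  by move=> us; rewrite indicE mem_setE in_itv/= us.
have i0 u : s < u <= t -> \1_(`[0, s]%classic) u = 0 :> R.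
  by move=> /andP[su _]; rewrite indicE mem_setE in_itv/= (leNgt u) su andbF.
split.
- exact: progressive_stop.
- apply: ae_mono fH => w.
  change (sqint H s w < +oo -> sqint (fun u w => H u w * \1_(`[0, s]%classic) u)%R t w < +oo)%E.
  rewrite (@sqint_stop H _ s t w)// => u us; first by rewrite i1// mulr1.
  by rewrite i0// mulr0.
- exact: (measurable_wrt_le usual s0 st).
exists S; split => //; first by move=> n; exact: is_simple_le (sS n).
move=> eps eps0; apply: (cvg0_ext _ (cS _ eps0)) => n; congr (P _); apply/funext => w /=.
congr (_ <= _)%E; symmetry.
apply: (@sqint_stop (fun u w => sp_val (S n) u w - H u w)
  (fun u w => sp_val (S n) u w - H u w * \1_(`[0, s]%classic) u) s t w) => // u us.
  by rewrite i1// mulr1.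
rewrite i0// mulr0 subr0 (sp_val_out (sS n))//.
by rewrite negb_and -!ltNge; case/andP: us => -> _; rewrite orbT.
Qed.

(** Continuity of the integral in probability, read off from Lenglart's bound; [dl] makes its second
    term equal to [e / 2] at level [eps / 2]. *)
Lemma ito_cvg0 (G : nat -> R -> Omega -> R) (Y : nat -> Omega -> R) t : 0 <= t <= T ->
  (forall n, ito (G n) t (Y n)) -> cvg0_in_probability P (fun n w => sqint (G n) t w) ->
  cvg0_in_probability P (fun n w => (`|Y n w|)%:E).
Proof.
move=> t0T iG cG eps eps0; apply/cvge0_leP => // e e0.
have e20 : 0 < e / 2 by rewrite divr_gt0.
have eps20 : 0 < eps / 2 by rewrite divr_gt0.
pose dl := (e / 2) * (eps / 2) ^+ 2 / 4.
have dl0 : 0 < dl by rewrite divr_gt0// mulr_gt0// exprn_gt0.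
have /cvge0_leP h := cG dl dl0.
have [N hN] := h (fun _ => measure_ge0 _ _) _ e20; exists N => n /hN le.
have := ito_tail_le usual bm t0T (iG n) measurableT eps20 dl0.
rewrite !setTI (_ : 2 * (eps / 2) = eps); last by field.
rewrite (_ : 4 * dl / (eps / 2) ^+ 2 = e / 2); last by rewrite /dl; field; rewrite gt_eqF.
move=> /le_trans; apply; rewrite [in leRHS](_ : e = e / 2 + e / 2); last by field.
by rewrite EFinD leeD.
Qed.

(** The simple processes contained in the definition carry no moment bound. They are replaced by
    those of [simple_approximation], dominated by [H]; their integrals converge to [I] almost surely
    along a subsequence, and Fatou's lemma concludes. The right-hand side may be infinite. *)
Lemma ito_sqr_le H t I : 0 <= t <= T -> ito H t I ->
  (\int[P]_w ((I w) ^+ 2)%:E <= \int[P]_w sqint H t w)%E.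
Proof.
move=> t0T iH; have t0 : 0 <= t by case/andP: t0T.
have pH := ito_progressive iH.
have [S [sS cS leS]] := simple_approximation t0 pH.
have iG k : ito (fun s w => sp_val (S k) s w + -1 * H s w) t (fun w => sp_integral B (S k) w + -1 * I w).
  by apply: (ito_add usual bm) => //; exact: ito_simple.
have eG k w : sqint (fun s w => sp_val (S k) s w + -1 * H s w) t w =
    sqint (fun s w => sp_val (S k) s w - H s w) t w.
  by apply: eq_sqint => s _; rewrite mulN1r.
have mI : measurable_fun setT I by exact: (ito_measurable usual t0T iH).
have c0 := ito_cvg0 t0T iG; have /c0 : cvg0_in_probability P
    (fun k w => sqint (fun s w => sp_val (S k) s w + -1 * H s w) t w).
  apply: cvg0_prob_ae.
    by move=> k; apply: (measurable_sqint usual t0T); exact: ito_progressive (iG k).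
  apply: ae_mono (ito_sqint_lty iH) => w /cS; apply: cvg0_ext => k.
  by rewrite eG.
move=> /cvg0_prob_ae_subseq[|//|phi hphi].
  move=> n; apply/measurable_EFinP; apply: measurableT_comp => //.
  exact: (ito_measurable usual t0T (iG n)).
apply: (@expectation_sqr_fatou _ _ _ _ (fun k => sp_integral B (S (phi k)))) => //.
- by move=> k; exact: sp_integral_measurable (sS _).
- by apply: ae_mono hphi => w; apply: cvg0_ext => k; rewrite mulN1r.
move=> k; have [_ h _ _] := sp_integral_moments t0T (sS (phi k)).
apply: le_trans h _; apply: ge0_le_integral => //.
- by move=> w _; exact: sqint_ge0.
- by apply: (measurable_sqint usual t0T); exact: (progressive_sp_val usual t0T).
- exact: (measurable_sqint usual t0T).
Qed.

(** Simple integrals have mean 0, and their distance to [I] tends to 0 in L2 by dominated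
    convergence of the square integrals, with bound [4 * sqint H t]. *)
Lemma ito_mean H t I : 0 <= t <= T -> ito H t I -> (\int[P]_w sqint H t w < +oo)%E ->
  P.-integrable setT (fun w => (I w)%:E) /\ (\int[P]_w (I w)%:E = 0)%E.
Proof.
move=> t0T iH H2; have t0 : 0 <= t by case/andP: t0T.
have pH := ito_progressive iH.
have mI : measurable_fun setT I by exact: (ito_measurable usual t0T iH).
have I2 := le_lt_trans (ito_sqr_le t0T iH) H2.
split; first exact: integrable_sqr_lty.
have [S [sS cS leS]] := simple_approximation t0 pH.
pose G k s w := H s w + -1 * sp_val (S k) s w.
pose Y k w := I w + -1 * sp_integral B (S k) w.
have iG k : ito (G k) t (Y k).
  by apply: (ito_add usual bm) => //; exact: ito_simple.
have mG k : measurable_fun setT (sqint (G k) t).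
  by apply: (measurable_sqint usual t0T); exact: ito_progressive (iG k).
have mH : measurable_fun setT (sqint H t) by exact: (measurable_sqint usual t0T).
have iint : P.-integrable setT (sqint H t).
  apply/integrableP; split => //.
  by rewrite (eq_integral (sqint H t))// => w _; rewrite gee0_abs// sqint_ge0.
have Gle k w : (sqint (G k) t w <= 4%:E * sqint H t w)%E.
  apply: (@le_trans _ _ (2%:E * (sqint H t w + sqint (sp_val (S k)) t w))%E).
    apply: (sqint_le2 (F := F)) => //.
    - exact: ito_progressive (iG k).
    - exact: (progressive_sp_val usual t0T).
    - by move=> s _; rewrite /G mulN1r; apply: (le_trans (sqrD_le2 _ _)); rewrite sqrrN.
  rewrite (_ : 4 = 2 * 2); last by rewrite -natrM.
  rewrite EFinM -muleA lee_wpmul2l// (mule_natl _ 2) mule2n.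
  by apply: leeD.
have /cvge0_leP hG : (fun k => \int[P]_w sqint (G k) t w)%E @ \oo --> 0%E.
  rewrite -[X in _ --> X](integral0 P setT).
  have [] := @dominated_convergence _ Omega R P setT measurableT
    (fun k w => sqint (G k) t w) (cst 0%E) (fun w => 4%:E * sqint H t w)%E => //.
  - apply: ae_mono (ito_sqint_lty iH) => w /cS cw _.
    apply: (cvg0_ext _ cw) => k.
    by apply: eq_integral => s _; congr EFin; rewrite /G mulN1r -sqrrN opprB.
  - exact: integrableZl.
  - by apply: aeW => w k _; rewrite gee0_abs// sqint_ge0.
have G0 k : (0 <= \int[P]_w sqint (G k) t w)%E by apply: integral_ge0 => w _; exact: sqint_ge0.
apply/eqP; rewrite -abse_eq0 eq_le abse_ge0 andbT; apply/lee_addgt0Pr => e e0; rewrite add0e.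
have e20 : 0 < e / 2 by rewrite divr_gt0.
(* With this second moment, [expectation_le_sqr] at [e / 2] gives the bound [e / 2 + e / 2]. *)
have [N hN] := hG G0 ((e / 2) ^+ 2) (exprn_gt0 2 e20).
have [_ _ i1 i0] := sp_integral_moments t0T (sS N).
have Y2 := ito_sqr_le t0T (iG N).
have {}hN := le_trans Y2 (hN N (leqnn N)).
have mY : measurable_fun setT (Y N) by exact: (ito_measurable usual t0T (iG N)).
have -> : (\int[P]_w (I w)%:E = \int[P]_w (Y N w)%:E)%E.
  rewrite /Y; under [RHS]eq_integral do rewrite EFinD EFinM.
  rewrite integralD//; last 2 first.
  - exact: integrable_sqr_lty.
  - exact: integrableZl.
  by rewrite integralZl// i0 mule0 adde0.
apply: le_trans (expectation_le_sqr e20 mY (le_lt_trans hN (ltry _))) _.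
apply: (@le_trans _ _ ((e / 2)%:E + ((e / 2)^-1)%:E * ((e / 2) ^+ 2)%:E)%E).
  by rewrite leeD2l// lee_wpmul2l// lee_fin invr_ge0 ltW.
rewrite -EFinM -EFinD lee_fin expr2 mulKf ?gt_eqF//.
by rewrite -mulrDl; lra.
Qed.

End ito_isometry.

Section real_sequences.
Context {R : realType}.

Lemma exists_dense_seq (T : R) : 0 <= T -> exists qs : nat -> R,
  (forall i, 0 <= qs i <= T) /\
  forall b c, 0 <= b -> b < c -> c <= T -> exists i, b < qs i < c.
Proof.
move=> T0; pose qs (i : nat) : R := Num.max 0 (Num.min T (ratr (odflt 0 (unpickle i)))).
exists qs; split=> [i|b c b0 bc cT].
  by rewrite /qs le_max lexx/= ge_max T0 ge_min lexx.
have [q] := rat_in_itvoo bc; rewrite in_itv/= => /andP[bq qc].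
exists (pickle q); rewrite /qs pickleK/= min_r ?max_r ?bq ?qc//.
  exact/ltW/(le_lt_trans b0).
exact/ltW/(lt_le_trans qc).
Qed.

Lemma pow2_small (e : R) : 0 < e -> exists N : nat, forall k, (N <= k)%N ->
  (2 ^ k)%:R^-1 < e.
Proof.
move=> e0; exists (Num.truncn e^-1) => k Nk.
rewrite -[ltRHS]invrK ltf_pV2 ?posrE ?invr_gt0 ?ltr0n ?expn_gt0//.
apply: (lt_le_trans (truncnS_gt _)); rewrite ler_nat.
by apply: (leq_ltn_trans Nk); exact: ltn_expl.
Qed.

Lemma geometric_cauchy (u : nat -> R) (N : nat) :
  (forall k, (N <= k)%N -> `|u k.+1 - u k| <= (2 ^ k)%:R^-1) ->
  u @ \oo --> lim (u @ \oo) /\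
  forall k, (N <= k)%N -> `|u k - lim (u @ \oo)| <= 2 * (2 ^ k)%:R^-1.
Proof.
move=> hu.
have step k n : (N <= k)%N -> `|u (k + n)%N - u k| <= 2 * (2 ^ k)%:R^-1 - 2 * (2 ^ (k + n))%:R^-1.
  move=> Nk; elim: n => [|n IH]; first by rewrite addn0 !subrr normr0.
  have := hu (k + n)%N (leq_trans Nk (leq_addr _ _)); rewrite addnS.
  rewrite expnS natrM invfM mulrA mulfV// mul1r => h.
  rewrite (_ : u _ - u k = (u (k + n).+1 - u (k + n)%N) + (u (k + n)%N - u k)); last by ring.
  by apply: (le_trans (ler_normD _ _)); lra.
have le2 k m : (N <= k)%N -> (k <= m)%N -> `|u m - u k| <= 2 * (2 ^ k)%:R^-1.
  move=> Nk /subnKC <-; apply: le_trans (step _ _ Nk) _.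
  by rewrite gerBl mulr_ge0// invr_ge0.
have cu : cvg (u @ \oo).
  apply/cauchy_cvgP/cauchy_exP => e e0.
  have e20 : 0 < e / 2 by rewrite divr_gt0.
  have [M hM] := pow2_small e20; pose k := maxn M N.
  exists (u k); exists k => // m /= km; rewrite /ball/= distrC.
  apply: le_lt_trans (le2 k m (leq_maxr _ _) km) _.
  by have := hM k (leq_maxl _ _); lra.
split => // k Nk; rewrite distrC.
have c1 : (fun m => `|u m - u k|) @ \oo --> `|lim (u @ \oo) - u k|.
  by apply: cvg_norm; apply: cvgB => //; exact: cvg_cst.
rewrite -(cvg_lim _ c1)//; apply: limr_le; first by apply/cvg_ex; eexists; exact: c1.
by exists k => // m /= km; exact: le2.
Qed.

Variables (T : R) (qs : nat -> R).
Hypothesis dense : forall b c, 0 <= b -> b < c -> c <= T -> exists i, b < qs i < c.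

(** The points found are strictly below [T]. With a localizing time in the role of [T], this keeps
    them where the square integral is still under its level. *)
Lemma dense_near (x dl : R) : 0 < T -> 0 <= x <= T -> 0 < dl ->
  exists2 i, 0 <= qs i < T & `|x - qs i| < dl.
Proof.
move=> T0 /andP[x0 xT] dl0; have [xltT|Tx] := ltP x T.
  have xm : x < Num.min T (x + dl) by rewrite lt_min xltT ltrDl.
  have mT : Num.min T (x + dl) <= T by rewrite ge_min lexx.
  have [i /andP[h1]] := dense x0 xm mT.
  rewrite lt_min => /andP[h2 h3]; exists i; first by rewrite h2 (le_trans x0) ?ltW.
  by rewrite ltr_norml; apply/andP; split; lra.
have m0 : 0 <= Num.max 0 (x - dl) by rewrite le_max lexx.
have mx : Num.max 0 (x - dl) < x by rewrite gt_max (lt_le_trans T0)//= ltrBlDr ltrDl.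
have [i /andP[h1 h2]] := dense m0 mx xT.
move: h1; rewrite gt_max => /andP[h1 h3]; exists i; first by rewrite (ltW h1) (lt_le_trans h2).
by rewrite ltr_norml; apply/andP; split; lra.
Qed.

Lemma continuous_dense_le (f : R -> R) (c : R) : 0 < T ->
  {within `[0, T], continuous f} -> (forall i, 0 <= qs i < T -> `|f (qs i)| <= c) ->
  forall x, 0 <= x <= T -> `|f x| <= c.
Proof.
move=> T0 /within_continuousP cf hf x xT; apply/ler_addgt0Pr => e e0.
have [dl dl0 hdl] := cf x xT e e0; have [i iT] := dense_near T0 xT dl0.
have iT' : 0 <= qs i <= T by case/andP: iT => -> /ltW.
move=> /(hdl _ iT') h; rewrite (_ : f x = (f x - f (qs i)) + f (qs i)); last by ring.
by apply: (le_trans (ler_normD _ _)); have := hf i iT; lra.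
Qed.

End real_sequences.

Section ito_existence.
Context {R : realType} {d : measure_display} {Omega : measurableType d}.
Local Notation leb := (@lebesgue_measure R).
Variables (P : probability Omega R) (T : R) (F : R -> set_system Omega).
Variable B : R -> Omega -> R.
Hypothesis T_gt0 : 0 < T.
Hypothesis usual : usual_conditions P F T.
Hypothesis bm : brownian_motion P F T B.
Variable H : R -> Omega -> R.
Hypothesis pH : progressive F T H.
Hypothesis fH : {ae P, forall w, (sqint H T w < +oo)%E}.

Let T0T : 0 <= T <= T.
Proof. by rewrite ltW//=. Qed.

(** Lenglart's inequality at all times of a dense sequence, Borel-Cantelli, and continuity of the
    simple integrals make consecutive approximations close uniformly in [q], from a random index
    on. *)
Lemma fast_simple_approximation : exists S : nat -> @simple_process R d Omega,
  (forall k, is_simple F T (S k)) /\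
  {ae P, forall w, exists N, forall k, (N <= k)%N ->
     (sqint (fun s w => sp_val (S k) s w - H s w)%R T w < ((2 ^ k)%:R^-1)%:E)%E /\
     forall q, 0 <= q <= T ->
       `|stopped_integral B (S k.+1) q w - stopped_integral B (S k) q w| <= (2 ^ k)%:R^-1}.
Proof.
have [S [sS cS _]] := simple_approximation (ltW T_gt0) pH.
(* The cube makes [dl k / eps k ^+ 2] equal to [2 ^ -k], which is summable. *)
pose dl k : R := (2 ^ k)%:R^-1 ^+ 3.
pose eps k : R := (2 ^ k)%:R^-1.
have eps0 k : 0 < eps k by rewrite invr_gt0 ltr0n expn_gt0.
have eps1 k : eps k <= 1 by rewrite invf_le1 ?ler1n ?ltr0n ?expn_gt0.
have dl0 k : 0 < dl k by rewrite exprn_gt0.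
have dlS k : dl k.+1 <= dl k.
  rewrite /dl lerXn2r ?nnegrE ?invr_ge0// lef_pV2 ?posrE ?ltr0n ?expn_gt0// ler_nat.
  by rewrite leq_exp2l.
pose G k s w := sp_val (S k) s w - H s w.
have pG k : progressive F T (G k) by apply: progressiveB => //; exact: (progressive_sp_val usual T0T).
have mG k : measurable_fun setT (sqint (G k) T) by exact: (measurable_sqint usual T0T).
have cG : cvg0_in_probability P (fun k w => sqint (G k) T w).
  by apply: cvg0_prob_ae => //; exact: ae_mono fH.
have [phi hphi] := cvg0_prob_subseq dl0 cG.
have /choice[D hD] k : exists D, [/\ is_simple F T D,
    forall s w, sp_val D s w = sp_val (S (phi k.+1)) s w + -1 * sp_val (S (phi k)) s w &
    forall B' w, sp_integral B' D w =
      sp_integral B' (S (phi k.+1)) w + -1 * sp_integral B' (S (phi k)) w].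
  exact: (simple_add usual _ T0T).
have [qs [qsT dense]] := exists_dense_seq (ltW T_gt0).
have /choice[Z hZ] k : exists Z : set Omega, [/\ measurable Z,
    (P Z <= (4 * dl k / eps k ^+ 2)%:E)%E & forall w i,
     eps k <= `|stopped_integral B (D k) (qs i) w| ->
     ((4 * dl k)%:E < sqint (sp_val (D k)) T w)%E \/ Z w].
  have [sD _ _] := hD k; apply: (simple_maximal_countable usual bm T0T sD qsT (eps0 k)).
  by rewrite mulr_ge0// ltW.
pose A k := [set w | (dl k)%:E <= sqint (G (phi k)) T w]%E `|` Z k.
have mA1 k : measurable [set w | (dl k)%:E <= sqint (G (phi k)) T w]%E.
  exact: measurable_ge_event.
have mZ k : measurable (Z k) by case: (hZ k).
have mA k : measurable (A k) by exact: measurableU.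
have sA : (\sum_(0 <= n <oo) P (A n) < +oo)%E.
  (* The approximation error accounts for 1 and Lenglart's bound for 8, as
     [4 * 2 ^ -n = 8 * 2 ^ -(n + 1)]. *)
  apply: (@summable_geometric _ _ 9) => // n.
  apply: (le_trans (measureU2 _ (mA1 n) (mZ n))).
  rewrite (_ : 9 / _ = (2 ^ n.+1)%:R^-1 + 8 / (2 ^ n.+1)%:R); last first.
    by rewrite -[X in X + _]mul1r -mulrDl; congr (_ / _); rewrite -[1]/(1%:R) -natrD.
  rewrite EFinD; apply: leeD; first exact: hphi.
  have [_ h _] := hZ n; apply: le_trans h _; rewrite lee_fin.
  rewrite /dl /eps expnS natrM invfM le_eqVlt; apply/orP; left; apply/eqP.
  have : (2 ^ n)%:R != 0 :> R by rewrite pnatr_eq0 -lt0n expn_gt0.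
  by move=> n0; field.
have [_ _ cB _] := bm.
exists (S \o phi); split=> [k|]; first exact: sS.
apply: ae_mono2 (ae_eventually_notin mA sA) cB => w [N hN] cBw.
exists N => k Nk; have /not_orP[/= nA nZ] := hN k Nk.
have /not_orP[/= nA' _] := hN k.+1 (leqW Nk).
move/negP: nA; rewrite -ltNge => nA; move/negP: nA'; rewrite -ltNge => nA'.
split.
  apply: lt_le_trans nA _; rewrite lee_fin /dl exprS ler_piMr ?(ltW (eps0 k))//.
  exact: (exprn_ile1 2 (ltW (eps0 k)) (eps1 k)).
have [sD vD iD] := hD k.
have eD q : stopped_integral B (D k) q w =
    stopped_integral B (S (phi k.+1)) q w - stopped_integral B (S (phi k)) q w.
  by rewrite /stopped_integral iD mulN1r.
move=> q qT; rewrite -eD; move: q qT.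
apply: (continuous_dense_le dense T_gt0); first exact: (continuous_stopped_integral sD cBw).
(* Off the bad events both approximation errors are below [dl k], so the square integral of [D k] is
   at most [4 * dl k]; this excludes the first alternative of [hZ], and [Z k] is excluded as
   well. *)
move=> i _; rewrite leNgt; apply/negP => /ltW h.
have [_ _ /(_ w i h)[]//] := hZ k.
apply/negP; rewrite -leNgt.
apply: (@le_trans _ _ (2%:E * (sqint (G (phi k.+1)) T w + sqint (G (phi k)) T w))%E).
  apply: (sqint_le2 (F := F)) => //.
  - exact: ltW.
  - exact: (progressive_sp_val usual T0T).
  - move=> s _; rewrite vD.
    rewrite (_ : _ + -1 * _ = G (phi k.+1) s w + - G (phi k) s w); last by rewrite /G; ring.
    by apply: (le_trans (sqrD_le2 _ _)); rewrite sqrrN.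
rewrite (_ : (4 * dl k)%:E = (2%:E * ((dl k)%:E + (dl k)%:E))%E); last first.
  by rewrite -EFinD -EFinM; congr EFin; ring.
rewrite lee_wpmul2l// leeD ?(ltW nA)//.
by apply: (le_trans (ltW nA')); rewrite lee_fin.
Qed.

(** The pathwise limit is almost surely uniform in [q], hence continuous, and one sequence of simple
    processes, restricted to [[0, q]], identifies it as the Ito integral at every time. *)
Theorem ito_process_exists : exists M, ito_integral_process P F T B H M.
Proof.
have [S [sS hS]] := fast_simple_approximation.
have [_ _ cB _] := bm.
pose N k q w := stopped_integral B (S k) q w.
pose M q w := lim (N k q w @[k --> \oo]).
exists M; split.
  apply: ae_mono2 hS cB => w [K hK] cBw.
  apply/within_continuousP => x xT e e0.
  have e40 : 0 < e / 8 by rewrite divr_gt0.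
  have [K' hK'] := pow2_small e40; pose k := maxn K K'.
  have le q : 0 <= q <= T -> `|N k q w - M q w| <= 2 * (2 ^ k)%:R^-1.
    move=> qT; have [_ h] := @geometric_cauchy _ (fun k => N k q w) K
      (fun k Kk => (hK k Kk).2 q qT).
    by apply: h; exact: leq_maxl.
  have k8 := hK' k (leq_maxr _ _).
  have /within_continuousP cN := continuous_stopped_integral (sS k) cBw.
  have e20 : 0 < e / 4 by rewrite divr_gt0.
  have [dl dl0 hdl] := cN x xT _ e20; exists dl => // y yT /(hdl y yT).
  have := le x xT; have := le y yT; rewrite -/(N k x w) -/(N k y w) => h1 h2 h3.
  rewrite (_ : M x w - M y w = (N k x w - N k y w) - (N k x w - M x w) + (N k y w - M y w)); last by ring.
  apply: (le_lt_trans (ler_normD _ _)).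
  have := ler_normB (N k x w - N k y w) (N k x w - M x w).
  by set z := (2 ^ k)%:R^-1 in h1 h2 k8; clearbody z; clear - h1 h2 h3 k8 e0; lra.
move=> q qT; have /andP[q0 q1] := qT.
have mN k : measurable_wrt (F q) (N k q) by exact: (stopped_integral_wrt usual bm (sS k) qT).
have cN : {ae P, forall w, N k q w @[k --> \oo] --> M q w}.
  apply: ae_mono hS => w [K hK].
  by have [] := @geometric_cauchy _ (fun k => N k q w) K (fun k Kk => (hK k Kk).2 q qT).
have mM : measurable_wrt (F q) (M q).
  (* The upper limit is measurable at time [q] on all paths and agrees with [M q] wherever the
     sequence converges. *)
  apply: (measurable_wrt_ae usual qT (Y := fun w => fine (limn_esup (fun k => (N k q w)%:E)))).
    apply: ae_mono cN => w cw.
    have /cvg_limn_einf_sup[_ ->//] : (N k q w)%:E @[k --> \oo] --> (M q w)%:E.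
    by apply: cvg_EFin => //; exact: nearW.
  apply: measurableT_comp => //.
  by apply: measurable_fun_limn_esup => k; apply/measurable_EFinP; exact: mN.
have pHq := progressive_le q1 pH.
split => //.
- apply: ae_mono fH => w; apply: le_lt_trans.
  apply: ge0_subset_integral => //=.
  + exact: (measurable_sqr_section w (ltW T_gt0) pH).
  + by move=> s _; rewrite lee_fin sqr_ge0.
  + by move=> s /=; rewrite !in_itv/= => /andP[-> /le_trans ->].
exists (fun k => sp_restrict (S k) q); split.
- by move=> k; exact: sp_restrict_simple (sS k) q0.
- apply: cvg0_prob_ae.
    move=> k; apply: (measurable_sqint usual qT (H := fun s w => sp_val (sp_restrict (S k) q) s w - H s w)).
    apply: progressiveB => //; apply: (progressive_sp_val usual qT).
    exact: sp_restrict_simple (sS k) q0.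
  apply: ae_mono hS => w [K hK]; apply/cvge0_leP.
    by move=> k; apply: integral_ge0 => s _; rewrite lee_fin sqr_ge0.
  move=> e e0; have [K' hK'] := pow2_small e0; exists (maxn K K') => k.
  rewrite geq_max => /andP[/hK[h _] /hK' h'].
  apply: (@le_trans _ _ (sqint (fun s w => sp_val (S k) s w - H s w) T w)); last first.
    by apply: ltW; apply: (lt_trans h); rewrite lte_fin.
  have -> : (\int[leb]_(s in `[0%R, q]) ((sp_val (sp_restrict (S k) q) s w - H s w) ^+ 2)%:E =
      \int[leb]_(s in `[0%R, q]) ((sp_val (S k) s w - H s w) ^+ 2)%:E)%E.
    apply: eq_integral => s; rewrite inE/= in_itv/= => /andP[_ sq].
    by rewrite (sp_restrict_val _ (sS k) sq).
  apply: ge0_subset_integral => //=.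
  + have pD : progressive F T (fun s w => sp_val (S k) s w - H s w).
      by apply: progressiveB => //; exact: (progressive_sp_val usual T0T).
    exact: (measurable_sqr_section w (ltW T_gt0) pD).
  + by move=> s _; rewrite lee_fin sqr_ge0.
  + by move=> s /=; rewrite !in_itv/= => /andP[-> /le_trans ->].
- apply: cvg0_prob_ae.
    move=> k; apply/measurable_EFinP; apply: measurableT_comp => //.
    apply: measurable_funB; last exact: (measurable_wrt_ambient usual qT).
    apply: (sp_integral_measurable usual bm qT).
    exact: sp_restrict_simple (sS k) q0.
  apply: ae_mono cN => w /cvgrPdist_le cw; apply/cvge0_leP => // e e0.
  have [K _ hK] := cw _ e0; exists K => k /hK /=.
  by rewrite lee_fin (sp_restrict_integral _ _ _ (sS k)) distrC.
Qed.

End ito_existence.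

(** * Martingales and local martingales *)

Section moving_bounds.
Context {R : realType} {d : measure_display} {X : measurableType d}.
Local Notation leb := (@lebesgue_measure R).

(** The moving upper bound becomes the indicator of [r <= s] inside the integrand; over the fixed
    interval [[0, u]] the pair [(s, x)] is then a mere parameter. *)
Lemma measurable_moving_integral (u : R) (f : R -> R -> X -> \bar R) :
  measurable_fun (`[0, u] `*` (`[0, u] `*` setT))
    (fun p : R * (R * X) => f p.1 p.2.1 p.2.2) ->
  measurable_fun (`[0, u] `*` setT)
    (fun q : R * X => \int[leb]_(r in `[0%R, q.1]) f r q.1 q.2)%E.
Proof.
move=> mf.
pose E : set (R * (R * X)) := (`[0, u] `*` (`[0, u] `*` setT)) `&` [set p | p.1 <= p.2.1].
have mI : measurable (`[0, u] : set R) by exact: measurable_itv.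
have mE : measurable E.
  apply: measurableI; first by do 2 (apply: measurableX => //).
  rewrite (_ : [set p | _] = (fun p : R * (R * X) => p.2.1 - p.1) @^-1` `[0, +oo[%classic).
    rewrite -[X in measurable X]setTI.
    have : measurable_fun setT (fun p : R * (R * X) => p.2.1 - p.1).
      apply: measurable_funB; last exact: measurable_fst.
      by apply: (measurableT_comp (@measurable_fst _ _ _ _)); exact: measurable_snd.
    by apply => //; exact: measurable_itv.
  by apply/seteqP; split => p /=; rewrite in_itv/= andbT subr_ge0.
pose f' := (fun p : R * (R * X) => f p.1 p.2.1 p.2.2) \_ E.
have mf' : measurable_fun setT f'.
  by apply: (measurable_restrictT _ _).1 => //; apply: (measurable_funS _ _ mf) => //;
    [do 2 (apply: measurableX => //)|move=> p []].
have := @measurable_integral_section _ (R * X)%type R `[0, u] (fun r q => f' (r, q)) mI.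
have mT : measurable_fun (`[0, u] `*` [set: R * X]) (fun p : R * (R * X) => f' (p.1, p.2)).
  by apply: measurable_funTS; apply: eq_measurable_fun mf' => -[].
move=> /(_ mT) /(@measurable_funTS _ _ _ _ (`[0, u] `*` setT)) h.
apply: eq_measurable_fun h => -[s x] /=; rewrite inE/= in_itv/= => -[/andP[s0 su] _].
rewrite integral_mkcond [RHS]integral_mkcond; apply: eq_integral => r _.
rewrite !patchE !mem_setE !in_itv/=.
case: (leP 0 r) => r0 //=; case: (leP r s) => rs /=.
  rewrite (le_trans rs su) /f' patchE mem_set// /E/= !in_itv/=.
  by rewrite r0 (le_trans rs su) s0 su.
case: (leP r u) => // ru; rewrite /f' patchE memNset// /E/= => -[_ /=].
by rewrite leNgt rs.
Qed.

End moving_bounds.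

Section martingales.
Context {R : realType} {d : measure_display} {Omega : measurableType d}.
Local Notation leb := (@lebesgue_measure R).
Variables (P : probability Omega R) (T : R) (F : R -> set_system Omega).
Variable B : R -> Omega -> R.
Hypothesis T_gt0 : 0 < T.
Hypothesis usual : usual_conditions P F T.
Hypothesis bm : brownian_motion P F T B.
Implicit Types (H M : R -> Omega -> R) (s t : R) (I : Omega -> R).
Local Notation ito := (is_ito_integral P F B).

Let T0T : 0 <= T <= T.
Proof. by rewrite ltW//=. Qed.

(** The factor [\1_E] is pulled out of the integral by locality, applied once on [E] and once on its
    complement. *)
Lemma ito_indic H s t I J (E : set Omega) : 0 <= s -> s <= t -> t <= T -> F s E ->
  progressive F T H -> {ae P, forall w, (sqint H T w < +oo)%E} ->
  ito H s I -> ito H t J ->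
  ito (fun u w => \1_E w * \1_(`]s, +oo[%classic) u * H u w) t
    (fun w => \1_E w * (J w - I w)).
Proof.
move=> s0 st tT FE pH fH iI iJ.
have sT := le_trans st tT; have s0T : 0 <= s <= T by rewrite s0.
have t0T : 0 <= t <= T by rewrite (le_trans s0).
have mEs : measurable (E : set (g_sigma_algebraType (F s))).
  exact: (measurable_event_wrt s0T).
have mE : measurable E by exact: (filtration_measurable usual s0T).
pose G u w := \1_E w * \1_(`]s, +oo[%classic) u * H u w.
have pG : progressive F T G.
  apply: progressiveM => //; apply: (progressive_start usual (Y := \1_E)) => //.
  exact: measurable_indic.
have fG : {ae P, forall w, (sqint G T w < +oo)%E}.
  apply: ae_mono fH => w; apply: le_lt_trans; apply: (sqint_le (F := F)) => //.
    exact: ltW.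
  move=> u _; rewrite /G exprMn ler_piMl ?sqr_ge0// exprn_ile1//.
have [N [_ hN]] := ito_process_exists T_gt0 usual bm pG fG.
have iN := hN t t0T.
have iD := ito_add usual bm (-1) t0T iJ (ito_extend usual s0 st tT iI).
apply: (ito_ae usual bm t0T iN).
have h1 : {ae P, forall w, E w -> N t w = J w + -1 * I w}.
  apply: (ito_eq_on usual bm t0T mE iN iD); apply: aeW => w Ew.
  apply: sqint_eq0 => u /andP[u0 ut]; rewrite /G !indicE (mem_set Ew) !mem_setE !in_itv/= u0 andbT.
  by rewrite /= ltNge; case: (u <= s); rewrite /=; ring.
have h2 : {ae P, forall w, (~` E) w -> N t w = 0}.
  apply: (ito_eq_on usual bm t0T (measurableC mE) iN (ito_zero usual bm t0T)); apply: aeW => w Ew.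
  by apply: sqint_eq0 => u _; rewrite /G indicE memNset// !mul0r subrr.
apply: ae_mono2 h1 h2 => w e1 e2; have [Ew|nE] := pselect (E w).
  by rewrite e1// indicE mem_set// mul1r mulN1r.
by rewrite e2// indicE memNset// mul0r.
Qed.

Lemma sqint_expectation_lty H t : 0 <= t <= T -> progressive F T H ->
  (\int[P]_w sqint H T w < +oo)%E -> (\int[P]_w sqint H t w < +oo)%E.
Proof.
move=> /andP[t0 tT] pH; apply: le_lt_trans.
have t0T : 0 <= t <= T by rewrite t0.
apply: ge0_le_integral => //.
- by move=> w _; exact: sqint_ge0.
- by apply: (measurable_sqint usual t0T); exact: progressive_le tT pH.
- exact: (measurable_sqint usual T0T).
move=> w _; apply: ge0_subset_integral => //=.
- exact: (measurable_sqr_section w (ltW T_gt0) pH).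
- by move=> s _; rewrite lee_fin sqr_ge0.
- by move=> s /=; rewrite !in_itv/= => /andP[-> /le_trans ->].
Qed.

Lemma ito_martingale H M : progressive F T H -> (\int[P]_w sqint H T w < +oo)%E ->
  (forall t, 0 <= t <= T -> ito H t (M t)) -> martingale P F T M.
Proof.
move=> pH H2 iM.
have fH := ito_sqint_lty (iM T T0T).
have Mi t : 0 <= t <= T -> P.-integrable setT (fun w => (M t w)%:E).
  move=> t0T; have [|//] := ito_mean usual bm t0T (iM t t0T).
  exact: sqint_expectation_lty.
split => // [t t0T|s t s0 st tT E FE]; first exact: ito_wrt (iM t t0T).
have s0T : 0 <= s <= T by rewrite s0 (le_trans st).
have t0T : 0 <= t <= T by rewrite tT (le_trans s0).
have mE : measurable E by exact: (filtration_measurable usual s0T).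
have MiE u : 0 <= u <= T -> P.-integrable E (fun w => (M u w)%:E).
  by move=> /Mi; apply: integrableS.
have iE := ito_indic s0 st tT FE pH fH (iM s s0T) (iM t t0T).
set G := fun u w => \1_E w * \1_(`]s, +oo[%classic) u * H u w in iE.
have G2 : (\int[P]_w sqint G t w < +oo)%E.
  apply: le_lt_trans (sqint_expectation_lty t0T pH H2).
  have pHt := progressive_le tT pH.
  apply: ge0_le_integral => //.
  - by move=> w _; exact: sqint_ge0.
  - by apply: (measurable_sqint usual t0T); exact: ito_progressive iE.
  - exact: (measurable_sqint usual t0T).
  move=> w _; apply: (sqint_le (F := F)) => //.
    by case/andP: t0T.
    exact: ito_progressive iE.
  move=> u _; rewrite /G exprMn ler_piMl ?sqr_ge0// exprn_ile1//.
have [_ I0] := ito_mean usual bm t0T iE G2.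
have E0 : (\int[P]_(w in E) ((M t w)%:E - (M s w)%:E) = 0)%E.
  rewrite integral_mkcond -[RHS]I0; apply: eq_integral => w _.
  by rewrite patchE indicE; case: (w \in E); rewrite ?mul1r ?mul0r// EFinB.
rewrite -[RHS]add0e -E0 integralB//; last 2 first.
- exact: MiE.
- exact: MiE.
by rewrite subeK//; apply: integrable_fin_num => //; exact: MiE.
Qed.

Lemma martingale_ae M N : martingale P F T M ->
  (forall t, 0 <= t <= T -> {ae P, forall w, M t w = N t w}) -> martingale P F T N.
Proof.
move=> [aM iM eM] e.
have aN : adapted F T N.
  by move=> t t0T; apply: (measurable_wrt_ae usual t0T (e t t0T)); exact: aM.
have mM t : 0 <= t <= T -> measurable_fun setT (fun w => (M t w)%:E).
  by move=> t0T; apply/measurable_EFinP; exact: (measurable_wrt_ambient usual t0T (aM t t0T)).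
have mN t : 0 <= t <= T -> measurable_fun setT (fun w => (N t w)%:E).
  by move=> t0T; apply/measurable_EFinP; exact: (measurable_wrt_ambient usual t0T (aN t t0T)).
have eI t E : 0 <= t <= T -> measurable E ->
    (\int[P]_(w in E) (N t w)%:E = \int[P]_(w in E) (M t w)%:E)%E.
  move=> t0T mE; apply: ae_eq_integral => //; [exact: measurable_funTS (mN t t0T)|exact: measurable_funTS (mM t t0T)|].
  by apply: ae_mono (e t t0T) => w ->.
split => // [t t0T|s t s0 st tT E FE].
  have /integrableP[_ h] := iM t t0T; apply/integrableP; split; first exact: mN.
  apply: le_lt_trans h; rewrite le_eqVlt; apply/orP; left; apply/eqP.
  apply: ae_eq_integral => //.
  - by apply: measurableT_comp => //; exact: mN.
  - by apply: measurableT_comp => //; exact: mM.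
  - by apply: ae_mono (e t t0T) => w ->.
have s0T : 0 <= s <= T by rewrite s0 (le_trans st).
have t0T : 0 <= t <= T by rewrite tT (le_trans s0).
have mE : measurable E by exact: (filtration_measurable usual s0T).
by rewrite !eI//; exact: eM.
Qed.

End martingales.

Section cadlag_paths.
Context {R : realType}.

Lemma within_continuous_cadlag (T : R) (f : R -> R) :
  {within `[0, T], continuous f} -> cadlag T f.
Proof.
move=> /within_continuousP cf; split=> t /andP[t0 tT].
  apply/cvgrPdist_lt => e e0; have [|dl dl0 h] := cf t _ e e0; first by rewrite t0 ltW.
  near=> s; have st : t < s by near: s; exact: nbhs_right_gt.
  have sT : s < T by near: s; exact: nbhs_right_lt.
  have sd : s < t + dl by near: s; apply: nbhs_right_lt; rewrite ltrDl.
  apply: h; first by rewrite (le_trans t0 (ltW st)) ltW.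
  by rewrite ltr_norml; apply/andP; split; lra.
apply/cvg_ex; exists (f t); apply/cvgrPdist_lt => e e0.
have [|dl dl0 h] := cf t _ e e0; first by rewrite tT ltW.
near=> s; have st : s < t by near: s; exact: nbhs_left_lt.
have s0 : 0 < s by near: s; exact: nbhs_left_gt.
have sd : t - dl < s by near: s; apply: nbhs_left_gt; rewrite ltrBlDr ltrDl.
apply: h; first by rewrite ltW//= (le_trans (ltW st)).
by rewrite ltr_norml; apply/andP; split; lra.
Unshelve. all: by end_near. Qed.

Lemma within_continuous_le (T T' : R) (f : R -> R) : T' <= T ->
  {within `[0, T], continuous f} -> {within `[0, T'], continuous f}.
Proof.
move=> T'T /within_continuousP cf; apply/within_continuousP => x /andP[x0 xT] e e0.
have [|dl dl0 h] := cf x _ e e0; first by rewrite x0 (le_trans xT).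
by exists dl => // y /andP[y0 yT]; apply: h; rewrite y0 (le_trans yT).
Qed.

Lemma within_continuousB (T : R) (f g : R -> R) : {within `[0, T], continuous f} ->
  {within `[0, T], continuous g} -> {within `[0, T], continuous (fun x => f x - g x)}.
Proof.
move=> /subspace_continuousP cf /subspace_continuousP cg.
by apply/subspace_continuousP => x xT; apply: cvgB; [exact: cf|exact: cg].
Qed.

End cadlag_paths.

Section localization.
Context {R : realType} {d : measure_display} {Omega : measurableType d}.
Local Notation leb := (@lebesgue_measure R).
Variables (P : probability Omega R) (T : R) (F : R -> set_system Omega).
Variable B : R -> Omega -> R.
Hypothesis T_gt0 : 0 < T.
Hypothesis usual : usual_conditions P F T.
Hypothesis bm : brownian_motion P F T B.
Implicit Types (M : R -> Omega -> R) (s t : R) (n : nat).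
Local Notation ito := (is_ito_integral P F B).
Variable H : R -> Omega -> R.
Hypothesis pH : progressive F T H.

Let T0T : 0 <= T <= T.
Proof. by rewrite ltW//=. Qed.

Lemma sqint_homo s t w : s <= t -> t <= T -> (sqint H s w <= sqint H t w)%E.
Proof.
move=> st tT; have [s0|s0] := ltP s 0.
  rewrite /sqint (_ : `[0, s]%classic = set0) ?integral_set0; first exact: sqint_ge0.
  by apply/seteqP; split => u //=; rewrite in_itv/= => /andP[u0 /(le_trans u0)]; rewrite leNgt s0.
apply: ge0_subset_integral => //=.
- exact: (measurable_sqr_section w (le_trans s0 st) (progressive_le tT pH)).
- by move=> u _; rewrite lee_fin sqr_ge0.
- by move=> u /=; rewrite !in_itv/= => /andP[-> /le_trans ->].
Qed.

Lemma sqint0 (G : R -> Omega -> R) w : sqint G 0 w = 0%E.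
Proof. by rewrite /sqint set_itv1 integral_set1. Qed.

(** The cut-off tests the current value of the square integral and not a stopping time, so that
    progressivity reduces to that of a moving integral. *)
Definition truncated n s w : R := H s w * \1_([set x | (x <= n%:R%:E)%E]) (sqint H s w).

Lemma truncated_below n s w : (sqint H s w <= n%:R%:E)%E -> truncated n s w = H s w.
Proof. by move=> h; rewrite /truncated indicE mem_set// mulr1. Qed.

Lemma truncated_above n s w : (n%:R%:E < sqint H s w)%E -> truncated n s w = 0.
Proof. by move=> h; rewrite /truncated indicE memNset ?mulr0//= leNgt h. Qed.

Lemma progressive_truncated n : progressive F T (truncated n).
Proof.
move=> u /andP[u0 uT]; apply: measurable_funM; first by apply: pH; rewrite u0.
have mf : @measurable_fun _ _ (R * (R * g_sigma_algebraType (F u)))%type _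
   (`[0, u] `*` (`[0, u] `*` setT)) (fun p => ((H p.1 p.2.2) ^+ 2)%:E).
  apply/measurable_EFinP; apply: measurable_funX.
  have mI : measurable (`[0, u] : set R) by exact: measurable_itv.
  apply: (@measurable_comp _ _ _ _ _ _ (`[0, u] `*` setT)
    (fun p : R * g_sigma_algebraType (F u) => H p.1 p.2) _
    (fun p : R * (R * g_sigma_algebraType (F u)) => (p.1, p.2.2))).
  - by apply: measurableX.
  - by move=> _ [[a [b w]] /= [am _] <-].
  - by apply: pH; rewrite u0.
  - apply: measurable_funTS; apply/measurable_fun_pairP; split => /=; first exact: measurable_fst.
    exact: (measurableT_comp (@measurable_snd _ _ _ _) (@measurable_snd _ _ _ _)).
have mQ := @measurable_moving_integral R _ (g_sigma_algebraType (F u)) u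
  (fun r _ w => ((H r w) ^+ 2)%:E) mf.
apply: (measurableT_comp _ mQ); apply: measurable_indic.
by rewrite (_ : [set x | _] = `]-oo, n%:R%:E]%classic) //; exact: emeasurable_itv.
Qed.

Definition exhausted n w : set R := [set s | 0 <= s <= T /\ (sqint H s w <= n%:R%:E)%E].

(* A supremum over [0, T], so it is defined (and a stopping time) even on the null
   set where the integral of H^2 is infinite. *)
Definition localizing_time n w : R := sup (exhausted n w).

Let exhausted0 n w : exhausted n w 0.
Proof. by split; [rewrite lexx ltW|rewrite sqint0 lee_fin]. Qed.

Let has_ub_exhausted n w : has_ubound (exhausted n w).
Proof. by exists T => s [/andP[]]. Qed.

Lemma localizing_time_itv n w : 0 <= localizing_time n w <= T.
Proof.
apply/andP; split; first by apply: ub_le_sup => //; exact: exhausted0.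
by apply: ge_sup; [exists 0; exact: exhausted0|move=> s [/andP[]]].
Qed.

Lemma before_localizing_time n s w : 0 <= s -> s < localizing_time n w ->
  (sqint H s w <= n%:R%:E)%E.
Proof.
move=> s0 st; have [|u [/andP[_ uT] hu] su] := sup_gt _ st.
  by exists 0; exact: exhausted0.
by apply: le_trans hu; apply: sqint_homo => //; exact: ltW.
Qed.

Lemma after_localizing_time n s w : localizing_time n w < s -> s <= T ->
  (n%:R%:E < sqint H s w)%E.
Proof.
move=> ts sT; rewrite ltNge; apply/negP => h.
have /andP[t0 _] := localizing_time_itv n w.
suff : s <= localizing_time n w by rewrite leNgt ts.
by apply: ub_le_sup => //; split => //; rewrite sT (le_trans t0 (ltW ts)).
Qed.

Lemma localizing_time_homo n w : localizing_time n w <= localizing_time n.+1 w.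
Proof.
apply: ge_sup; first by exists 0; exact: exhausted0.
move=> s [sT hs]; apply: ub_le_sup => //; split => //.
by apply: (le_trans hs); rewrite lee_fin ler_nat.
Qed.

Lemma localizing_time_end w : (sqint H T w < +oo)%E -> exists n, localizing_time n w = T.
Proof.
move=> h; have fQ : sqint H T w \is a fin_num by rewrite ge0_fin_numE// sqint_ge0.
exists (Num.truncn (fine (sqint H T w))).+1; apply/eqP; rewrite eq_le.
have /andP[_ ->]/= := localizing_time_itv (Num.truncn (fine (sqint H T w))).+1 w.
apply: ub_le_sup => //; split => //.
by rewrite -(fineK fQ) lee_fin; apply/ltW/truncnS_gt.
Qed.

(** The event that the supremum is at most [t] depends on the square integral at times just after
    [t]. It therefore lies in [F r] for every [r > t], and right-continuity of the filtration brings
    it down to [F t]. *)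
Lemma stopping_time_localizing n : stopping_time F T (localizing_time n).
Proof.
split=> [w|t /andP[t0 tT]]; first exact: localizing_time_itv.
have t0T : 0 <= t <= T by rewrite t0.
have [tltT|Tt] := ltP t T; last first.
  rewrite (_ : [set w | _] = setT).
    rewrite -(sigma_algebra_id (filtration_sigma usual t0T)).
    exact: (@measurableT _ (g_sigma_algebraType (F t))).
  apply/seteqP; split => // w _ /=; have /andP[_] := localizing_time_itv n w.
  by move=> /le_trans; apply.
have [_ rc _] := usual; apply: rc; first by rewrite t0.
move=> r; rewrite /= in_itv/= => /andP[tr rT].
have r0 : 0 <= r by rewrite (le_trans t0) ?ltW.
have r0T : 0 <= r <= T by rewrite r0.
rewrite -(sigma_algebra_id (filtration_sigma usual r0T)).
(* Times decreasing to [t] and staying in []t, r]]. *)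
pose q (m : nat) := t + (r - t) / m.+1%:R.
have rt0 : 0 < r - t by rewrite subr_gt0.
have qt m : t < q m by rewrite ltrDl divr_gt0.
have qr m : q m <= r.
  rewrite /q -lerBrDl ler_pdivrMr//; apply: ler_peMr; first exact: ltW.
  by rewrite ler1n.
have -> : [set w | localizing_time n w <= t] =
    \bigcap_m [set w | (n%:R%:E < sqint H (q m) w)%E].
  apply/seteqP; split => w /=.
    by move=> h m _; apply: after_localizing_time; [exact: le_lt_trans (qt m)|exact: le_trans rT].
  move=> h; rewrite leNgt; apply/negP => tt.
  have d0 : 0 < localizing_time n w - t by rewrite subr_gt0.
  pose m := Num.truncn ((localizing_time n w - t)^-1 * (r - t)).
  have := h m Logic.I; apply/negP; rewrite /= -leNgt.
  apply: before_localizing_time; first by rewrite (le_trans t0) ?ltW.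
  rewrite /q -ltrBrDl ltr_pdivrMr// -ltr_pdivrMl//.
  exact: truncnS_gt.
apply: (@bigcapT_measurable _ (g_sigma_algebraType (F r))) => m.
have q0 : 0 <= q m by rewrite (le_trans t0) ?ltW.
have mQ := measurable_wrt_sqint q0 (progressive_le (le_trans (qr m) rT) pH).
have mid : measurable_fun setT (id : g_sigma_algebraType (F r) -> g_sigma_algebraType (F (q m))).
  by apply: measurable_id_sub; exact: (filtration_le usual).
have := measurableT_comp mQ mid => /(_ measurableT _ (emeasurable_itv `]n%:R%:E, +oo[)).
rewrite setTI; congr (measurable _); apply/seteqP; split => w /=; rewrite in_itv/= andbT//.
Qed.

Lemma sqint_truncated_le n w : (sqint (truncated n) T w <= n%:R%:E)%E.
Proof.
set tau := localizing_time n w; have /andP[tau0 tauT] := localizing_time_itv n w.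
have mS : measurable_fun `[0, T] (fun s => ((H s w) ^+ 2)%:E).
  exact: (measurable_sqr_section w (ltW T_gt0) pH).
have eE : sqint (truncated n) T w = (\int[leb]_(s in exhausted n w) ((H s w) ^+ 2)%:E)%E.
  rewrite /sqint integral_mkcond [RHS]integral_mkcond; apply: eq_integral => s _.
  rewrite !patchE mem_setE in_itv/=; case: (boolP (0 <= s <= T)) => sT; last first.
    by rewrite memNset// => -[]; rewrite (negbTE sT).
  have [h|h] := leP (sqint H s w) n%:R%:E.
    by rewrite mem_set// truncated_below.
  by rewrite memNset ?truncated_above ?expr0n// => -[_]; rewrite leNgt h.
(* If [tau] belongs to [exhausted], that set is [[0, tau]]; otherwise it is an increasing union of
   closed intervals ending before [tau], and monotone convergence carries the bound over. *)
rewrite eE; have [h|h] := leP (sqint H tau w) n%:R%:E.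
  rewrite (_ : exhausted n w = `[0, tau]%classic)//; apply/seteqP; split => s /=.
    move=> [/andP[s0 sT] hs]; rewrite in_itv/= s0; apply: ub_le_sup => //; split => //.
    by rewrite s0.
  rewrite in_itv/= => /andP[s0 st]; split; first by rewrite s0 (le_trans st).
  by apply: le_trans h; exact: sqint_homo.
pose A m := `[0, tau - m.+1%:R^-1]%classic : set R.
have eA : exhausted n w = \bigcup_m A m.
  apply/seteqP; split => s.
    move=> [/andP[s0 sT] hs].
    have st : s < tau.
      rewrite lt_neqAle; apply/andP; split.
        by apply/eqP => est; move: h; rewrite -est ltNge hs.
      by apply: ub_le_sup => //; split => //; rewrite s0.
    have ts0 : 0 < tau - s by rewrite subr_gt0.
    exists (Num.truncn (tau - s)^-1) => //; rewrite /A/= in_itv/= s0 lerBrDr -lerBrDl.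
    rewrite -[leRHS]invrK lef_pV2 ?posrE ?invr_gt0//.
    by apply/ltW/truncnS_gt.
  move=> [m _]; rewrite /A/= in_itv/= => /andP[s0 sm].
  have st : s < tau by apply: (le_lt_trans sm); rewrite ltrBlDr ltrDl invr_gt0.
  split; first by rewrite s0 (le_trans (ltW st)).
  exact: before_localizing_time.
have mA m : measurable (A m : set (measurableTypeR R)) by exact: measurable_itv.
have AT m : A m `<=` `[0, T]%classic.
  move=> s; rewrite /A/= !in_itv/= => /andP[-> /le_trans]; apply.
  by apply: le_trans tauT; rewrite gerBl.
have cA : (\int[leb]_(s in A m) ((H s w) ^+ 2)%:E)%E @[m --> \oo] -->
    (\int[leb]_(s in \bigcup_m A m) ((H s w) ^+ 2)%:E)%E.
  apply: ge0_nondecreasing_set_cvg_integral => //.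
  - move=> i j ij; apply/subsetPset => s; rewrite /A/= !in_itv/= => /andP[-> /le_trans]; apply.
    by rewrite lerD2l lerN2 lef_pV2 ?posrE// ler_nat.
  - by move=> m; apply: (measurable_funS _ (@AT m) mS); exact: measurable_itv.
  - by move=> m s _; rewrite lee_fin sqr_ge0.
rewrite eA -(cvg_lim _ cA)//; apply: lime_le; first by apply/cvg_ex; eexists; exact: cA.
apply: nearW => m; rewrite -/(sqint H (tau - m.+1%:R^-1) w).
have [m0|m0] := leP 0 (tau - m.+1%:R^-1).
  by apply: before_localizing_time => //; rewrite ltrBlDr ltrDl invr_gt0.
rewrite /sqint (_ : `[0, _]%classic = set0) ?integral_set0//.
by apply/seteqP; split => u //=; rewrite in_itv/= => /andP[u0 /(le_trans u0)]; rewrite leNgt m0.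
Qed.

End localization.

Section local_martingale_of_ito.
Context {R : realType} {d : measure_display} {Omega : measurableType d}.
Local Notation leb := (@lebesgue_measure R).
Variables (P : probability Omega R) (T : R) (F : R -> set_system Omega).
Variable B : R -> Omega -> R.
Hypothesis T_gt0 : 0 < T.
Hypothesis usual : usual_conditions P F T.
Hypothesis bm : brownian_motion P F T B.
Implicit Types (s t : R) (n : nat).
Local Notation ito := (is_ito_integral P F B).
Variables H M : R -> Omega -> R.
Hypothesis pH : progressive F T H.
Hypothesis fH : {ae P, forall w, (sqint H T w < +oo)%E}.
Hypothesis MH : ito_integral_process P F T B H M.

Let T0T : 0 <= T <= T.
Proof. by rewrite ltW//=. Qed.

Lemma ito_integral_zero (G : R -> Omega -> R) I : ito G 0 I ->
  {ae P, forall w, I w = 0}.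
Proof.
move=> iG; have T0 : 0 <= (0 : R) <= T by apply/andP; split; [exact: lexx|exact: ltW].
have := ito_eq_on usual bm T0 measurableT iG (ito_zero usual bm T0).
move=> h; apply: (ae_mono (A := fun w => setT w -> I w = 0)); first by move=> w; apply.
by apply: h; apply: aeW => w _; exact: sqint0.
Qed.

Section stopping.
Variables (n : nat) (N : R -> Omega -> R).
Hypothesis NH : ito_integral_process P F T B (truncated H n) N.

Lemma truncated_agree t : 0 <= t <= T ->
  {ae P, forall w, (sqint H t w <= n%:R%:E)%E -> M t w = N t w}.
Proof.
move=> t0T; have [_ iM] := MH; have [_ iN] := NH; have /andP[t0 tT] := t0T.
have mD : measurable [set w | (sqint H t w <= n%:R%:E)%E].
  have mQ := measurable_sqint usual t0T (progressive_le tT pH).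
  rewrite (_ : [set w | _] = sqint H t @^-1` `]-oo, n%:R%:E]%classic).
    by rewrite -[X in measurable X]setTI; apply: mQ => //; exact: emeasurable_itv.
  by apply/seteqP; split => w /=; rewrite in_itv.
apply: (ito_eq_on usual bm t0T mD (iM t t0T) (iN t t0T)); apply: aeW => w /= hw.
apply: sqint_eq0 => s /andP[s0 st]; rewrite truncated_below ?subrr//.
by apply: le_trans hw; exact: (sqint_homo pH).
Qed.

(** Once the square integral has exceeded [n] at time [s], the truncated integrand vanishes on []s,
    t]]; locality compares its integral over [[0, t]] with the extension of the one over
    [[0, s]]. *)
Lemma truncated_frozen s t : 0 <= s -> s <= t -> t <= T ->
  {ae P, forall w, (n%:R%:E < sqint H s w)%E -> N t w = N s w}.
Proof.
move=> s0 st tT; have [_ iN] := NH.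
have s0T : 0 <= s <= T by rewrite s0 (le_trans st).
have t0T : 0 <= t <= T by rewrite (le_trans s0).
have mD : measurable [set w | (n%:R%:E < sqint H s w)%E].
  have mQ := measurable_sqint usual s0T (progressive_le (le_trans st tT) pH).
  rewrite (_ : [set w | _] = sqint H s @^-1` `]n%:R%:E, +oo[%classic).
    by rewrite -[X in measurable X]setTI; apply: mQ => //; exact: emeasurable_itv.
  by apply/seteqP; split => w /=; rewrite in_itv/= andbT.
apply: (ito_eq_on usual bm t0T mD (iN t t0T) (ito_extend usual s0 st tT (iN s s0T))).
apply: aeW => w /= hw; apply: sqint_eq0 => u /andP[u0 ut].
rewrite indicE mem_setE in_itv/= u0/=; have [us|su] := leP u s; first by rewrite mulr1 subrr.
rewrite truncated_above ?mul0r ?subrr//.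
by apply: (lt_le_trans hw); apply: (sqint_homo pH); [exact: ltW|exact: le_trans tT].
Qed.

(** A random time cannot be substituted into statements that hold almost surely at each fixed time.
    Agreement and freezing are therefore collected on a countable dense set of times, off one null
    set, and carried to the localizing time by continuity of paths. *)
Lemma stopped_ito t : 0 <= t <= T ->
  {ae P, forall w, N t w = M (Num.min t (localizing_time T H n w)) w - M 0 w}.
Proof.
move=> t0T; have /andP[t0 tT] := t0T.
have T0 : 0 <= (0 : R) <= T by apply/andP; split; [exact: lexx|exact: ltW].
have [cM iM] := MH; have [cN iN] := NH.
have [qs [qsT dense]] := exists_dense_seq (ltW T_gt0).
have h1 : {ae P, forall w, forall i, (sqint H (qs i) w <= n%:R%:E)%E ->
    M (qs i) w = N (qs i) w}.
  by apply/ae_foralln => i; exact: truncated_agree.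
have h2 : {ae P, forall w, forall i, qs i <= t -> (n%:R%:E < sqint H (qs i) w)%E ->
    N t w = N (qs i) w}.
  apply/ae_foralln => i; have [qt|tq] := leP (qs i) t.
    have /andP[q0 _] := qsT i.
    by apply: ae_mono (truncated_frozen q0 qt tT) => w h _; exact: h.
  by apply: aeW => w.
have z := ae_mono2 (C := fun w => M 0 w = 0 /\ N 0 w = 0) (fun w a b => conj a b)
  (ito_integral_zero (iM 0 T0)) (ito_integral_zero (iN 0 T0)).
have c := ae_mono2 (C := fun w => {within `[0, T], continuous (fun t => M t w)} /\
  {within `[0, T], continuous (fun t => N t w)}) (fun w a b => conj a b) cM cN.
have h := ae_mono2 (C := fun w => _ /\ _) (fun w a b => conj a b) h1 h2.
have zc := ae_mono2 (C := fun w => _ /\ _) (fun w a b => conj a b) z c.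
apply: ae_mono2 h zc => w [e1 e2] [[M0 N0] [cMw cNw]].
rewrite M0 subr0; set tau := localizing_time T H n w.
have /andP[tau0 tauT] : 0 <= tau <= T by exact: localizing_time_itv.
have below s : 0 <= s <= tau -> M s w = N s w.
  move=> /andP[s0 st]; have [tauz|taup] := leP tau 0.
    have -> : s = 0 by apply/eqP; rewrite eq_le s0 (le_trans st).
    by rewrite M0 N0.
  have densetau b c' : 0 <= b -> b < c' -> c' <= tau -> exists i, b < qs i < c'.
    by move=> b0 bc ct; apply: dense => //; exact: le_trans tauT.
  have cD := within_continuous_le tauT (within_continuousB cMw cNw).
  have := continuous_dense_le densetau taup cD (c := 0).
  suff hq i : 0 <= qs i < tau -> `|M (qs i) w - N (qs i) w| <= 0.
    move=> /(_ hq s); rewrite s0 st normr_le0 subr_eq0 => /(_ isT)/eqP//.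
  move=> /andP[q0 qt]; rewrite e1 ?subrr ?normr0//.
  exact: (before_localizing_time T_gt0 pH q0 qt).
have [tt|tt] := leP t tau; first by rewrite below// t0.
(* After [tau]: a dense time just to the right of [tau] gives a value that is already frozen and, by
   continuity, close to [N tau]. *)
rewrite below ?tau0 ?lexx//; apply/eqP; rewrite -subr_eq0 -normr_le0.
apply/ler_addgt0Pr => e e0; rewrite add0r.
have /within_continuousP/(_ tau) := cNw; rewrite tau0 tauT => /(_ isT e e0)[dl dl0 hdl].
have tm : tau < Num.min t (tau + dl) by rewrite lt_min tt ltrDl.
have mT : Num.min t (tau + dl) <= T by rewrite ge_min tT.
have [i /andP[i1]] := dense _ _ tau0 tm mT; rewrite lt_min => /andP[i2 i3].
rewrite (e2 i (ltW i2)); last first.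
  by apply: (after_localizing_time T_gt0 i1); rewrite (le_trans (ltW i2)).
rewrite distrC; apply/ltW/hdl; first exact: qsT.
by rewrite ltr_norml; apply/andP; split; lra.
Qed.

End stopping.

Theorem ito_local_martingale : local_martingale P F T M.
Proof.
have [cM iM] := MH; split.
- by move=> t t0T; exact: ito_wrt (iM t t0T).
- by apply: ae_mono cM => w; exact: within_continuous_cadlag.
exists (localizing_time T H); split.
- by move=> n; exact: (stopping_time_localizing T_gt0 usual).
- by move=> n w; exact: localizing_time_homo.
- by apply: ae_mono fH => w; exact: localizing_time_end.
move=> n; have pN := progressive_truncated pH n.
have lN w := sqint_truncated_le T_gt0 pH n w.
have fN : {ae P, forall w, (sqint (truncated H n) T w < +oo)%E}.
  by apply: aeW => w; apply: (le_lt_trans (lN w)); exact: ltry.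
have [N NH] := ito_process_exists T_gt0 usual bm pN fN.
have [_ iN] := NH.
apply: (martingale_ae usual _ (fun t t0T => stopped_ito NH t0T)).
apply: (ito_martingale T_gt0 usual bm pN) => //.
apply: (@le_lt_trans _ _ (\int[P]_w n%:R%:E)%E).
  apply: ge0_le_integral => //.
  - by move=> w _; exact: sqint_ge0.
  - exact: (measurable_sqint usual T0T).
by rewrite integral_cst// [X in (_ * X)%E]probability_setT mule1 ltry.
Qed.

End local_martingale_of_ito.

(** * Kernels and the inner stochastic integral *)

Section iterated_integrals.
Context {d1 d2 : measure_display} {T1 : measurableType d1} {T2 : measurableType d2}.
Context {R : realType}.
Variables (m1 : {sigma_finite_measure set T1 -> \bar R}).
Variables (m2 : {sigma_finite_measure set T2 -> \bar R}).
Local Open Scope ereal_scope.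

Lemma tonelli_strip (D : set T1) (f : T1 -> T2 -> \bar R) : measurable D ->
  measurable_fun (D `*` setT) (fun p : T1 * T2 => f p.1 p.2) ->
  (forall x y, D x -> 0 <= f x y) ->
  \int[m2]_y \int[m1]_(x in D) f x y = \int[m1]_(x in D) \int[m2]_y f x y.
Proof.
move=> mD mf f0.
pose g : T1 * T2 -> \bar R := (fun p => f p.1 p.2) \_ (D `*` setT).
have mDT : measurable (D `*` [set: T2]) by exact: measurableX.
have mg : measurable_fun setT g by apply: (measurable_restrictT _ _).1.
have gE x y : g (x, y) = ((f ^~ y) \_ D) x.
  rewrite /g !patchE; have -> : ((x, y) \in D `*` [set: T2]) = (x \in D).
    by apply/idP/idP; rewrite !inE//= => -[].
  by [].
have g0 p : 0 <= g p.
  by case: p => x y; rewrite gE patchE; case: ifPn => // /set_mem Dx; exact: f0.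
have h := @fubini_tonelli _ _ _ _ R m1 m2 g mg g0.
rewrite [RHS]integral_mkcond; transitivity (\int[m2]_y \int[m1]_x g (x, y)).
  apply: eq_integral => y _; rewrite integral_mkcond.
  by apply: eq_integral => x _; rewrite gE.
rewrite -h; apply: eq_integral => x _; rewrite patchE.
case: ifPn => Dx; first by apply: eq_integral => y _; rewrite gE patchE Dx.
by apply: integral0_eq => y _; rewrite gE patchE (negbTE Dx).
Qed.

Lemma measurable_strip_integral (D : set T1) (f : T1 -> T2 -> \bar R) : measurable D ->
  measurable_fun (D `*` setT) (fun p : T1 * T2 => f p.1 p.2) ->
  (forall x y, D x -> 0 <= f x y) ->
  measurable_fun D (fun x => \int[m2]_y f x y).
Proof.
move=> mD mf f0.
pose g : T1 * T2 -> \bar R := (fun p => f p.1 p.2) \_ (D `*` setT).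
have mDT : measurable (D `*` [set: T2]) by exact: measurableX.
have mg : measurable_fun setT g by apply: (measurable_restrictT _ _).1.
have g0 p : 0 <= g p.
  by rewrite /g patchE; case: ifPn => // /set_mem[Dx _]; exact: f0.
have := @measurable_fun_fubini_tonelli_F _ _ _ _ R m2 g mg g0.
move=> /(@measurable_funTS _ _ _ _ D); apply: eq_measurable_fun => x Dx.
apply: eq_integral => y _; rewrite /g patchE ifT//.
by apply/mem_set; split => //=; exact: set_mem.
Qed.

End iterated_integrals.

Section kernels.
Context {R : realType}.
Local Notation leb := (@lebesgue_measure R).
Local Notation TR := (measurableTypeR R).

(** Cauchy-Schwarz against the constant 1, obtained as Jensen for the single cell [cell t 1], which
    is []0, t]]. *)
Lemma sqr_Rintegral_le (t : R) (f : TR -> R) : 0 < t -> measurable_fun setT f ->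
  (((\int[leb]_(s in `[0%R, t]) f s) ^+ 2)%:E <=
   t%:E * \int[leb]_(s in `[0%R, t]) ((f s) ^+ 2)%:E)%E.
Proof.
move=> t0 mf.
have mI : measurable (`]0%R, t] : set TR) by exact: measurable_itv.
have e1 : \int[leb]_(s in `[0%R, t]) f s = t * cell_avg t f 1.
  rewrite /cell_avg /cell mulVKf ?gt_eqF// subrr mul0r mul1r /Rintegral.
  by congr fine; rewrite integral_itv_obnd_cbnd//; apply/measurable_EFinP; exact: measurable_funTS.
have e2 : (\int[leb]_(s in `[0%R, t]) ((f s) ^+ 2)%:E =
    \int[leb]_(s in cell t 1) ((f s) ^+ 2)%:E)%E.
  rewrite /cell subrr mul0r mul1r integral_itv_obnd_cbnd//.
  by apply/measurable_EFinP; apply: measurable_funX; exact: measurable_funTS.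
rewrite e1 e2; have := cell_avg_jensen 1 t0 mf => /(lee_wpmul2l (_ : 0 <= t%:E)%E).
rewrite lee_fin ltW// => /(_ isT); apply: le_trans.
by rewrite -EFinM lee_fin le_eqVlt; apply/orP; left; apply/eqP; ring.
Qed.

(** Extension by 0 off the triangle: the kernel becomes measurable on the whole plane, so Tonelli
    and averaging involve no moving bounds. *)
Definition kext (T : R) (K : R -> R -> R) (u s : R) : R :=
  if [&& 0 <= u, u <= s & s <= T] then K u s else 0.

Lemma kext_in T K u s : 0 <= u -> u <= s -> s <= T -> kext T K u s = K u s.
Proof. by rewrite /kext => -> -> ->. Qed.

Lemma kext_out T K u s : ~~ [&& 0 <= u, u <= s & s <= T] -> kext T K u s = 0.
Proof. by rewrite /kext => /negbTE ->. Qed.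

Lemma measurable_triangle T : measurable (triangle T : set (R * R)).
Proof.
have m1 := @measurable_fst _ _ R R; have m2 := @measurable_snd _ _ R R.
have mB : measurable_fun setT (fun p : R * R => p.2 - p.1) by exact: measurable_funB.
rewrite (_ : triangle T = (fst @^-1` `[0, +oo[%classic) `&`
  ((fun p : R * R => p.2 - p.1) @^-1` `[0, +oo[%classic) `&` (snd @^-1` `]-oo, T]%classic)).
  apply: measurableI; first apply: measurableI.
  - by rewrite -[X in measurable X]setTI; apply: m1 => //; exact: measurable_itv.
  - by rewrite -[X in measurable X]setTI; apply: mB => //; exact: measurable_itv.
  - by rewrite -[X in measurable X]setTI; apply: m2 => //; exact: measurable_itv.
apply/seteqP; split => -[u s] /=; rewrite /triangle/= !in_itv/= !andbT subr_ge0.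
  by move=> [? []].
by move=> [[]].
Qed.

Lemma measurable_kext T K : measurable_on_triangle T K ->
  measurable_fun setT (fun p : R * R => kext T K p.1 p.2).
Proof.
move=> mK; have := (measurable_restrictT _ (measurable_triangle T)).1 mK.
congr (measurable_fun _ _); apply/funext => -[u s]; rewrite patchE /kext/=.
case: ifPn => [/set_mem[/= -> [-> ->]]//|].
by case: and3P => // -[h1 h2 h3]; rewrite mem_set.
Qed.

Lemma measurable_kext2 T K s : measurable_on_triangle T K ->
  measurable_fun setT (kext T K ^~ s : TR -> R).
Proof.
move=> /measurable_kext mK; apply: (measurableT_comp mK (g := fun u : TR => (u, s))).
by apply: measurable_fun_pair => //; exact: measurable_cst.
Qed.

Lemma measurable_kext_diag T K : measurable_on_triangle T K ->
  measurable_fun setT (fun s : TR => kext T K s s).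
Proof.
move=> /measurable_kext mK; apply: (measurableT_comp mK (g := fun u : TR => (u, u))).
exact: measurable_fun_pair.
Qed.

Lemma in_Lp_kext (p : nat) T K : (0 < p)%N -> in_Lp_triangle p T K ->
  (\int[leb]_s \int[leb]_u (`|kext T K u s| ^+ p)%:E < +oo)%E.
Proof.
move=> p0 [mK]; apply: le_lt_trans; rewrite le_eqVlt; apply/orP; left; apply/eqP; symmetry.
rewrite integral_mkcond; apply: eq_integral => s _; rewrite patchE mem_setE in_itv/=.
case: (boolP (0 <= s <= T)) => [/andP[s0 sT]|sT].
  rewrite integral_mkcond; apply: eq_integral => u _; rewrite patchE mem_setE in_itv/=.
  case: (boolP (0 <= u <= s)) => [/andP[u0 us]|us]; first by rewrite kext_in.
  by rewrite kext_out ?normr0 ?expr0n ?gtn_eqF//; rewrite andbA (negbTE us).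
symmetry; apply: integral0_eq => u _; rewrite kext_out ?normr0 ?expr0n ?gtn_eqF//.
apply: contra sT => /and3P[u0 us ->]; by rewrite (le_trans u0).
Qed.

End kernels.

Lemma measurable_fun_pair_on (d d1 d2 : measure_display) (X : measurableType d)
    (T1 : measurableType d1) (T2 : measurableType d2) (D : set X)
    (f : X -> T1) (g : X -> T2) : measurable D -> measurable_fun D f ->
  measurable_fun D g -> measurable_fun D (fun x => (f x, g x)).
Proof.
move=> mD mf mg.
have mf' := (measurable_restrictT f mD).1 mf.
have mg' := (measurable_restrictT g mD).1 mg.
apply: eq_measurable_fun (measurable_funTS (measurable_fun_pair mf' mg')).
by move=> x xD; rewrite !patchE xD.
Qed.

Section moments.
Context {R : realType} {d : measure_display} {Omega : measurableType d}.
Local Notation leb := (@lebesgue_measure R).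
Local Notation TR := (measurableTypeR R).
Variables (P : probability Omega R) (T : R) (F : R -> set_system Omega).
Hypothesis usual : usual_conditions P F T.

Lemma progressive_comp (g : R -> R -> R) (X : R -> Omega -> R) :
  measurable_fun (`[0, T] `*` setT) (fun p : R * R => g p.1 p.2) ->
  progressive F T X -> progressive F T (fun s w => g s (X s w)).
Proof.
move=> mg pX u /andP[u0 uT].
have mI (a : R) : measurable (`[0, a] : set R) by exact: measurable_itv.
apply: (@measurable_comp _ _ _ _ _ _ (`[0, T] `*` setT) (fun p : R * R => g p.1 p.2) _
  (fun p : R * g_sigma_algebraType (F u) => (p.1, X p.1 p.2))) => //.
- exact: measurableX.
- by move=> _ [[s w] /= [+ _] <-]; rewrite /= !in_itv/= => /andP[-> /le_trans ->].
- apply: measurable_fun_pair_on; first exact: measurableX.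
    by apply: measurable_funTS; exact: measurable_fst.
  by apply: pX; rewrite u0.
Qed.

Variables (phi : R -> Omega -> R) (c : R).
Hypothesis pphi : progressive F T phi.

Let mphi t : 0 <= t <= T ->
  measurable_fun (`[0, t] `*` setT) (fun p : R * Omega => phi p.1 p.2).
Proof. by move=> t0T; exact: (progressive_ambient usual t0T pphi). Qed.

Lemma progressive_kernelM (a : TR -> R) : measurable_fun setT a ->
  progressive F T (fun s w => a s * phi s w).
Proof.
move=> ma; apply: progressiveM => //; apply: progressive_deterministic.
exact: measurable_funTS.
Qed.

(** The place where the uniform second moment of [phi] enters: by Tonelli, integrals of a
    deterministic function times [phi] are governed by the L2 norm of that function. *)
Lemma expectation_sqint_le (a : TR -> R) t : 0 <= t <= T -> measurable_fun setT a ->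
  (forall s, 0 <= s <= T -> (\int[P]_w ((phi s w) ^+ 2)%:E <= c%:E)%E) ->
  (\int[P]_w sqint (fun s w => a s * phi s w)%R t w <=
   c%:E * \int[leb]_(s in `[0%R, t]) ((a s) ^+ 2)%:E)%E.
Proof.
move=> t0T ma hc; have /andP[t0 tT] := t0T.
have c0 : (0 <= c%:E)%E.
  by apply: le_trans (hc t t0T); apply: integral_ge0 => w _; rewrite lee_fin sqr_ge0.
have mI : measurable (`[0, t] : set TR) by exact: measurable_itv.
have mf : measurable_fun (`[0, t] `*` setT) (fun p : TR * Omega => ((a p.1 * phi p.1 p.2) ^+ 2)%:E).
  apply/measurable_EFinP; apply: measurable_funX; apply: measurable_funM; last exact: mphi.
  by apply: measurable_funTS; apply: (measurableT_comp ma); exact: measurable_fst.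
have := @tonelli_strip _ _ TR Omega R leb P `[0, t]
  (fun s w => ((a s * phi s w) ^+ 2)%:E) mI mf.
rewrite /sqint => ->; last by move=> s w _; rewrite lee_fin sqr_ge0.
have ma2 : measurable_fun `[0, t] (fun s : TR => ((a s) ^+ 2)%:E).
  by apply/measurable_EFinP; apply: measurable_funX; exact: measurable_funTS.
rewrite -ge0_integralZl//; last by move=> s _; rewrite lee_fin sqr_ge0.
apply: ge0_le_integral => //.
- by move=> s _; apply: integral_ge0 => w _; rewrite lee_fin sqr_ge0.
- by apply: (@measurable_strip_integral _ _ TR Omega R P _ _ mI mf) => s w _; rewrite lee_fin sqr_ge0.
- exact: measurable_funeM.
move=> s; rewrite /= in_itv/= => /andP[s0 st].
have s0T : 0 <= s <= T by rewrite s0 (le_trans st).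
have mps : measurable_fun setT (fun w => ((phi s w) ^+ 2)%:E).
  apply/measurable_EFinP; apply: measurable_funX; apply: (measurable_wrt_ambient usual s0T).
  exact: (progressive_at s0T pphi).
rewrite (eq_integral (fun w => ((a s) ^+ 2)%:E * ((phi s w) ^+ 2)%:E)%E); last first.
  by move=> w _; rewrite -EFinM exprMn.
rewrite ge0_integralZl// ?lee_fin ?sqr_ge0//; last by move=> w _; rewrite lee_fin sqr_ge0.
by rewrite muleC lee_wpmul2r ?lee_fin ?sqr_ge0//; exact: hc.
Qed.

End moments.

Section kernel_averages.
Context {R : realType}.
Local Notation leb := (@lebesgue_measure R).
Local Notation TR := (measurableTypeR R).
Variables (T : R) (k : TR -> TR -> R).
Hypothesis T_gt0 : 0 < T.
Hypothesis mk : measurable_fun setT (fun p : TR * TR => k p.1 p.2).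
Hypothesis k_out : forall u s, ~~ [&& 0 <= u, u <= s & s <= T] -> k u s = 0.
Hypothesis k_L2 : (\int[leb]_s \int[leb]_u ((k u s) ^+ 2)%:E < +oo)%E.

Definition mesh (n : nat) : R := T / n.+1%:R.
Definition kernel_cell_avg n j (u : TR) : R := cell_avg (mesh n) (k u) j.
Definition kernel_avg n (u s : TR) : R := avg_fun (mesh n) n.+1 (k u) s.
Definition kernel_err n (s : TR) : \bar R :=
  (\int[leb]_u ((kernel_avg n u s - k u s) ^+ 2)%:E)%E.

Lemma mesh_gt0 n : 0 < mesh n.
Proof. by rewrite divr_gt0. Qed.

Lemma mesh_end n : n.+1%:R * mesh n = T.
Proof. by rewrite mulrC divfK// pnatr_eq0. Qed.

Let mk1 u : measurable_fun setT (k u).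
Proof. exact: (measurable_fun_pair2 u mk). Qed.

Lemma k_L2_swap : (\int[leb]_u \int[leb]_s ((k u s) ^+ 2)%:E < +oo)%E.
Proof.
have mk2 : measurable_fun setT (fun p : TR * TR => ((k p.1 p.2) ^+ 2)%:E).
  by apply/measurable_EFinP; exact: measurable_funX.
have := @fubini_tonelli _ _ TR TR R leb leb (fun p => ((k p.1 p.2) ^+ 2)%:E) mk2.
by move=> /= ->// => p; rewrite lee_fin sqr_ge0.
Qed.

Lemma measurable_kernel_cell_avg n j : measurable_fun setT (kernel_cell_avg n j).
Proof.
apply: measurable_funM; first exact: measurable_cst.
apply: measurableT_comp => //.
apply: (@measurable_integral_section _ TR R (cell (mesh n) j) (fun r u => (k u r)%:E)).
  exact: measurable_itv.
apply: measurable_funTS; apply/measurable_EFinP.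
exact: (measurableT_comp mk (@measurable_swap _ _ TR TR)).
Qed.

Lemma measurable_kernel_avg n : measurable_fun setT (fun p : TR * TR => kernel_avg n p.1 p.2).
Proof.
apply: measurable_sum => j; apply: measurable_funM.
  exact: (measurableT_comp (measurable_kernel_cell_avg n j) (@measurable_fst _ _ TR TR)).
apply: (measurableT_comp (f := \1_(`]j%:R * mesh n, j.+1%:R * mesh n]%classic) : TR -> R)).
  by apply: measurable_indic; exact: measurable_itv.
exact: measurable_snd.
Qed.

(** Since averages look back, the average for cell [j] charges only [u <= j h]. Its Ito integral is
    complete at time [j h], when the cell on which it is used begins. *)
Lemma kernel_cell_avg_out n j u : ~~ (0 <= u <= j%:R * mesh n) -> kernel_cell_avg n j u = 0.
Proof.
move=> hu; rewrite /kernel_cell_avg /cell_avg /Rintegral integral0_eq ?mulr0// => r.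
rewrite /cell/= in_itv/= => /andP[_ rj]; rewrite k_out//.
by apply: contra hu => /and3P[-> /le_trans + _]; apply.
Qed.

Let k2_ge0 u s : (0 <= ((k u s) ^+ 2)%:E)%E.
Proof. by rewrite lee_fin sqr_ge0. Qed.

Lemma kernel_cell_avg_L2 n j : (\int[leb]_u ((kernel_cell_avg n j u) ^+ 2)%:E < +oo)%E.
Proof.
have h0 := mesh_gt0 n.
have mI : measurable_fun setT (fun u : TR => \int[leb]_s ((k u s) ^+ 2)%:E)%E.
  apply: (@measurable_strip_integral _ _ TR TR R leb setT (fun u s => ((k u s) ^+ 2)%:E)) => //.
  rewrite setXTT; by apply/measurable_EFinP; exact: measurable_funX.
apply: (@le_lt_trans _ _ (\int[leb]_u ((mesh n)^-1%:E * \int[leb]_s ((k u s) ^+ 2)%:E))%E).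
  apply: ge0_le_integral => //.
  - by move=> u _; rewrite lee_fin sqr_ge0.
  - by apply/measurable_EFinP; apply: measurable_funX; exact: measurable_kernel_cell_avg.
  - exact: measurable_funeM.
  move=> u _; rewrite -lee_pdivrMl ?invr_gt0// invrK muleC -EFinM.
  apply: (le_trans (cell_avg_jensen j h0 (@mk1 u))).
  apply: ge0_subset_integral => //; first exact: measurable_itv.
  by apply/measurable_EFinP; exact: measurable_funX.
rewrite ge0_integralZl//; last 2 first.
- by move=> u _; exact: integral_ge0.
- by rewrite lee_fin invr_ge0 ltW.
by apply: lte_mul_pinfty; [rewrite lee_fin invr_ge0 ltW| |exact: k_L2_swap].
Qed.

Let msq n : measurable_fun setT (fun p : TR * TR => ((kernel_avg n p.1 p.2 - k p.1 p.2) ^+ 2)%:E).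
Proof.
apply/measurable_EFinP; apply: measurable_funX; apply: measurable_funB => //.
exact: measurable_kernel_avg.
Qed.

Let msq_swap n : measurable_fun setT (fun p : TR * TR => ((kernel_avg n p.2 p.1 - k p.2 p.1) ^+ 2)%:E).
Proof. exact: (measurableT_comp (msq n) (@measurable_swap _ _ TR TR)). Qed.

Lemma kernel_err_ge0 n s : (0 <= kernel_err n s)%E.
Proof. by apply: integral_ge0 => u _; rewrite lee_fin sqr_ge0. Qed.

Lemma measurable_kernel_err n : measurable_fun setT (kernel_err n).
Proof.
apply: (@measurable_strip_integral _ _ TR TR R leb setT
  (fun s u => ((kernel_avg n u s - k u s) ^+ 2)%:E)) => //.
- by rewrite setXTT; exact: msq_swap.
- by move=> s u _; rewrite lee_fin sqr_ge0.
Qed.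

Lemma kernel_err_swap n : (\int[leb]_(s in `[0%R, T]) kernel_err n s =
  \int[leb]_u \int[leb]_(s in `[0%R, T]) ((kernel_avg n u s - k u s) ^+ 2)%:E)%E.
Proof.
symmetry; apply: (@tonelli_strip _ _ TR TR R leb leb `[0%R, T]
  (fun s u => ((kernel_avg n u s - k u s) ^+ 2)%:E)).
- exact: measurable_itv.
- by apply: measurable_funTS; exact: msq_swap.
- by move=> s u _; rewrite lee_fin sqr_ge0.
Qed.

Lemma kernel_err_u_le n u : (\int[leb]_(s in `[0%R, T]) ((kernel_avg n u s - k u s) ^+ 2)%:E <=
  4%:E * \int[leb]_s ((k u s) ^+ 2)%:E)%E.
Proof.
have mD : measurable (`[0, T] : set TR) by exact: measurable_itv.
have mA : measurable_fun setT (kernel_avg n u).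
  exact: (measurable_fun_pair2 u (measurable_kernel_avg n)).
apply: (@le_trans _ _ (2%:E * (\int[leb]_(s in `[0%R, T]) ((kernel_avg n u s) ^+ 2)%:E +
    \int[leb]_(s in `[0%R, T]) ((k u s) ^+ 2)%:E))%E).
  apply: L2_le2 => //.
  - by apply: measurable_funTS; exact: measurable_funB.
  - exact: measurable_funTS.
  - exact: measurable_funTS.
  - by move=> s _; apply: (le_trans (sqrD_le2 _ _)); rewrite sqrrN.
rewrite (_ : 4 = 2 * 2); last by rewrite -natrM.
rewrite EFinM -muleA lee_wpmul2l// (mule_natl _ 2) mule2n; apply: leeD.
  have := avg_fun_sqr_le n.+1 (mesh_gt0 n) (@mk1 u).
  by rewrite mesh_end.
apply: ge0_subset_integral => //.
by apply/measurable_EFinP; exact: measurable_funX.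
Qed.

(** In the swapped order, [k u] is square integrable for almost every [u], so its averages converge
    in L2. Dominated convergence in [u] applies because averaging is a contraction. *)
Lemma kernel_err_cvg : (fun n => \int[leb]_(s in `[0%R, T]) kernel_err n s)%E @ \oo --> 0%E.
Proof.
apply: (cvg0_ext (fun n => esym (kernel_err_swap n))).
have mI : measurable_fun setT (fun u : TR => \int[leb]_s ((k u s) ^+ 2)%:E)%E.
  apply: (@measurable_strip_integral _ _ TR TR R leb setT (fun u s => ((k u s) ^+ 2)%:E)) => //.
  by rewrite setXTT; apply/measurable_EFinP; exact: measurable_funX.
have iI : leb.-integrable setT (fun u : TR => \int[leb]_s ((k u s) ^+ 2)%:E)%E.
  apply/integrableP; split => //.
  rewrite (eq_integral (fun u : TR => \int[leb]_s ((k u s) ^+ 2)%:E)%E) ?k_L2_swap//.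
  by move=> u _; rewrite gee0_abs// integral_ge0.
rewrite -[X in _ --> X](integral0 leb setT).
have [] := @dominated_convergence _ TR R leb setT measurableT
  (fun n u => \int[leb]_(s in `[0%R, T]) ((kernel_avg n u s - k u s) ^+ 2)%:E)%E (cst 0%E)
  (fun u => 4%:E * \int[leb]_s ((k u s) ^+ 2)%:E)%E => //.
- move=> n; apply: (@measurable_integral_section _ TR R `[0, T]
    (fun s u => ((kernel_avg n u s - k u s) ^+ 2)%:E)); first exact: measurable_itv.
  by apply: measurable_funTS; exact: msq_swap.
- apply: ae_mono (integrable_ae measurableT iI) => u /(_ Logic.I).
  rewrite ge0_fin_numE ?integral_ge0// => hu _.
  apply: cvg_avg_fun_L2 => // r rT; apply: k_out.
  by apply: contra rT => /and3P[u0 ur ->]; rewrite (le_trans u0).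
- exact: integrableZl.
- apply: aeW => u n _; rewrite gee0_abs; first exact: kernel_err_u_le.
  by apply: integral_ge0 => s _; rewrite lee_fin sqr_ge0.
Qed.

(** Along a subsequence the errors are summable over time in the mean, hence summable at almost
    every fixed [s]; this yields almost sure convergence of the inner integrals at such [s]. *)
Lemma kernel_avg_subsequence : exists ni : nat -> nat,
  (forall i, (\int[leb]_(s in `[0%R, T]) kernel_err (ni i) s <= ((2 ^ i.+1)%:R^-1)%:E)%E) /\
  {ae leb, forall s, `[0, T]%classic s ->
    (\sum_(0 <= i <oo) kernel_err (ni i) s < +oo)%E}.
Proof.
have /cvge0_leP h := kernel_err_cvg.
have h0 n : (0 <= \int[leb]_(s in `[0%R, T]) kernel_err n s)%E.
  by apply: integral_ge0 => s _; exact: kernel_err_ge0.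
have /choice[ni hni] i : exists n,
    (\int[leb]_(s in `[0%R, T]) kernel_err n s <= ((2 ^ i.+1)%:R^-1)%:E)%E.
  have p0 : (0 < (2 ^ i.+1)%:R^-1 :> R)%R by rewrite invr_gt0 ltr0n expn_gt0.
  by have [N hN] := h h0 _ p0; exists N; exact: hN.
exists ni; split => //.
apply: (@ae_summable _ TR R leb `[0, T]%classic (fun i => kernel_err (ni i))).
- exact: measurable_itv.
- by move=> i; apply: measurable_funTS; exact: measurable_kernel_err.
- by move=> i s _; exact: kernel_err_ge0.
- apply: (@summable_geometric R
    (fun i => \int[leb]_(s in `[0%R, T]) kernel_err (ni i) s)%E 1 ler01) => i; first exact: h0.
  by rewrite div1r; exact: hni.
Qed.

Lemma ae_kernel_section : {ae leb, forall s, (\int[leb]_u ((k u s) ^+ 2)%:E < +oo)%E}.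
Proof.
have mI : measurable_fun setT (fun s : TR => \int[leb]_u ((k u s) ^+ 2)%:E)%E.
  apply: (@measurable_strip_integral _ _ TR TR R leb setT (fun s u => ((k u s) ^+ 2)%:E)) => //.
  rewrite setXTT; apply/measurable_EFinP; apply: measurable_funX.
  exact: (measurableT_comp mk (@measurable_swap _ _ TR TR)).
by apply: ae_lty_integral => // s; exact: integral_ge0.
Qed.

End kernel_averages.

Section stochastic_kernel.
Context {R : realType} {d : measure_display} {Omega : measurableType d}.
Local Notation leb := (@lebesgue_measure R).
Local Notation TR := (measurableTypeR R).
Variables (P : probability Omega R) (T : R) (F : R -> set_system Omega).
Variable B : R -> Omega -> R.
Hypothesis T_gt0 : 0 < T.
Hypothesis usual : usual_conditions P F T.
Hypothesis bm : brownian_motion P F T B.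
Variables (phi : R -> Omega -> R) (c : R).
Hypothesis pphi : progressive F T phi.
Hypothesis phi2 : forall s, 0 <= s <= T -> (\int[P]_w ((phi s w) ^+ 2)%:E <= c%:E)%E.
Local Notation ito := (is_ito_integral P F B).

Let T0T : 0 <= T <= T.
Proof. by rewrite ltW//=. Qed.

Lemma second_moment_ge0 : 0 <= c.
Proof.
rewrite -lee_fin; apply: le_trans (phi2 T0T).
by apply: integral_ge0 => w _; rewrite lee_fin sqr_ge0.
Qed.

Lemma ae_sqint_lty (H : R -> Omega -> R) t : 0 <= t <= T -> progressive F t H ->
  (\int[P]_w sqint H t w < +oo)%E -> {ae P, forall w, (sqint H t w < +oo)%E}.
Proof.
move=> t0T pH h; have mH := measurable_sqint usual t0T pH.
by apply: ae_lty_integral => // w; exact: sqint_ge0.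
Qed.

Lemma ito_kernel_exists (a : TR -> R) : measurable_fun setT a ->
  (\int[leb]_(s in `[0%R, T]) ((a s) ^+ 2)%:E < +oo)%E ->
  exists M, ito_integral_process P F T B (fun s w => a s * phi s w) M.
Proof.
move=> ma a2; have pa := progressive_kernelM pphi ma.
apply: (ito_process_exists T_gt0 usual bm pa).
apply: ae_sqint_lty => //; apply: le_lt_trans (expectation_sqint_le usual pphi T0T ma phi2) _.
have a0 : (0 <= \int[leb]_(s in `[0%R, T]) ((a s) ^+ 2)%:E)%E.
  by apply: integral_ge0 => s _; rewrite lee_fin sqr_ge0.
have c0 := second_moment_ge0.
by rewrite lte_mul_pinfty// ge0_fin_numE.
Qed.

Lemma ito_kernel_sqr_le (a : TR -> R) t I : 0 <= t <= T -> measurable_fun setT a ->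
  ito (fun s w => a s * phi s w) t I ->
  (\int[P]_w ((I w) ^+ 2)%:E <= c%:E * \int[leb]_(s in `[0%R, t]) ((a s) ^+ 2)%:E)%E.
Proof.
move=> t0T ma iI; apply: le_trans (ito_sqr_le usual bm t0T iI) _.
exact: (expectation_sqint_le usual pphi t0T ma phi2).
Qed.

Lemma ito_sum n (H : nat -> R -> Omega -> R) (I : nat -> Omega -> R) t : 0 <= t <= T ->
  (forall j, (j < n)%N -> ito (H j) t (I j)) ->
  ito (fun s w => \sum_(j < n) H j s w) t (fun w => \sum_(j < n) I j w).
Proof.
move=> t0T; elim: n => [_|n IH h].
  have := ito_zero usual bm t0T.
  by congr (is_ito_integral _ _ _ _ _ _); apply/funext => s; [apply/funext => w|];
    rewrite big_ord0.
have := ito_add usual bm 1 t0T (IH (fun j jn => h j (ltnW jn))) (h n (ltnSn n)).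
by congr (is_ito_integral _ _ _ _ _ _); apply/funext => s; [apply/funext => w|];
  rewrite big_ord_recr/= mul1r.
Qed.

Lemma integrable_step_fun (t : R) (g : nat -> R) n (a : nat -> R) :
  leb.-integrable `[0, t] (fun s => (step_fun g n a s)%:E).
Proof.
have mI : measurable (`[0, t] : set TR) by exact: measurable_itv.
have lI : (leb `[0%R, t] < +oo)%E.
  by rewrite lebesgue_measure_itv/=; case: ifP => _; rewrite ltry.
pose K := \sum_(j < n) `|a j|.
apply: (@le_integrable _ _ _ leb _ mI _ (fun=> K%:E)).
- by apply/measurable_EFinP; apply: measurable_funTS; exact: measurable_step_fun.
- move=> s _; rewrite !abse_EFin lee_fin; apply: le_trans (ler_norm _).
  apply: le_trans (ler_norm_sum _ _ _) _; apply: ler_sum => j _.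
  by rewrite normrM ler_piMr// indicE; case: (_ \in _); rewrite ?normr1 ?normr0.
apply/integrableP; split; first exact: measurable_cst.
by rewrite integral_cst// lte_mul_pinfty.
Qed.

Lemma Rintegral_step_fun (t : R) (g : nat -> R) n (a : nat -> R) :
  \int[leb]_(s in `[0, t]) step_fun g n a s =
  \sum_(j < n) a j * \int[leb]_(s in `[0, t]) \1_(`]g j, g j.+1]%classic) s.
Proof.
have mI : measurable (`[0, t] : set TR) by exact: measurable_itv.
elim: n => [|n IH].
  rewrite big_ord0 /Rintegral integral0_eq// => s _; by rewrite /step_fun big_ord0.
have i1 : leb.-integrable `[0, t] (EFin \o (\1_(`]g n, g n.+1]%classic) : TR -> R)).
  have := integrable_step_fun t (fun i => g (n + i)%N) 1 (fun=> 1).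
  apply: eq_integrable => // s _.
  by rewrite /step_fun big_ord_recl big_ord0 addr0 mul1r /= addn0 addn1.
rewrite big_ord_recr/= -IH -RintegralZl// -RintegralD//; last 2 first.
- exact: integrable_step_fun.
- have := integrableZl mI (a n) i1; apply: eq_integrable => // s _.
by apply: eq_Rintegral => s _; rewrite /step_fun big_ord_recr.
Qed.

Variable k : TR -> TR -> R.
Hypothesis mk : measurable_fun setT (fun p : TR * TR => k p.1 p.2).
Hypothesis k_out : forall u s, ~~ [&& 0 <= u, u <= s & s <= T] -> k u s = 0.
Hypothesis k_L2 : (\int[leb]_s \int[leb]_u ((k u s) ^+ 2)%:E < +oo)%E.

Local Notation h := (mesh T).
Local Notation g n := (fun j : nat => j%:R * h n).

Lemma step_grid_le n j : (j <= n.+1)%N -> 0 <= g n j <= T.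
Proof.
move=> jn; have h0 := mesh_gt0 T_gt0 n.
apply/andP; split; first by rewrite mulr_ge0// ltW.
by rewrite -[leRHS](mesh_end T n) ler_wpM2r ?(ltW h0)// ler_nat.
Qed.

Lemma cell_processes_exist : exists N : nat -> nat -> R -> Omega -> R, forall n j,
  ito_integral_process P F T B (fun s w => kernel_cell_avg T k n j s * phi s w) (N n j).
Proof.
suff hN n : exists N : nat -> R -> Omega -> R, forall j,
    ito_integral_process P F T B (fun s w => kernel_cell_avg T k n j s * phi s w) (N j).
  by have /choice[N ?] := hN; exists N.
have /choice[N ?] j : exists M, ito_integral_process P F T B
    (fun s w => kernel_cell_avg T k n j s * phi s w) M; last by exists N.
have ma := measurable_kernel_cell_avg T mk n j.
apply: ito_kernel_exists => //.
apply: le_lt_trans (kernel_cell_avg_L2 T_gt0 mk k_L2 n j).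
apply: ge0_subset_integral => //.
- by apply/measurable_EFinP; exact: measurable_funX.
- by move=> u _; rewrite lee_fin sqr_ge0.
Qed.

Section cell_processes.
Variable N : nat -> nat -> R -> Omega -> R.
Hypothesis NH : forall n j,
  ito_integral_process P F T B (fun s w => kernel_cell_avg T k n j s * phi s w) (N n j).

(** On cell [j] the averaged kernel does not depend on [s], and its integral is already complete at
    the left end of the cell. One value of [N n j] thus serves for the entire cell, which makes the
    process progressive. *)
Definition inner_step n (s : R) (w : Omega) : R :=
  step_fun (g n) n.+1 (fun j => N n j (g n j) w) s.

Lemma progressive_inner_step n : progressive F T (inner_step n).
Proof.
apply: (@progressive_sum R d Omega F n.+1 (fun j s w => N n j (g n j) w *
  \1_(`]g n j, g n j.+1]%classic) s)) => j jn.
have [g0 gT] := andP (step_grid_le (ltnW jn)).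
have mN : measurable_wrt (F (g n j)) (N n j (g n j)).
  by apply: (ito_wrt ((NH n j).2 _ _)); rewrite g0.
have -> : (fun (s : R) (w : Omega) => N n j (g n j) w * \1_(`]g n j, g n j.+1]%classic) s) =
    (fun (s : R) (w : Omega) => (N n j (g n j) w * \1_(`]g n j, +oo[%classic) s) *
   \1_(`]-oo, g n j.+1]%classic) s).
  apply/funext => s; apply/funext => w; rewrite -mulrA; congr (_ * _).
  by rewrite !indicE !mem_setE !in_itv/= andbT -natrM mulnb.
apply: progressiveM; first exact: (progressive_start usual).
by apply: progressive_indic; exact: measurable_itv.
Qed.

Lemma cell_ito n j t : g n j <= t -> t <= T -> (j <= n)%N ->
  ito (fun u w => kernel_cell_avg T k n j u * phi u w) t (N n j (g n j)).
Proof.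
move=> gt tT jn; have [g0 gT] := andP (step_grid_le (leqW jn)).
have t0T : 0 <= t <= T by rewrite tT (le_trans g0).
have g0T : 0 <= g n j <= T by rewrite g0.
apply: (ito_eq t0T (ito_extend usual g0 gt tT ((NH n j).2 _ g0T))) => u w /andP[u0 ut].
rewrite indicE mem_setE in_itv/= u0/=; case: (leP u (g n j)) => ug; first by rewrite mulr1.
by rewrite kernel_cell_avg_out ?mul0r// negb_and -!ltNge ug orbT.
Qed.

Lemma inner_step_ito n s : 0 < s -> s <= T ->
  ito (fun u w => kernel_avg T k n u s * phi u w) s (inner_step n s).
Proof.
move=> s0 sT; have h0 := mesh_gt0 T_gt0 n.
have exj : exists j : nat, s <= g n j by exists n.+1; rewrite mesh_end.
have [[|j] sj jmin] := ex_minnP exj; first by move: sj; rewrite mul0r leNgt s0.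
have js : g n j < s by rewrite ltNge; apply/negP => /jmin; rewrite ltnn.
have jn : (j < n.+1)%N by apply: jmin; rewrite mesh_end.
have sc : g n j < s <= g n j.+1 by rewrite js.
have nd := step_grid_nd (h := h n).
have gnd i : (i < n.+1)%N -> g n i <= g n i.+1 by rewrite ler_wpM2r ?ler_nat// ltW.
have -> : inner_step n s = N n j (g n j).
  by apply/funext => w; rewrite /inner_step (step_fun_at gnd _ jn sc).
have s0T : 0 <= s <= T by rewrite ltW.
apply: (ito_eq s0T (cell_ito (ltW js) sT jn)) => u w _.
by rewrite /kernel_avg /avg_fun (step_fun_at gnd _ jn sc).
Qed.

Lemma integral_inner_step_ito n t : 0 <= t <= T ->
  ito (fun u w => (\int[leb]_(s in `[0, t]) kernel_avg T k n u s) * phi u w) t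
    (fun w => \int[leb]_(s in `[0, t]) inner_step n s w).
Proof.
move=> t0T; have /andP[t0 tT] := t0T.
pose l j : R := \int[leb]_(s in `[0, t]) \1_(`]g n j, g n j.+1]%classic) s.
have := @ito_sum n.+1 (fun j u w => l j * (kernel_cell_avg T k n j u * phi u w))
  (fun j w => l j * N n j (g n j) w) t t0T.
have step j : (j < n.+1)%N -> ito (fun u w => l j * (kernel_cell_avg T k n j u * phi u w)) t
    (fun w => l j * N n j (g n j) w).
  move=> jn; have [gt|tg] := leP (g n j) t.
    exact: (ito_scale usual bm _ t0T (cell_ito gt tT jn)).
  (* [l j] is the length of the part of cell [j] inside [[0, t]]. A cell starting after [t] would
     bring in a variable of the future, but its weight is 0. *)
  have -> : l j = 0.
    rewrite /l /Rintegral integral0_eq// => s /=; rewrite in_itv/= => /andP[s0 st].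
    by rewrite indicE memNset//= in_itv/= ltNge (le_trans st (ltW tg)).
  have := ito_zero usual bm t0T.
  by congr (is_ito_integral _ _ _ _ _ _); apply/funext => s; [apply/funext => w|];
    rewrite mul0r.
move=> /(_ step); congr (is_ito_integral _ _ _ _ _ _).
  apply/funext => u; apply/funext => w.
  rewrite /kernel_avg /avg_fun Rintegral_step_fun mulr_suml.
  by apply: eq_bigr => j _; rewrite /l /kernel_cell_avg; ring.
apply/funext => w; rewrite /inner_step Rintegral_step_fun.
by apply: eq_bigr => j _; rewrite mulrC.
Qed.

End cell_processes.

End stochastic_kernel.

Section inner_integral.
Context {R : realType} {d : measure_display} {Omega : measurableType d}.
Local Notation leb := (@lebesgue_measure R).
Local Notation TR := (measurableTypeR R).
Variables (P : probability Omega R) (T : R) (F : R -> set_system Omega).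
Variable B : R -> Omega -> R.
Hypothesis T_gt0 : 0 < T.
Hypothesis usual : usual_conditions P F T.
Hypothesis bm : brownian_motion P F T B.
Variables (phi : R -> Omega -> R) (c : R).
Hypothesis pphi : progressive F T phi.
Hypothesis phi2 : forall s, 0 <= s <= T -> (\int[P]_w ((phi s w) ^+ 2)%:E <= c%:E)%E.
Local Notation ito := (is_ito_integral P F B).
Variable k : TR -> TR -> R.
Hypothesis mk : measurable_fun setT (fun p : TR * TR => k p.1 p.2).
Hypothesis k_out : forall u s, ~~ [&& 0 <= u, u <= s & s <= T] -> k u s = 0.
Hypothesis k_L2 : (\int[leb]_s \int[leb]_u ((k u s) ^+ 2)%:E < +oo)%E.

Let T0T : 0 <= T <= T.
Proof. by rewrite ltW//=. Qed.

Let c0 : 0 <= c.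
Proof. exact: (second_moment_ge0 T_gt0 phi2). Qed.

Let mk2 s : measurable_fun setT (k ^~ s).
Proof. exact: (measurable_fun_pair1 s mk). Qed.

Let mavg n s : measurable_fun setT ((kernel_avg T k n) ^~ s).
Proof. exact: (measurable_fun_pair1 s (measurable_kernel_avg T mk n)). Qed.

Let sub_sqr (a : TR -> R) (t : R) : measurable_fun setT a ->
  (\int[leb]_(u in `[0%R, t]) ((a u) ^+ 2)%:E <= \int[leb]_u ((a u) ^+ 2)%:E)%E.
Proof.
move=> ma; apply: ge0_subset_integral => //.
- by apply/measurable_EFinP; exact: measurable_funX.
- by move=> u _; rewrite lee_fin sqr_ge0.
Qed.

Variable N : nat -> nat -> R -> Omega -> R.
Hypothesis NH : forall n j,
  ito_integral_process P F T B (fun s w => kernel_cell_avg T k n j s * phi s w) (N n j).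
Local Notation step := (inner_step T N).

Variable ni : nat -> nat.
(* Equal to the limit wherever the sequence converges in R, and progressive
   without discarding null sets. *)
Definition inner_limit (s : R) (w : Omega) : R :=
  fine (limn_esup (fun i => (step (ni i) s w)%:E)).

Lemma progressive_inner_limit : progressive F T inner_limit.
Proof.
move=> u uT; apply: measurableT_comp => //.
apply: measurable_fun_limn_esup => i; apply/measurable_EFinP.
exact: (progressive_inner_step T_gt0 usual NH).
Qed.

(** At a fixed [s] the integral [I] exists, and the step processes approach it in L2 with summable
    errors, hence almost surely; so the upper limit is a version of [I]. *)
Lemma inner_limit_ito s : 0 < s <= T -> (\int[leb]_u ((k u s) ^+ 2)%:E < +oo)%E ->
  (\sum_(0 <= i <oo) kernel_err T k (ni i) s < +oo)%E ->
  [/\ ito (fun u w => k u s * phi u w) s (inner_limit s),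
      (\int[P]_w ((inner_limit s w) ^+ 2)%:E <= c%:E * \int[leb]_u ((k u s) ^+ 2)%:E)%E &
      forall i, (\int[P]_w ((step (ni i) s w - inner_limit s w) ^+ 2)%:E <=
        c%:E * kernel_err T k (ni i) s)%E].
Proof.
move=> /andP[s0 sT] ks2 es; have s0T : 0 <= s <= T by rewrite ltW.
have [||M [_ iM]] := @ito_kernel_exists R d Omega P T F B T_gt0 usual bm phi c pphi phi2 (k ^~ s).
- exact: mk2.
- by apply: le_lt_trans ks2; exact: sub_sqr.
have {iM}iI := iM s s0T; set I := M s in iI.
have iD i := ito_add usual bm (-1) s0T (inner_step_ito T_gt0 usual k_out NH (ni i) s0 sT) iI.
have mI : measurable_fun setT I by exact: (ito_measurable usual s0T iI).
have mS i : measurable_fun setT (step (ni i) s).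
  apply: (measurable_wrt_ambient usual s0T); apply: progressive_at s0T _.
  exact: (progressive_inner_step T_gt0 usual NH).
have mD i : measurable_fun setT (fun w => ((step (ni i) s w - I w) ^+ 2)%:E).
  by apply/measurable_EFinP; apply: measurable_funX; exact: measurable_funB.
have bD i : (\int[P]_w ((step (ni i) s w - I w) ^+ 2)%:E <= c%:E * kernel_err T k (ni i) s)%E.
  have ma : measurable_fun setT (fun u : TR => kernel_avg T k (ni i) u s - k u s).
    by apply: measurable_funB; [exact: mavg|exact: mk2].
  have := @ito_kernel_sqr_le R d Omega P T F B usual bm phi c pphi phi2
    (fun u => kernel_avg T k (ni i) u s - k u s) s (fun w => step (ni i) s w - I w) s0T ma.
  have iD' : ito (fun u w => (kernel_avg T k (ni i) u s - k u s) * phi u w) s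
      (fun w => step (ni i) s w - I w).
    have := iD i; congr (is_ito_integral _ _ _ _ _ _).
      by apply/funext => u; apply/funext => w; ring.
    by apply/funext => w; rewrite mulN1r.
  move=> /(_ iD') /le_trans; apply; rewrite lee_wpmul2l ?lee_fin//.
  exact: sub_sqr.
have eJ : {ae P, forall w, I w = inner_limit s w}.
  have sD : (\sum_(0 <= i <oo) \int[P]_(w in setT) ((step (ni i) s w - I w) ^+ 2)%:E < +oo)%E.
    apply: (@le_lt_trans _ _ (\sum_(0 <= i <oo) (c%:E * kernel_err T k (ni i) s))%E).
      by apply: lee_nneseries => // i _ _; apply: integral_ge0 => w _; rewrite lee_fin sqr_ge0.
    rewrite nneseriesZl; last by move=> i _; exact: kernel_err_ge0.
    by rewrite lte_mul_pinfty// ?lee_fin// ge0_fin_numE.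
  have sD0 i w : setT w -> (0 <= ((step (ni i) s w - I w) ^+ 2)%:E)%E.
    by move=> _; rewrite lee_fin sqr_ge0.
  apply: ae_mono (ae_summable measurableT mD sD0 sD) => w /(_ Logic.I) hw.
  have := cvg0_summable (fun i => sD0 i w Logic.I) hw.
  move=> /cvge0_leP cw; rewrite /inner_limit.
  have /cvg_limn_einf_sup[_ ->//] : (step (ni i) s w)%:E @[i --> \oo] --> (I w)%:E.
  apply: cvg_EFin; first exact: nearW.
  apply/cvgrPdist_le => e e0.
  have [K hK] := cw (fun i => sD0 i w Logic.I) _ (exprn_gt0 2 e0).
  exists K => // i /= /hK; rewrite lee_fin distrC -(real_normK (num_real (_ - _))).
  by rewrite ler_pXn2r ?nnegrE// ltW.
have mJ : measurable_fun setT (inner_limit s).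
  apply: (measurable_wrt_ambient usual s0T); apply: progressive_at s0T _.
  exact: progressive_inner_limit.
split.
- exact: (ito_ae usual bm s0T iI).
- have -> : (\int[P]_w ((inner_limit s w) ^+ 2)%:E = \int[P]_w ((I w) ^+ 2)%:E)%E.
    apply: ae_eq_integral => //.
    + by apply/measurable_EFinP; exact: measurable_funX.
    + by apply/measurable_EFinP; exact: measurable_funX.
    + by apply: ae_mono eJ => w ->.
  apply: le_trans (ito_kernel_sqr_le usual bm pphi phi2 s0T (@mk2 s) iI) _.
  by rewrite lee_wpmul2l ?lee_fin//; exact: sub_sqr.
- move=> i; apply: le_trans (bD i); rewrite le_eqVlt; apply/orP; left; apply/eqP.
  apply: ae_eq_integral => //.
  + by apply/measurable_EFinP; apply: measurable_funX; exact: measurable_funB.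
  + by apply: ae_mono eJ => w ->.
Qed.

Hypothesis niE : forall i,
  (\int[leb]_(s in `[0%R, T]) kernel_err T k (ni i) s <= ((2 ^ i.+1)%:R^-1)%:E)%E.
Hypothesis niS : {ae leb, forall s, `[0, T]%classic s ->
    (\sum_(0 <= i <oo) kernel_err T k (ni i) s < +oo)%E}.

Lemma ae_inner_limit : {ae leb, forall s, 0 <= s <= T ->
  [/\ ito (fun u w => k u s * phi u w) s (inner_limit s),
      (\int[P]_w ((inner_limit s w) ^+ 2)%:E <= c%:E * \int[leb]_u ((k u s) ^+ 2)%:E)%E &
      forall i, (\int[P]_w ((step (ni i) s w - inner_limit s w) ^+ 2)%:E <=
        c%:E * kernel_err T k (ni i) s)%E]}.
Proof.
have n0 : {ae leb, forall s : TR, s != 0}.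
  exists [set 0 : TR]; split; [exact: measurable_set1|by rewrite lebesgue_measure_set1|].
  by move=> s /= /negP; rewrite negbK => /eqP ->.
have h := ae_mono2 (C := fun s => _ /\ _) (fun s a b => conj a b)
  (ae_kernel_section mk k_L2) niS.
apply: ae_mono2 n0 h => s sn0 [ks2 hs] /andP[s0 sT].
apply: inner_limit_ito => //; first by rewrite lt_neqAle eq_sym sn0 s0.
by apply: hs; rewrite /= in_itv/= s0.
Qed.

Let mJ t : 0 <= t <= T ->
  measurable_fun (`[0, t] `*` setT) (fun p : R * Omega => inner_limit p.1 p.2).
Proof.
by move=> t0T; apply: (progressive_ambient usual t0T); exact: progressive_inner_limit.
Qed.

Let msqJ : measurable_fun (`[0, T] `*` setT) (fun p : TR * Omega => ((inner_limit p.1 p.2) ^+ 2)%:E).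
Proof. by apply/measurable_EFinP; apply: measurable_funX; exact: mJ. Qed.

(** The second moment bound, valid at almost every [s], is integrated over time. It makes almost
    every path of the inner integral square integrable. *)
Lemma inner_limit_sqr_lty : (\int[P]_w sqint inner_limit T w < +oo)%E.
Proof.
have mI : measurable (`[0, T] : set TR) by exact: measurable_itv.
have J0 (s : TR) (w : Omega) : `[0%R, T]%classic s -> (0 <= ((inner_limit s w) ^+ 2)%:E)%E.
  by rewrite lee_fin sqr_ge0.
rewrite /sqint (@tonelli_strip _ _ TR Omega R leb P `[0, T] (fun s w => ((inner_limit s w) ^+ 2)%:E) mI msqJ J0).
have mk2I : measurable_fun setT (fun s : TR => \int[leb]_u ((k u s) ^+ 2)%:E)%E.
  apply: (@measurable_strip_integral _ _ TR TR R leb setT (fun s u => ((k u s) ^+ 2)%:E)) => //.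
    rewrite setXTT; apply/measurable_EFinP; apply: measurable_funX.
    exact: (measurableT_comp mk (@measurable_swap _ _ TR TR)).
  by move=> s u _; rewrite lee_fin sqr_ge0.
have k0 (s : TR) : (0 <= \int[leb]_u ((k u s) ^+ 2)%:E)%E.
  by apply: integral_ge0 => u _; rewrite lee_fin sqr_ge0.
apply: (@le_lt_trans _ _ (\int[leb]_(s in `[0%R, T]) (c%:E * \int[leb]_u ((k u s) ^+ 2)%:E))%E).
  apply: ae_ge0_le_integral => //.
  - by move=> s _; apply: integral_ge0 => w _; rewrite lee_fin sqr_ge0.
  - exact: (@measurable_strip_integral _ _ TR Omega R P _ (fun s w => ((inner_limit s w) ^+ 2)%:E) mI msqJ J0).
  - by move=> s _; rewrite mule_ge0 ?lee_fin.
  - by apply: measurable_funTS; exact: measurable_funeM.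
  apply: ae_mono ae_inner_limit => s hs sT.
  by have [|] := hs; first by move: sT; rewrite /= in_itv.
rewrite ge0_integralZl//; last exact: measurable_funTS.
have kL : (\int[leb]_(s in `[0%R, T]) \int[leb]_u ((k u s) ^+ 2)%:E < +oo)%E.
  by apply: le_lt_trans k_L2; apply: ge0_subset_integral.
by rewrite lte_mul_pinfty// ge0_fin_numE// integral_ge0.
Qed.

End inner_integral.

(** * The stochastic Fubini theorem *)

Section vanishing_integrals.
Context {d : measure_display} {X : measurableType d} {R : realType}.
Variable mu : {measure set X -> \bar R}.

Lemma ae_eq_of_sqr (f g : X -> R) : measurable_fun setT f -> measurable_fun setT g ->
  (forall e : R, 0 < e -> (\int[mu]_x ((f x - g x) ^+ 2)%:E <= e%:E)%E) ->
  {ae mu, forall x, f x = g x}.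
Proof.
move=> mf mg h.
have m2 : measurable_fun setT (fun x => ((f x - g x) ^+ 2)%:E).
  by apply/measurable_EFinP; apply: measurable_funX; exact: measurable_funB.
have i0 : (\int[mu]_x `|((f x - g x) ^+ 2)%:E| = 0)%E.
  rewrite (eq_integral (fun x => ((f x - g x) ^+ 2)%:E)); last first.
    by move=> x _; rewrite gee0_abs// lee_fin sqr_ge0.
  apply/eqP; rewrite eq_le; apply/andP; split.
    by apply/lee_addgt0Pr => e e0; rewrite add0e; exact: h.
  by apply: integral_ge0 => x _; rewrite lee_fin sqr_ge0.
have := (ae_eq_integral_abs mu measurableT m2).1 i0.
apply: ae_mono => x /(_ Logic.I) [] /eqP; rewrite sqrf_eq0 subr_eq0 => /eqP.
by [].
Qed.

End vanishing_integrals.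

Section square_of_integral.
Context {R : realType}.
Local Notation leb := (@lebesgue_measure R).
Local Notation TR := (measurableTypeR R).

Lemma sqr_Rintegral_le_on (t : R) (f : TR -> R) : 0 < t -> measurable_fun `[0, t] f ->
  (((\int[leb]_(s in `[0%R, t]) f s) ^+ 2)%:E <=
   t%:E * \int[leb]_(s in `[0%R, t]) ((f s) ^+ 2)%:E)%E.
Proof.
move=> t0 mf; have mI : measurable (`[0, t] : set TR) by exact: measurable_itv.
have mf' := (measurable_restrictT f mI).1 mf.
have := sqr_Rintegral_le t0 mf'.
rewrite (_ : \int[leb]_(s in `[0, t]) (f \_ `[0, t]) s = \int[leb]_(s in `[0, t]) f s); last first.
  by apply: eq_Rintegral => s sI; rewrite patchE sI.
rewrite (_ : (\int[leb]_(s in `[0%R, t]) (((f \_ `[0, t]) s) ^+ 2)%:E =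
   \int[leb]_(s in `[0%R, t]) ((f s) ^+ 2)%:E)%E)//.
by apply: eq_integral => s sI; rewrite patchE sI.
Qed.

End square_of_integral.

Section time_integral.
Context {R : realType} {d : measure_display} {Omega : measurableType d}.
Local Notation leb := (@lebesgue_measure R).
Local Notation TR := (measurableTypeR R).
Variables (P : probability Omega R) (T : R) (F : R -> set_system Omega).
Variable B : R -> Omega -> R.
Hypothesis T_gt0 : 0 < T.
Hypothesis usual : usual_conditions P F T.
Hypothesis bm : brownian_motion P F T B.
Variables (phi : R -> Omega -> R) (c : R).
Hypothesis pphi : progressive F T phi.
Hypothesis phi2 : forall s, 0 <= s <= T -> (\int[P]_w ((phi s w) ^+ 2)%:E <= c%:E)%E.
Local Notation ito := (is_ito_integral P F B).
Variable k : TR -> TR -> R.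
Hypothesis mk : measurable_fun setT (fun p : TR * TR => k p.1 p.2).
Hypothesis k_out : forall u s, ~~ [&& 0 <= u, u <= s & s <= T] -> k u s = 0.
Hypothesis k_L2 : (\int[leb]_s \int[leb]_u ((k u s) ^+ 2)%:E < +oo)%E.

Let T0T : 0 <= T <= T.
Proof. by rewrite ltW//=. Qed.

Let c0 : 0 <= c.
Proof. exact: (second_moment_ge0 T_gt0 phi2). Qed.

Let mk1 u : measurable_fun setT (k u).
Proof. exact: (measurable_fun_pair2 u mk). Qed.

Let mI (t : R) : measurable (`[0, t] : set TR).
Proof. exact: measurable_itv. Qed.

Definition kernel_primitive (t : R) (u : TR) : R := \int[leb]_(s in `[0, t]) k u s.

Lemma measurable_kernel_primitive t : measurable_fun setT (kernel_primitive t).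
Proof.
apply: measurableT_comp => //.
apply: (@measurable_integral_section _ TR R `[0, t] (fun s u => (k u s)%:E)) => //.
apply: measurable_funTS; apply/measurable_EFinP.
exact: (measurableT_comp mk (@measurable_swap _ _ TR TR)).
Qed.

Let mk_sq : measurable_fun setT (fun u : TR => \int[leb]_s ((k u s) ^+ 2)%:E)%E.
Proof.
apply: (@measurable_strip_integral _ _ TR TR R leb setT (fun u s => ((k u s) ^+ 2)%:E)) => //.
  by rewrite setXTT; apply/measurable_EFinP; exact: measurable_funX.
by move=> u s _; rewrite lee_fin sqr_ge0.
Qed.

Let k0 u : (0 <= \int[leb]_s ((k u s) ^+ 2)%:E)%E.
Proof. by apply: integral_ge0 => s _; rewrite lee_fin sqr_ge0. Qed.

Let sub_sqr (a : TR -> R) (t : R) : measurable_fun setT a ->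
  (\int[leb]_(u in `[0%R, t]) ((a u) ^+ 2)%:E <= \int[leb]_u ((a u) ^+ 2)%:E)%E.
Proof.
move=> ma; apply: ge0_subset_integral => //.
- by apply/measurable_EFinP; exact: measurable_funX.
- by move=> u _; rewrite lee_fin sqr_ge0.
Qed.

Lemma kernel_primitive_L2 t : 0 < t ->
  (\int[leb]_u ((kernel_primitive t u) ^+ 2)%:E < +oo)%E.
Proof.
move=> t0; apply: (@le_lt_trans _ _ (\int[leb]_u (t%:E * \int[leb]_s ((k u s) ^+ 2)%:E))%E).
  apply: ge0_le_integral => //.
  - by move=> u _; rewrite lee_fin sqr_ge0.
  - by apply/measurable_EFinP; apply: measurable_funX; exact: measurable_kernel_primitive.
  - exact: measurable_funeM.
  move=> u _; apply: le_trans (sqr_Rintegral_le t0 (@mk1 u)) _.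
  by rewrite lee_wpmul2l ?lee_fin ?(ltW t0)//; exact: sub_sqr.
rewrite ge0_integralZl// ?lee_fin ?(ltW t0)//.
have h := k_L2_swap mk k_L2.
by rewrite lte_mul_pinfty ?lee_fin ?(ltW t0)// ge0_fin_numE// integral_ge0.
Qed.

Variable N : nat -> nat -> R -> Omega -> R.
Hypothesis NH : forall n j,
  ito_integral_process P F T B (fun s w => kernel_cell_avg T k n j s * phi s w) (N n j).
Local Notation step := (inner_step T N).
Variable ni : nat -> nat.
Local Notation J := (inner_limit T N ni).
Hypothesis niE : forall i,
  (\int[leb]_(s in `[0%R, T]) kernel_err T k (ni i) s <= ((2 ^ i.+1)%:R^-1)%:E)%E.
Hypothesis niS : {ae leb, forall s, `[0, T]%classic s ->
    (\sum_(0 <= i <oo) kernel_err T k (ni i) s < +oo)%E}.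

(** Cauchy-Schwarz in [s], then the error of averaging taken in the swapped order. The integrands
    are compared for almost every [u] only, where [k u] is integrable. *)
Lemma primitive_dist i t : 0 < t -> t <= T ->
  (\int[leb]_u (((\int[leb]_(s in `[0%R, t]) kernel_avg T k (ni i) u s) - kernel_primitive t u) ^+ 2)%:E
    <= t%:E * ((2 ^ i.+1)%:R^-1)%:E)%E.
Proof.
move=> t0 tT.
have mA : measurable_fun setT (fun p : TR * TR => kernel_avg T k (ni i) p.1 p.2).
  exact: measurable_kernel_avg.
have mA1 u : measurable_fun setT (kernel_avg T k (ni i) u) by exact: (measurable_fun_pair2 u mA).
have mdiff u : measurable_fun setT (fun s : TR => kernel_avg T k (ni i) u s - k u s).
  exact: measurable_funB.
have mGi : measurable_fun setT (fun u : TR => \int[leb]_(s in `[0%R, t]) kernel_avg T k (ni i) u s).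
  apply: measurableT_comp => //.
  apply: (@measurable_integral_section _ TR R `[0, t] (fun s u => (kernel_avg T k (ni i) u s)%:E)) => //.
  apply: measurable_funTS; apply/measurable_EFinP.
  exact: (measurableT_comp mA (@measurable_swap _ _ TR TR)).
apply: (@le_trans _ _ (\int[leb]_u (t%:E * \int[leb]_(s in `[0%R, T])
    ((kernel_avg T k (ni i) u s - k u s) ^+ 2)%:E))%E); last first.
  rewrite ge0_integralZl ?lee_fin ?(ltW t0)//; last 2 first.
  - apply: (@measurable_integral_section _ TR R `[0, T]
      (fun s u => ((kernel_avg T k (ni i) u s - k u s) ^+ 2)%:E)) => //.
    apply: measurable_funTS; apply/measurable_EFinP; apply: measurable_funX.
    by apply: measurable_funB;
      [exact: (measurableT_comp mA (@measurable_swap _ _ TR TR))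
      |exact: (measurableT_comp mk (@measurable_swap _ _ TR TR))].
  - by move=> u _; apply: integral_ge0 => s _; rewrite lee_fin sqr_ge0.
  by rewrite -kernel_err_swap// lee_wpmul2l ?lee_fin ?(ltW t0).
apply: ae_ge0_le_integral => //.
- by move=> u _; rewrite lee_fin sqr_ge0.
- apply/measurable_EFinP; apply: measurable_funX; apply: measurable_funB => //.
  exact: measurable_kernel_primitive.
- by move=> u _; rewrite mule_ge0 ?lee_fin ?(ltW t0)//; apply: integral_ge0 => s _; rewrite lee_fin sqr_ge0.
- apply: measurable_funeM.
  apply: (@measurable_integral_section _ TR R `[0, T]
      (fun s u => ((kernel_avg T k (ni i) u s - k u s) ^+ 2)%:E)) => //.
  apply: measurable_funTS; apply/measurable_EFinP; apply: measurable_funX.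
  by apply: measurable_funB;
      [exact: (measurableT_comp mA (@measurable_swap _ _ TR TR))
      |exact: (measurableT_comp mk (@measurable_swap _ _ TR TR))].
apply: ae_mono (ae_lty_integral mk_sq k0 (k_L2_swap mk k_L2)) => u hu _.
have lI : (leb `[0%R, t] < +oo)%E.
  by rewrite lebesgue_measure_itv/=; case: ifP => _; rewrite ltry.
have i1 : leb.-integrable `[0, t] (EFin \o kernel_avg T k (ni i) u).
  exact: integrable_step_fun.
have i2 : leb.-integrable `[0, t] (EFin \o k u).
  apply: (integrable_sqr (mI t) lI); first exact: measurable_funTS.
  by apply: le_lt_trans hu; exact: sub_sqr.
rewrite /kernel_primitive -RintegralB//.
apply: le_trans (sqr_Rintegral_le t0 (mdiff u)) _.
rewrite lee_wpmul2l ?lee_fin ?(ltW t0)//; apply: ge0_subset_integral => //=.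
- by apply: measurable_funTS; apply/measurable_EFinP; exact: measurable_funX.
- by move=> s _; rewrite lee_fin sqr_ge0.
- by move=> s /=; rewrite !in_itv/= => /andP[-> /le_trans ->].
Qed.

Let pJ : progressive F T J.
Proof. exact: (progressive_inner_limit T_gt0 usual NH). Qed.

Lemma integral_inner_limit_wrt t : 0 <= t <= T ->
  measurable_wrt (F t) (fun w => \int[leb]_(s in `[0, t]) J s w).
Proof.
move=> /andP[t0 tT]; apply: measurableT_comp => //.
apply: (@measurable_integral_progressive R d Omega F (fun s w => (J s w)%:E)) => //.
by apply/measurable_EFinP; apply: pJ; rewrite t0.
Qed.

Lemma ae_inner_limit_L2 : {ae P, forall w, (sqint J T w < +oo)%E}.
Proof.
apply: ae_lty_integral.
- exact: (measurable_sqint usual T0T).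
- by move=> w; exact: sqint_ge0.
- exact: (inner_limit_sqr_lty T_gt0 usual bm pphi phi2 mk k_out k_L2 NH niS).
Qed.

(** Cauchy-Schwarz along the path, then Tonelli: at almost every [s] the second moment of the
    difference is at most [c] times the error of the kernel. *)
Lemma time_integral_dist i t : 0 < t -> t <= T ->
  (\int[P]_w (((\int[leb]_(s in `[0%R, t]) step (ni i) s w) - \int[leb]_(s in `[0%R, t]) J s w) ^+ 2)%:E
    <= t%:E * (c%:E * ((2 ^ i.+1)%:R^-1)%:E))%E.
Proof.
move=> t0 tT; have t0T : 0 <= t <= T by rewrite ltW.
have pS : progressive F T (step (ni i)) by exact: (progressive_inner_step T_gt0 usual NH).
have pD : progressive F T (fun s w => step (ni i) s w - J s w) by exact: progressiveB.
have mD : measurable_fun setT (sqint (fun s w => step (ni i) s w - J s w) t).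
  by apply: (measurable_sqint usual t0T); exact: progressive_le tT pD.
have mS : measurable_fun setT (fun w => \int[leb]_(s in `[0, t]) step (ni i) s w).
  apply: (measurable_wrt_ambient usual t0T); apply: measurableT_comp => //.
  apply: (@measurable_integral_progressive R d Omega F (fun s w => (step (ni i) s w)%:E)) => //.
    exact: ltW.
  by apply/measurable_EFinP; apply: pS.
have mV : measurable_fun setT (fun w => \int[leb]_(s in `[0, t]) J s w).
  by apply: (measurable_wrt_ambient usual t0T); exact: integral_inner_limit_wrt.
have mf : measurable_fun (`[0, t] `*` setT)
    (fun p : TR * Omega => ((step (ni i) p.1 p.2 - J p.1 p.2) ^+ 2)%:E).
  apply/measurable_EFinP; apply: measurable_funX.
  exact: (progressive_ambient usual t0T pD).
have f0 (s : TR) (w : Omega) : `[0%R, t]%classic s -> (0 <= ((step (ni i) s w - J s w) ^+ 2)%:E)%E.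
  by rewrite lee_fin sqr_ge0.
apply: (@le_trans _ _ (\int[P]_w (t%:E * sqint (fun s w => step (ni i) s w - J s w)%R t w))%E).
  apply: ae_ge0_le_integral => //.
  - by move=> w _; rewrite lee_fin sqr_ge0.
  - by apply/measurable_EFinP; apply: measurable_funX; exact: measurable_funB.
  - by move=> w _; rewrite mule_ge0 ?lee_fin ?(ltW t0)// sqint_ge0.
  - exact: measurable_funeM.
  apply: ae_mono ae_inner_limit_L2 => w hw _.
  have lI : (leb `[0%R, t] < +oo)%E.
    by rewrite lebesgue_measure_itv/=; case: ifP => _; rewrite ltry.
  have i1 : leb.-integrable `[0, t] (EFin \o (step (ni i))^~ w).
    exact: integrable_step_fun.
  have mJw : measurable_fun `[0, t] (J ^~ w).
    exact: (progressive_section w (ltW t0) (progressive_le tT pJ)).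
  have i2 : leb.-integrable `[0, t] (EFin \o J ^~ w).
    apply: (integrable_sqr (mI t) lI) => //.
    by apply: le_lt_trans hw; exact: (sqint_homo pJ).
  rewrite -RintegralB//; apply: sqr_Rintegral_le_on => //.
  exact: (progressive_section w (ltW t0) (progressive_le tT pD)).
rewrite ge0_integralZl ?lee_fin ?(ltW t0)//; last by move=> w _; exact: sqint_ge0.
rewrite lee_wpmul2l ?lee_fin ?(ltW t0)//.
rewrite /sqint (@tonelli_strip _ _ TR Omega R leb P `[0, t] (fun s w => ((step (ni i) s w - J s w) ^+ 2)%:E) (mI t) mf f0).
have mE := measurable_kernel_err T mk (ni i).
apply: (@le_trans _ _ (\int[leb]_(s in `[0%R, t]) (c%:E * kernel_err T k (ni i) s))%E).
  apply: ae_ge0_le_integral => //.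
  - by move=> s _; apply: integral_ge0 => w _; rewrite lee_fin sqr_ge0.
  - exact: (@measurable_strip_integral _ _ TR Omega R P _ (fun s w => ((step (ni i) s w - J s w) ^+ 2)%:E) (mI t) mf f0).
  - by move=> s _; rewrite mule_ge0 ?lee_fin// kernel_err_ge0.
  - by apply: measurable_funTS; exact: measurable_funeM.
  have := ae_inner_limit T_gt0 usual bm pphi phi2 mk k_out k_L2 NH niS.
  apply: ae_mono => s hs; rewrite /= in_itv/= => /andP[s0 st].
  by have [|_ _] := hs; first by rewrite s0 (le_trans st).
rewrite ge0_integralZl ?lee_fin//; last 2 first.
- exact: measurable_funTS.
- by move=> s _; exact: kernel_err_ge0.
rewrite lee_wpmul2l ?lee_fin//; apply: le_trans (niE i); apply: ge0_subset_integral => //=.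
- exact: measurable_funTS.
- by move=> s _; exact: kernel_err_ge0.
- by move=> s /=; rewrite !in_itv/= => /andP[-> /le_trans ->].
Qed.

(** The integrated step processes approach in L2 both the Ito integral of the primitive, through the
    isometry, and the time integral of the limit; the two must agree almost surely. *)
Lemma integral_inner_limit_ito t : 0 <= t <= T ->
  ito (fun u w => kernel_primitive t u * phi u w) t
    (fun w => \int[leb]_(s in `[0, t]) J s w).
Proof.
move=> t0T; have /andP[] := t0T; rewrite le_eqVlt => /predU1P[<- _|t0 tT].
  have T0 : 0 <= (0 : R) <= T by apply/andP; split; [exact: lexx|exact: ltW].
  have := ito_zero usual bm T0.
  have z (f : R -> R) : \int[leb]_(s in `[0%R, 0%R]) f s = 0.
    by rewrite /Rintegral set_itv1 integral_set1.
  by congr (is_ito_integral _ _ _ _ _ _); apply/funext => u;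
    [apply/funext => w; rewrite /kernel_primitive z mul0r|rewrite z].
have mG := measurable_kernel_primitive t.
have [|M [_ /(_ t t0T) iI]] := ito_kernel_exists T_gt0 usual bm pphi phi2 mG.
  by apply: le_lt_trans (kernel_primitive_L2 t0); exact: sub_sqr.
apply: (ito_ae usual bm t0T iI).
have mM : measurable_fun setT (M t) by exact: (ito_measurable usual t0T iI).
have mV : measurable_fun setT (fun w => \int[leb]_(s in `[0, t]) J s w).
  by apply: (measurable_wrt_ambient usual t0T); exact: integral_inner_limit_wrt.
apply: ae_eq_of_sqr => // e e0.
(* The two errors, doubled by [sqrD_le2], add up to [2 t c 2 ^ -i]; the summand 1 keeps the
   denominator positive when [c] is 0. *)
have K0 : 0 < e / (4 * (t * c + 1)) by rewrite divr_gt0// mulr_gt0// ltr_wpDl// mulr_ge0// ltW.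
have [i /(_ i (leqnn _)) hi] := pow2_small K0.
pose Y w := \int[leb]_(s in `[0, t]) step (ni i) s w.
pose Gi u := \int[leb]_(s in `[0, t]) kernel_avg T k (ni i) u s.
have iY : ito (fun u w => Gi u * phi u w) t Y.
  exact: (integral_inner_step_ito T_gt0 usual bm k_out NH (ni i) t0T).
have mY : measurable_fun setT Y by exact: (ito_measurable usual t0T iY).
have mGi : measurable_fun setT (fun u : TR => Gi u - kernel_primitive t u).
  apply: measurable_funB => //; apply: measurableT_comp => //.
  apply: (@measurable_integral_section _ TR R `[0, t] (fun s u => (kernel_avg T k (ni i) u s)%:E)) => //.
  apply: measurable_funTS; apply/measurable_EFinP.
  exact: (measurableT_comp (measurable_kernel_avg T mk (ni i)) (@measurable_swap _ _ TR TR)).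
have iD : ito (fun u w => (Gi u - kernel_primitive t u) * phi u w) t (fun w => Y w - M t w).
  have := ito_add usual bm (-1) t0T iY iI; congr (is_ito_integral _ _ _ _ _ _).
    by apply/funext => u; apply/funext => w; ring.
  by apply/funext => w; rewrite mulN1r.
have d1 : (\int[P]_w ((Y w - M t w) ^+ 2)%:E <= c%:E * (t%:E * ((2 ^ i.+1)%:R^-1)%:E))%E.
  apply: le_trans (ito_kernel_sqr_le usual bm pphi phi2 t0T mGi iD) _.
  rewrite lee_wpmul2l ?lee_fin//; apply: le_trans (primitive_dist i t0 tT).
  exact: sub_sqr.
have d2 := time_integral_dist i t0 tT.
have mY1 : measurable_fun setT (fun w => ((Y w - M t w) ^+ 2)%:E).
  by apply/measurable_EFinP; apply: measurable_funX; exact: measurable_funB.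
have mY2 : measurable_fun setT (fun w => ((Y w - \int[leb]_(s in `[0, t]) J s w) ^+ 2)%:E).
  by apply/measurable_EFinP; apply: measurable_funX; exact: measurable_funB.
apply: (@le_trans _ _ (\int[P]_w (2%:E * (((Y w - M t w) ^+ 2)%:E +
    ((Y w - \int[leb]_(s in `[0%R, t]) J s w) ^+ 2)%:E)))%E).
  apply: ge0_le_integral => //.
  - by move=> w _; rewrite lee_fin sqr_ge0.
  - by apply/measurable_EFinP; apply: measurable_funX; exact: measurable_funB.
  - by apply: measurable_funeM; exact: emeasurable_funD.
  move=> w _; rewrite -EFinD -EFinM lee_fin.
  rewrite (_ : M t w - _ = - (Y w - M t w) + (Y w - \int[leb]_(s in `[0, t]) J s w)); last by ring.
  by apply: (le_trans (sqrD_le2 _ _)); rewrite sqrrN.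
rewrite ge0_integralZl//; last 2 first.
- exact: emeasurable_funD.
- by move=> w _; rewrite adde_ge0// lee_fin sqr_ge0.
rewrite ge0_integralD//; last 2 first.
- by move=> w _; rewrite lee_fin sqr_ge0.
- by move=> w _; rewrite lee_fin sqr_ge0.
apply: (@le_trans _ _ (2%:E * (c%:E * (t%:E * ((2 ^ i.+1)%:R^-1)%:E) + t%:E * (c%:E * ((2 ^ i.+1)%:R^-1)%:E)))%E).
  by rewrite lee_wpmul2l//; exact: leeD.
change ((2 * (c * (t * (2 ^ i.+1)%:R^-1) + t * (c * (2 ^ i.+1)%:R^-1)))%:E <= e%:E)%E.
rewrite lee_fin expnS natrM invfM.
have tc0 : 0 <= t * c by rewrite mulr_ge0// ltW.
move: hi; rewrite ltr_pdivlMr ?mulr_gt0 ?ltr_wpDl//.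
set z := (2 ^ i)%:R^-1 => hi.
have z0 : 0 <= z by rewrite invr_ge0.
rewrite (_ : 2 * _ = 2 * (t * c) * z); last by field.
by nra.
Qed.

End time_integral.

Lemma eq_bounded_variation (R : realType) (a b : R) (f g : R -> R) :
  (forall x, a <= x <= b -> f x = g x) -> bounded_variation a b f -> bounded_variation a b g.
Proof.
move=> e [M hM]; exists M => _ [l lp <-].
rewrite (_ : variation a b g l = variation a b f l); first by apply: hM; exists l.
apply: eq_big_nat => i /andP[_ il] /=.
have hx m : (m < (size l).+1)%N -> g (nth b (a :: l) m) = f (nth b (a :: l) m).
  move=> ml; symmetry; apply: e.
  by rewrite (itv_partition_nth_ge ml lp) (itv_partition_nth_le ml lp).
by rewrite -!/(nth b (a :: l) _) (hx i.+1)// (hx i (leqW il)).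
Qed.

(** * The drift and the decomposition *)

Section primitives.
Context {R : realType}.
Local Notation leb := (@lebesgue_measure R).
Local Notation TR := (measurableTypeR R).
Variables (T : R).
Hypothesis T_gt0 : 0 < T.

Let mI (t : R) : measurable (`[0, t] : set TR).
Proof. exact: measurable_itv. Qed.

Let subI (s t : R) : s <= t -> `[0, s]%classic `<=` `[0, t]%classic.
Proof. by move=> st u /=; rewrite !in_itv/= => /andP[-> /le_trans ->]. Qed.

Lemma primitive_nondecreasing (f : TR -> R) : leb.-integrable `[0, T] (EFin \o f) ->
  (forall s, 0 <= f s) ->
  {in `[0, T] &, {homo (fun t => \int[leb]_(s in `[0, t]) f s) : x y / x <= y}}.
Proof.
move=> fi f0 x y; rewrite !in_itv/= => /andP[_ xT] /andP[_ yT] xy.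
have ix (z : R) : z <= T -> leb.-integrable `[0, z] (EFin \o f).
  by move=> zT; exact: integrableS (mI T) (mI z) (subI zT) fi.
rewrite /Rintegral; apply: fine_le.
- by apply: integrable_fin_num => //; exact: ix.
- by apply: integrable_fin_num => //; exact: ix.
apply: ge0_subset_integral => //.
- by have /integrableP[] := ix y yT.
- by move=> s _; rewrite lee_fin.
- exact: subI.
Qed.

(** Jordan decomposition: the difference of the primitives of the positive and negative parts, both
    nondecreasing. *)
Lemma primitive_bounded_variation (f : TR -> R) : leb.-integrable `[0, T] (EFin \o f) ->
  bounded_variation 0 T (fun t => \int[leb]_(s in `[0, t]) f s).
Proof.
move=> fi; have fp := integrable_funrpos (mI T) fi; have fn := integrable_funrneg (mI T) fi.
have /nondecreasing_bounded_variation b1 :=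
  primitive_nondecreasing fp (fun s => funrpos_ge0 f s).
have /nondecreasing_bounded_variation/bounded_variationN b2 :=
  primitive_nondecreasing fn (fun s => funrneg_ge0 f s).
apply: eq_bounded_variation (bounded_variationD T_gt0 b1 b2) => t /andP[t0 tT] /=.
rewrite -RintegralB//; last 2 first.
- exact: integrableS (mI T) (mI t) (subI tT) fp.
- exact: integrableS (mI T) (mI t) (subI tT) fn.
by apply: eq_Rintegral => s _; exact: (congr1 (fun g => g s) (funrposBneg f)).
Qed.

Lemma continuous_primitive (f : TR -> R) : leb.-integrable `[0, T] (EFin \o f) ->
  {within `[0, T], continuous (fun t => \int[leb]_(s in `[0, t]) f s)}.
Proof. by move=> fi; exact: (parameterized_integral_continuous (ltW T_gt0) fi). Qed.

End primitives.

Section pathwise_fubini.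
Context {R : realType}.
Local Notation leb := (@lebesgue_measure R).
Local Notation TR := (measurableTypeR R).
Variables (T : R) (k : TR -> TR -> R) (p : TR -> R).
Hypothesis T_gt0 : 0 < T.
Hypothesis mk : measurable_fun setT (fun q : TR * TR => k q.1 q.2).
Hypothesis k_out : forall u s, ~~ [&& 0 <= u, u <= s & s <= T] -> k u s = 0.
Hypothesis k_int : forall u, leb.-integrable setT (fun s => (k u s)%:E).
Hypothesis mp : measurable_fun `[0, T] p.
Hypothesis kp_int : (\int[leb]_(u in `[0%R, T])
  ((\int[leb]_s (`|k u s|)%:E) * (`|p u|)%:E) < +oo)%E.

Let mI (t : R) : measurable (`[0, t] : set TR).
Proof. exact: measurable_itv. Qed.

Let q := p \_ `[0, T].

Let mq : measurable_fun setT q.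
Proof. exact: (measurable_restrictT p (mI T)).1. Qed.

(** The integrand on the whole plane, with the time variable first; the cut-off in time and the
    extension of [p] by 0 are explicit, and the constraint [u <= s] is carried by the support of
    [k]. *)
Let G t (z : TR * TR) : \bar R := (k z.2 z.1 * \1_(`[0, t]%classic) z.1 * q z.2)%:E.

Let mG t : measurable_fun setT (G t).
Proof.
apply/measurable_EFinP; apply: measurable_funM; last first.
  exact: (measurableT_comp mq (@measurable_snd _ _ TR TR)).
apply: measurable_funM; first exact: (measurableT_comp mk (@measurable_swap _ _ TR TR)).
apply: (measurableT_comp (f := \1_(`[0, t]%classic) : TR -> R)); first exact: measurable_indic.
exact: measurable_fst.
Qed.

Let G_lty t : (\int[leb]_u \int[leb]_s `|G t (s, u)| < +oo)%E.
Proof.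
apply: le_lt_trans kp_int.
rewrite [leRHS]integral_mkcond; apply: ge0_le_integral => //.
- by move=> u _; exact: integral_ge0.
- apply: (@measurable_integral_section _ TR R setT (fun s u => `|G t (s, u)|)%E) => //.
  rewrite setXTT; apply: measurableT_comp => //.
  by apply: eq_measurable_fun (mG t) => -[].
- apply: (measurable_restrictT _ (mI T)).1; apply: emeasurable_funM.
    apply: measurable_funTS.
    apply: (@measurable_integral_section _ TR R setT (fun s u => (`|k u s|)%:E)) => //.
    rewrite setXTT; apply/measurable_EFinP; apply: measurableT_comp => //.
    exact: (measurableT_comp mk (@measurable_swap _ _ TR TR)).
  by apply/measurable_EFinP; apply: measurableT_comp.
move=> u _; rewrite patchE; case: ifPn => uT; last first.
  rewrite integral0_eq// => s _; rewrite /G/= /q patchE (negbTE uT) mulr0 normr0//.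
have /integrableP[ik _] := k_int u.
have mku : measurable_fun setT (fun s : TR => (`|k u s|)%:E).
  apply/measurable_EFinP; apply: measurableT_comp => //; exact: (measurable_fun_pair2 u mk).
rewrite muleC -ge0_integralZl//.
apply: ge0_le_integral => //.
- apply: measurableT_comp => //.
  exact: (measurable_fun_pair1 u (mG t)).
- exact: measurable_funeM.
move=> s _; rewrite /G/= /q patchE uT -EFinM lee_fin !normrM mulrC ler_wpM2l//.
by rewrite ler_piMr// indicE; case: (_ \in _); rewrite ?normr1 ?normr0.
Qed.

Let iG t : (leb \x leb)%E.-integrable setT (G t).
Proof. by apply/(integrable21ltyP leb leb (mG t)); exact: G_lty. Qed.

Let iG' t : (leb \x leb)%E.-integrable setT (fun z : TR * TR => G t (z.2, z.1)).
Proof.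
have mG' : measurable_fun setT (fun z : TR * TR => G t (z.2, z.1)).
  exact: (measurableT_comp (mG t) (@measurable_swap _ _ TR TR)).
by apply/(integrable12ltyP leb leb mG'); exact: G_lty.
Qed.

Let kI u s t : u \notin `[0, s]%classic -> k u s * \1_(`[0, t]%classic) s * q u = 0.
Proof.
move=> us; rewrite k_out ?mul0r//; apply: contra us => /and3P[u0 us' _].
by rewrite mem_setE in_itv/= u0.
Qed.

Let inner_eq t s : 0 <= s <= T -> (\int[leb]_u G t (s, u) =
  \int[leb]_(u in `[0%R, s]) (k u s * \1_(`[0, t]%classic) s * p u)%:E)%E.
Proof.
move=> /andP[s0 sT]; rewrite [RHS]integral_mkcond; apply: eq_integral => u _.
rewrite /G/= patchE; case: ifPn => [us|/kI ->//].
rewrite /q patchE ifT//; move: us; rewrite !mem_setE !in_itv/= => /andP[-> /le_trans]; exact.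
Qed.

Lemma pathwise_inner_integrable : {ae leb, forall s, 0 <= s <= T ->
  leb.-integrable `[0, s] (fun u => (k u s * p u)%:E)}.
Proof.
apply: ae_mono (ae_integrable1 (iG T)) => s hs sT.
have := integrableS measurableT (mI s) (@subsetT _ _) hs.
apply: eq_integrable => // u; rewrite /G/= /q patchE !indicE !mem_setE !in_itv/= => /andP[u0 us].
by case/andP: sT => s0 sT; rewrite u0 (le_trans us sT) s0 sT mulr1.
Qed.

Lemma pathwise_inner_primitive_integrable : leb.-integrable `[0, T]
  (fun s => (\int[leb]_(u in `[0, s]) (k u s * p u))%:E).
Proof.
have h := integrableS measurableT (mI T) (@subsetT _ _) (integrable_fubini_F (iG T)).
have e s : s \in `[0, T]%classic -> (\int[leb]_(u in `[0, s]) (k u s * p u))%:E =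
    (fine (fubini_F leb (G T) s))%:E.
  rewrite mem_setE in_itv/= => sT; rewrite /fubini_F inner_eq//; congr EFin.
  rewrite /Rintegral; congr fine; apply: eq_integral => u _.
  by rewrite indicE mem_setE in_itv/= sT mulr1.
apply: (eq_integrable _ (fun s => (fine (fubini_F leb (G T) s))%:E)) => //.
  by move=> s sT; rewrite e.
have /integrableP[mh _] := h.
apply: (le_integrable (mI T) _ _ h).
  by apply/measurable_EFinP; exact: measurableT_comp.
by move=> s _; case: (fubini_F leb (G T) s) => [r||] //=; rewrite ?normr0 ?leey.
Qed.

Lemma pathwise_fubini t : 0 <= t <= T ->
  leb.-integrable `[0, t] (fun u => (kernel_primitive k t u * p u)%:E) /\
  \int[leb]_(s in `[0, t]) \int[leb]_(u in `[0, s]) (k u s * p u) =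
  \int[leb]_(u in `[0, t]) (kernel_primitive k t u * p u).
Proof.
move=> /andP[t0 tT].
have eu (u : TR) : u \in `[0, t]%classic -> (\int[leb]_s G t (s, u) =
    (kernel_primitive k t u * p u)%:E)%E.
  rewrite mem_setE in_itv/= => /andP[u0 ut].
  have ikt := integrableS measurableT (mI t) (@subsetT _ _) (k_int u).
  rewrite /kernel_primitive mulrC EFinM /Rintegral fineK; last exact: integrable_fin_num.
  rewrite -integralZl// [RHS]integral_mkcond; apply: eq_integral => s _.
  rewrite /G/= /q !patchE indicE !mem_setE !in_itv/= u0 (le_trans ut tT)/=.
  by case: ifPn => _; rewrite ?mulr1 ?mulr0 ?mul0r// mulrC.
have eu0 (u : TR) : u \notin `[0, t]%classic -> (\int[leb]_s G t (s, u) = 0)%E.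
  move=> ut; apply: integral0_eq => s _; rewrite /G/= indicE mem_setE in_itv/=.
  have [/andP[s0 st]|_] := boolP (0 <= s <= t); last by rewrite mulr0 mul0r.
  rewrite k_out ?mul0r//; apply: contra ut => /and3P[u0 us _].
  by rewrite mem_setE in_itv/= u0 (le_trans us).
have iu := integrableS measurableT (mI t) (@subsetT _ _) (integrable_fubini_F (iG' t)).
split.
  by apply: (eq_integrable _ _ _ _ iu) => // u ut; rewrite /fubini_G eu.
have iI : leb.-integrable `[0, t] (fun s => (\int[leb]_(u in `[0, s]) (k u s * p u))%:E).
  apply: integrableS (mI T) (mI t) _ pathwise_inner_primitive_integrable.
  by move=> s /=; rewrite !in_itv/= => /andP[-> /le_trans ->].
have iF := integrableS measurableT (mI t) (@subsetT _ _) (integrable_fubini_F (iG t)).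
rewrite /Rintegral; congr fine.
(* Where the inner integral does not converge, its real-valued form is a default value, so the two
   integrands are compared almost everywhere only. *)
transitivity (\int[leb]_(s in `[0%R, t]) fubini_F leb (G t) s)%E.
  apply: ae_eq_integral => //.
  - by have /integrableP[] := iI.
  - by have /integrableP[] := iF.
  apply: ae_mono pathwise_inner_integrable => s hs; rewrite /= in_itv/= => /andP[s0 st].
  have sT : 0 <= s <= T by rewrite s0 (le_trans st).
  have is_ := hs sT; rewrite /fubini_F inner_eq// fineK; last exact: integrable_fin_num.
  by apply: eq_integral => u _; rewrite indicE mem_setE in_itv/= s0 st mulr1.
transitivity (\int[leb]_s \int[leb]_u G t (s, u))%E.
  rewrite integral_mkcond; apply: eq_integral => s _; rewrite patchE.
  case: ifPn => // st; symmetry; apply: integral0_eq => u _.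
  by rewrite /G/= indicE (negbTE st) mulr0 mul0r.
rewrite (Fubini (iG t)) [RHS]integral_mkcond; apply: eq_integral => u _; rewrite patchE.
by case: ifPn => ut; [exact: eu|exact: eu0].
Qed.

End pathwise_fubini.

Section absolutely_continuous_kernels.
Context {R : realType}.
Local Notation leb := (@lebesgue_measure R).
Local Notation TR := (measurableTypeR R).
Variables (T : R) (K dK : R -> R -> R).
Hypothesis Kac : abs_continuous_kernel T K dK.

Let mI (a b : R) : measurable (`[a, b] : set TR).
Proof. exact: measurable_itv. Qed.

Let kext_itv u t : 0 <= u -> t <= T ->
  (fun s => (kext T dK u s)%:E) \_ `[0, t] = (fun s => (dK u s)%:E) \_ `[u, t].
Proof.
move=> u0 tT; apply/funext => s; rewrite !patchE !mem_setE !in_itv/=.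
case: (leP u s) => us /=; last by rewrite kext_out ?if_same// (leNgt u) us andbF.
rewrite (le_trans u0 us)/=; case: ifPn => // st.
by rewrite kext_in// (le_trans st).
Qed.

Lemma kext_integrable u : leb.-integrable setT (fun s => (kext T dK u s)%:E).
Proof.
have [/andP[u0 uT]|uT] := boolP (0 <= u <= T); last first.
  apply: (eq_integrable measurableT (fun=> 0%E)) => [s _|]; last exact: integrable0.
  rewrite kext_out//; apply: contra uT => /and3P[-> us sT]; exact: le_trans sT.
have [iK _] := Kac.2 u (introT andP (conj u0 uT)).
have := (integrable_mkcond _ (mI u T)).1 iK; rewrite -(kext_itv u0 (lexx T)).
apply: eq_integrable => // s _; rewrite patchE mem_setE in_itv/=.
case: ifPn => // sT; rewrite kext_out//; apply: contra sT => /and3P[_ us ->].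
by rewrite (le_trans u0 us).
Qed.

(** Extension by 0 turns the integral from [u] to [t] into one from 0 to [t], whose bounds no longer
    depend on [u]; this is the form in which the Fubini theorems produce it. *)
Lemma kernel_primitive_kext u t : 0 <= u -> u <= t -> t <= T ->
  kernel_primitive (kext T dK) t u = K u t - K u u.
Proof.
move=> u0 ut tT; have [_ ->] := Kac.2 u (introT andP (conj u0 (le_trans ut tT))); last by rewrite ut.
rewrite /kernel_primitive /Rintegral; congr fine.
by rewrite integral_mkcond [RHS]integral_mkcond kext_itv.
Qed.

End absolutely_continuous_kernels.

Section linear_growth.
Context {R : realType} {d : measure_display} {Omega : measurableType d}.
Variables (P : probability Omega R) (X f : Omega -> R) (C m : R).
Hypothesis mX : measurable_fun setT X.
Hypothesis mf : measurable_fun setT f.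
Hypothesis X2 : ('E_P[fun w => (`|X w| ^+ 2)%R] <= m%:E)%E.
Hypothesis fX : forall w, `|f w| <= C * (1 + `|X w|).

Let mX2 : measurable_fun setT (fun w => (1 + `|X w| ^+ 2)%:E).
Proof.
apply/measurable_EFinP; apply: measurable_funD => //.
by apply: measurable_funX; exact: measurableT_comp.
Qed.

Let EX2 : (\int[P]_w (1 + `|X w| ^+ 2)%:E <= (1 + m)%:E)%E.
Proof.
have mX2' : measurable_fun setT (fun w => (`|X w| ^+ 2)%:E).
  by apply/measurable_EFinP; apply: measurable_funX; exact: measurableT_comp.
under eq_integral do rewrite EFinD.
rewrite ge0_integralD//.
rewrite integral_cst// [X in (_ * X)%E]probability_setT mule1 EFinD leeD2l//.
by move: X2; rewrite unlock.
Qed.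

Lemma linear_growth_L2 : (\int[P]_w ((f w) ^+ 2)%:E <= (2 * C ^+ 2 * (1 + m))%:E)%E.
Proof.
apply: (@le_trans _ _ (\int[P]_w ((2 * C ^+ 2)%:E * (1 + `|X w| ^+ 2)%:E))%E).
  apply: ge0_le_integral => //.
  - by move=> w _; rewrite lee_fin sqr_ge0.
  - by apply/measurable_EFinP; exact: measurable_funX.
  - exact: measurable_funeM.
  move=> w _; rewrite -EFinM lee_fin -(real_normK (num_real (f w))).
  have h := fX w; have h0 := normr_ge0 (f w).
  (* The factor 2 comes from [(1 + y)^2 <= 2 (1 + y^2)]. *)
  apply: (@le_trans _ _ ((C * (1 + `|X w|)) ^+ 2)).
    by rewrite ler_pXn2r ?nnegrE// (le_trans h0).
  have := sqr_ge0 (1 - `|X w|); have := sqr_ge0 C; set y := `|X w|; nra.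
rewrite ge0_integralZl//; last by rewrite lee_fin mulr_ge0 ?sqr_ge0.
by rewrite [leRHS]EFinM lee_wpmul2l// lee_fin mulr_ge0 ?sqr_ge0.
Qed.

Lemma linear_growth_L1 : 0 <= C -> (\int[P]_w (`|f w|)%:E <= (2 * C * (1 + m))%:E)%E.
Proof.
move=> C0; apply: (@le_trans _ _ (\int[P]_w ((2 * C)%:E * (1 + `|X w| ^+ 2)%:E))%E).
  apply: ge0_le_integral => //.
  - by apply/measurable_EFinP; exact: measurableT_comp.
  - exact: measurable_funeM.
  move=> w _; rewrite -EFinM lee_fin; apply: (le_trans (fX w)).
  rewrite (mulrC 2 C) -mulrA ler_wpM2l//.
  have := normr_ge0 (X w); have := sqr_ge0 (1 - `|X w|); set y := `|X w|; nra.
rewrite ge0_integralZl//; last by rewrite lee_fin mulr_ge0.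
by rewrite [leRHS]EFinM lee_wpmul2l// lee_fin mulr_ge0.
Qed.

End linear_growth.

Section drift_integrability.
Context {R : realType} {d : measure_display} {Omega : measurableType d}.
Local Notation leb := (@lebesgue_measure R).
Local Notation TR := (measurableTypeR R).
Variables (P : probability Omega R) (T : R) (F : R -> set_system Omega).
Hypothesis T_gt0 : 0 < T.
Hypothesis usual : usual_conditions P F T.
Variables (psi : R -> Omega -> R) (c : R).
Hypothesis ppsi : progressive F T psi.
Hypothesis psi1 : forall s, 0 <= s <= T -> (\int[P]_w (`|psi s w|)%:E <= c%:E)%E.
Variable k : TR -> TR -> R.
Hypothesis mk : measurable_fun setT (fun p : TR * TR => k p.1 p.2).
Hypothesis k_L1 : (\int[leb]_s \int[leb]_u (`|k u s|)%:E < +oo)%E.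

Let T0T : 0 <= T <= T.
Proof. by rewrite ltW//=. Qed.

Let mI : measurable (`[0, T] : set TR).
Proof. exact: measurable_itv. Qed.

Let a (u : TR) : \bar R := (\int[leb]_s (`|k u s|)%:E)%E.

Let mabs : measurable_fun setT (fun p : TR * TR => (`|k p.1 p.2|)%:E).
Proof. by apply/measurable_EFinP; exact: measurableT_comp. Qed.

Let ma : measurable_fun setT a.
Proof.
apply: (@measurable_strip_integral _ _ TR TR R leb setT (fun u s => (`|k u s|)%:E)) => //.
by rewrite setXTT.
Qed.

Let a0 u : (0 <= a u)%E.
Proof. by apply: integral_ge0 => s _; rewrite lee_fin. Qed.

(** Tonelli and the uniform first moment of [psi] give a finite expectation, hence for almost every
    path the hypothesis of the pathwise Fubini theorem. *)
Lemma ae_kernel_psi_integrable : {ae P, forall w,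
  (\int[leb]_(u in `[0%R, T]) (a u * (`|psi u w|)%:E) < +oo)%E}.
Proof.
have mpsi := progressive_ambient usual T0T ppsi.
have mf : measurable_fun (`[0, T] `*` setT) (fun p : TR * Omega => (a p.1 * (`|psi p.1 p.2|)%:E)%E).
  apply: emeasurable_funM.
    by apply: measurable_funTS; apply: (measurableT_comp ma); exact: measurable_fst.
  by apply/measurable_EFinP; exact: measurableT_comp.
have f0 (u : TR) (w : Omega) : `[0%R, T]%classic u -> (0 <= a u * (`|psi u w|)%:E)%E.
  by move=> _; rewrite mule_ge0.
apply: ae_lty_integral.
- exact: (@measurable_integral_section _ Omega R `[0, T] (fun u w => a u * (`|psi u w|)%:E)%E).
- by move=> w; apply: integral_ge0 => u uT; exact: f0.
rewrite (@tonelli_strip _ _ TR Omega R leb P `[0, T] (fun u w => a u * (`|psi u w|)%:E)%E mI mf f0).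
apply: (@le_lt_trans _ _ (\int[leb]_(u in `[0%R, T]) (c%:E * a u))%E).
  apply: ge0_le_integral => //.
  - by move=> u uT; apply: integral_ge0 => w _; exact: f0.
  - exact: (@measurable_strip_integral _ _ TR Omega R P _ (fun u w => a u * (`|psi u w|)%:E)%E mI mf f0).
  - by apply: measurable_funTS; exact: measurable_funeM.
  move=> u; rewrite /= in_itv/= => uT.
  have mu_ : measurable_fun setT (fun w => (`|psi u w|)%:E).
    apply/measurable_EFinP; apply: measurableT_comp => //.
    exact: (measurable_wrt_ambient usual uT (progressive_at uT ppsi)).
  by rewrite ge0_integralZl// muleC lee_wpmul2r//; exact: psi1.
have c0 : 0 <= c.
  by rewrite -lee_fin; apply: le_trans (psi1 T0T); apply: integral_ge0 => w _; rewrite lee_fin.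
rewrite ge0_integralZl//; last exact: measurable_funTS.
have aL : (\int[leb]_(u in `[0%R, T]) a u < +oo)%E.
  apply: (@le_lt_trans _ _ (\int[leb]_u a u)%E); first exact: ge0_subset_integral.
  have -> // : (\int[leb]_u a u = \int[leb]_s \int[leb]_u (`|k u s|)%:E)%E.
  by have := @fubini_tonelli _ _ TR TR R leb leb (fun p => (`|k p.1 p.2|)%:E) mabs; apply => p; rewrite lee_fin.
by rewrite lte_mul_pinfty ?lee_fin// ge0_fin_numE// integral_ge0.
Qed.

End drift_integrability.

Lemma progressive_eq (R : realType) (d : measure_display) (Omega : measurableType d)
    (F : R -> set_system Omega) (H H' : R -> Omega -> R) (t : R) :
  (forall s w, 0 <= s <= t -> H s w = H' s w) -> progressive F t H -> progressive F t H'.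
Proof.
move=> e pH u /andP[u0 ut]; apply: eq_measurable_fun; last by apply: pH; rewrite u0.
move=> [s w] /=; rewrite inE/= in_itv/= => -[/andP[s0 su] _].
by apply: e; rewrite s0 (le_trans su).
Qed.

(** * Decomposition of a solution of the Volterra equation *)

Section volterra.
Context {R : realType} {d : measure_display} {Omega : measurableType d}.
Local Notation leb := (@lebesgue_measure R).
Local Notation TR := (measurableTypeR R).
Variables (P : probability Omega R) (T : R) (F : R -> set_system Omega).
Variable B : R -> Omega -> R.
Hypothesis T_gt0 : 0 < T.
Hypothesis usual : usual_conditions P F T.
Hypothesis bm : brownian_motion P F T B.
Local Notation ito := (is_ito_integral P F B).
Variables (x0 : R -> R) (Kmu dKmu Ks dKs mu sg : R -> R -> R) (X : R -> Omega -> R).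
Hypothesis Kmu_meas : measurable_on_triangle T Kmu.
Hypothesis Ks_meas : measurable_on_triangle T Ks.
Hypothesis Kmu_ac : abs_continuous_kernel T Kmu dKmu.
Hypothesis dKmu_L1 : in_Lp_triangle 1 T dKmu.
Hypothesis Ks_ac : abs_continuous_kernel T Ks dKs.
Hypothesis dKs_L2 : in_Lp_triangle 2 T dKs.
Hypothesis sol : volterra_solution P F T B x0 Kmu Ks mu sg X.
Local Notation psi := (fun s w => mu s (X s w)).
Local Notation phi := (fun s w => sg s (X s w)).
Variables c1 c2 : R.
Hypothesis ppsi : progressive F T psi.
Hypothesis pphi : progressive F T phi.
Hypothesis psi1 : forall s, 0 <= s <= T -> (\int[P]_w (`|psi s w|)%:E <= c1%:E)%E.
Hypothesis phi2 : forall s, 0 <= s <= T -> (\int[P]_w ((phi s w) ^+ 2)%:E <= c2%:E)%E.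

Let T0T : 0 <= T <= T.
Proof. by rewrite ltW//=. Qed.

Let mI (t : R) : measurable (`[0, t] : set TR).
Proof. exact: measurable_itv. Qed.

Let km := kext T dKmu.
Let ks := kext T dKs.

Let mkm : measurable_fun setT (fun p : TR * TR => km p.1 p.2).
Proof. exact: measurable_kext dKmu_L1.1. Qed.

Let mks : measurable_fun setT (fun p : TR * TR => ks p.1 p.2).
Proof. exact: measurable_kext dKs_L2.1. Qed.

Let km_out u s : ~~ [&& 0 <= u, u <= s & s <= T] -> km u s = 0.
Proof. exact: kext_out. Qed.

Let ks_out u s : ~~ [&& 0 <= u, u <= s & s <= T] -> ks u s = 0.
Proof. exact: kext_out. Qed.

Let km_L1 : (\int[leb]_s \int[leb]_u (`|km u s|)%:E < +oo)%E.
Proof. by have := in_Lp_kext (isT : (0 < 1)%N) dKmu_L1; under eq_integral do under eq_integral do rewrite expr1. Qed.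

Let ks_L2 : (\int[leb]_s \int[leb]_u ((ks u s) ^+ 2)%:E < +oo)%E.
Proof.
have := in_Lp_kext (isT : (0 < 2)%N) dKs_L2.
by under eq_integral do under eq_integral do rewrite (real_normK (num_real _)).
Qed.

Let H (s : R) (w : Omega) : R := Ks s s * phi s w.

Let pH : progressive F T H.
Proof.
apply: progressive_eq (progressive_kernelM pphi (measurable_kext_diag Ks_meas)) => s w /andP[s0 sT].
by rewrite /H kext_in.
Qed.

(** The solution property at the single time [T] yields pathwise integrability for the kernels with
    second argument [T]; the diagonal kernels are recovered by subtracting a primitive. *)
Let ae_section_T : {ae P, forall w,
  (\int[leb]_(s in `[0%R, T]) (`|Kmu s T * psi s w|)%:E < +oo)%E /\
  (sqint (fun s w => kext T Ks s T * phi s w)%R T w < +oo)%E}.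
Proof.
have [_ _ /(_ T T0T)[h _]] := sol.
have m1 : progressive F T (fun s w => kext T Kmu s T * psi s w).
  exact: (progressive_kernelM ppsi (measurable_kext2 T Kmu_meas)).
have m2 : progressive F T (fun s w => kext T Ks s T * phi s w).
  exact: (progressive_kernelM pphi (measurable_kext2 T Ks_meas)).
apply: ae_mono h => w h.
have mw1 : measurable_fun `[0, T] (fun s : TR => (`|Kmu s T * psi s w|)%:E).
  apply/measurable_EFinP; apply: measurableT_comp => //.
  apply: eq_measurable_fun (progressive_section w (ltW T_gt0) m1) => s.
  by rewrite inE/= in_itv/= => /andP[s0 sT]; rewrite kext_in.
have mw2 : measurable_fun `[0, T] (fun s : TR => ((Ks s T * phi s w) ^+ 2)%:E).
  apply: eq_measurable_fun (measurable_sqr_section w (ltW T_gt0) m2) => s.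
  by rewrite inE/= in_itv/= => /andP[s0 sT]; rewrite kext_in.
have e2 : sqint (fun s w => kext T Ks s T * phi s w) T w =
    (\int[leb]_(s in `[0%R, T]) ((Ks s T * phi s w) ^+ 2)%:E)%E.
  by apply: eq_integral => s; rewrite inE/= in_itv/= => /andP[s0 sT]; rewrite kext_in.
rewrite e2; have {}h : (\int[leb]_(s in `[0%R, T]) (`|Kmu s T * psi s w|)%:E +
    \int[leb]_(s in `[0%R, T]) ((Ks s T * phi s w) ^+ 2)%:E < +oo)%E.
  rewrite -ge0_integralD//; last by move=> s _; rewrite lee_fin sqr_ge0.
  apply: le_lt_trans h; rewrite le_eqVlt; apply/orP; left; apply/eqP.
  by apply: eq_integral => s _; rewrite EFinD (real_normK (num_real _)).
have p1 : (0 <= \int[leb]_(s in `[0%R, T]) (`|Kmu s T * psi s w|)%:E)%E.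
  by apply: integral_ge0 => s _; rewrite lee_fin.
have p2 : (0 <= \int[leb]_(s in `[0%R, T]) ((Ks s T * phi s w) ^+ 2)%:E)%E.
  by apply: integral_ge0 => s _; rewrite lee_fin sqr_ge0.
by split; apply: le_lt_trans h; rewrite ?leeDl ?leeDr.
Qed.

Section construction.
Variables (N : nat -> nat -> R -> Omega -> R) (ni : nat -> nat).
Hypothesis NH : forall n j,
  ito_integral_process P F T B (fun s w => kernel_cell_avg T ks n j s * phi s w) (N n j).
Hypothesis niE : forall i,
  (\int[leb]_(s in `[0%R, T]) kernel_err T ks (ni i) s <= ((2 ^ i.+1)%:R^-1)%:E)%E.
Hypothesis niS : {ae leb, forall s, `[0, T]%classic s ->
    (\sum_(0 <= i <oo) kernel_err T ks (ni i) s < +oo)%E}.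
Local Notation J := (inner_limit T N ni).

Let pJ : progressive F T J.
Proof. exact: (progressive_inner_limit T_gt0 usual NH). Qed.

Let primitive_ito t : 0 <= t <= T ->
  ito (fun u w => kernel_primitive ks t u * phi u w) t (fun w => \int[leb]_(s in `[0, t]) J s w).
Proof.
exact: (integral_inner_limit_ito T_gt0 usual bm pphi phi2 mks ks_out ks_L2 NH niE niS).
Qed.

(** [Ks s s] is [Ks s T] minus the primitive of the derivative up to [T]. The first term is
    controlled by the solution property and the second by the L2 norm of the derivative; the
    resulting bound is pathwise. *)
Lemma ae_sqint_diagonal : {ae P, forall w, (sqint H T w < +oo)%E}.
Proof.
have h := ito_sqint_lty (primitive_ito T0T).
apply: ae_mono2 ae_section_T h => w [_ h1] h2.
apply: (@le_lt_trans _ _ (2%:E * (sqint (fun s w => kext T Ks s T * phi s w)%R T w +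
  sqint (fun u w => kernel_primitive ks T u * phi u w)%R T w))%E); last first.
  by rewrite lte_mul_pinfty// lte_add_pinfty.
apply: (sqint_le2 (F := F)) => //.
- exact: ltW.
- exact: (progressive_kernelM pphi (measurable_kext2 T Ks_meas)).
- exact: (progressive_kernelM pphi (measurable_kernel_primitive mks T)).
move=> s /andP[s0 sT]; rewrite /H (kernel_primitive_kext Ks_ac)// kext_in//.
rewrite (_ : Ks s s * _ = Ks s T * phi s w + - ((Ks s T - Ks s s) * phi s w)); last by ring.
by apply: (le_trans (sqrD_le2 _ _)); rewrite sqrrN.
Qed.

Lemma inner_limit_is_inner_ito_integral : inner_ito_integral P F T B dKs sg X J.
Proof.
split => //.
apply: ae_mono (ae_inner_limit T_gt0 usual bm pphi phi2 mks ks_out ks_L2 NH niS) => s hs sT.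
have [iJ _ _] := hs sT; apply: (ito_eq sT iJ) => u w /andP[u0 us].
by rewrite /ks kext_in//; case/andP: sT.
Qed.

(** These three conditions isolate the randomness: off one null set, everything about the drift is a
    deterministic statement on a single path. *)
Let ae_paths : {ae P, forall w,
  [/\ (\int[leb]_(s in `[0%R, T]) (`|Kmu s T * psi s w|)%:E < +oo)%E,
      (\int[leb]_(u in `[0%R, T]) ((\int[leb]_s (`|km u s|)%:E) * (`|psi u w|)%:E) < +oo)%E &
      (sqint J T w < +oo)%E]}.
Proof.
have h1 := ae_kernel_psi_integrable T_gt0 usual ppsi psi1 mkm km_L1.
have h2 := ae_inner_limit_L2 T_gt0 usual bm pphi phi2 mks ks_out ks_L2 NH niS.
have h := ae_mono2 (C := fun w => _ /\ _) (fun w a b => conj a b) h1 h2.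
by apply: ae_mono2 ae_section_T h => w [a _] [b e].
Qed.

Section path.
Variable w : Omega.
Hypothesis w1 : (\int[leb]_(s in `[0%R, T]) (`|Kmu s T * psi s w|)%:E < +oo)%E.
Hypothesis w2 : (\int[leb]_(u in `[0%R, T]) ((\int[leb]_s (`|km u s|)%:E) * (`|psi u w|)%:E) < +oo)%E.
Hypothesis w3 : (sqint J T w < +oo)%E.

Let mpsi : measurable_fun `[0, T] (fun s : TR => psi s w).
Proof. exact: (progressive_section w (ltW T_gt0) ppsi). Qed.

Let fub := @pathwise_fubini R T km (fun s => psi s w) mkm km_out (kext_integrable Kmu_ac) mpsi w2.

Let density_eq s : 0 <= s <= T -> drift_density dKmu mu X J s w =
  \int[leb]_(u in `[0, s]) (km u s * psi u w) + J s w.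
Proof.
move=> /andP[_ sT]; congr (_ + _); apply: eq_Rintegral => u.
by rewrite mem_setE in_itv/= => /andP[u0 us]; rewrite /km kext_in.
Qed.

(** The L1 counterpart of [ae_sqint_diagonal]: the section at [T] minus a primitive that the
    pathwise Fubini theorem shows to be integrable. *)
Lemma path_diagonal_integrable : leb.-integrable `[0, T] (fun s => (Kmu s s * psi s w)%:E).
Proof.
have i1 : leb.-integrable `[0, T] (fun s => (Kmu s T * psi s w)%:E).
  apply/integrableP; split => //.
  apply/measurable_EFinP; have m1 := progressive_kernelM ppsi (measurable_kext2 T Kmu_meas).
  apply: eq_measurable_fun (progressive_section w (ltW T_gt0) m1) => s.
  by rewrite inE/= in_itv/= => /andP[s0 sT]; rewrite kext_in.
have [i2 _] := fub T0T.
have := integrableB (mI T) i1 i2; apply: eq_integrable => // s.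
rewrite mem_setE in_itv/= => /andP[s0 sT].
by rewrite -EFinB (kernel_primitive_kext Kmu_ac)//; congr EFin; ring.
Qed.

Lemma path_inner_limit_integrable : leb.-integrable `[0, T] (EFin \o J ^~ w).
Proof.
apply: (integrable_sqr (mI T)) => //.
  by rewrite lebesgue_measure_itv/=; case: ifP => _; rewrite ltry.
exact: (progressive_section w (ltW T_gt0) pJ).
Qed.

Let path_inner_integrable : leb.-integrable `[0, T]
  (fun s => (\int[leb]_(u in `[0, s]) (km u s * psi u w))%:E).
Proof. exact: (pathwise_inner_primitive_integrable mkm km_out (kext_integrable Kmu_ac) mpsi w2). Qed.

Lemma path_density_integrable : leb.-integrable `[0, T]
  (EFin \o (fun s => drift_density dKmu mu X J s w)).
Proof.
have := integrableD (mI T) path_inner_integrable path_inner_limit_integrable.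
apply: eq_integrable => // s; rewrite mem_setE in_itv/= => sT.
by rewrite density_eq.
Qed.

Lemma path_inner_density_integrable : {ae leb, forall s, 0 <= s <= T ->
  leb.-integrable `[0, s] (fun u => (dKmu u s * psi u w)%:E)}.
Proof.
apply: ae_mono (pathwise_inner_integrable mkm (kext_integrable Kmu_ac) mpsi w2) => s hs sT.
apply: eq_integrable (hs sT) => //.
by move=> u; rewrite mem_setE in_itv/= => /andP[u0 us]; rewrite /km kext_in//; case/andP: sT.
Qed.

(** Pathwise Fubini folds the diagonal term and the derivative term back into the kernel with second
    argument [t], leaving the same drift integral as in the equation. *)
Lemma path_drift t : 0 <= t <= T -> drift Kmu dKmu mu X J t w =
  \int[leb]_(s in `[0, t]) (Kmu s t * psi s w) + \int[leb]_(s in `[0, t]) J s w.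
Proof.
move=> t0T; have /andP[t0 tT] := t0T.
have sub : `[0, t]%classic `<=` `[0, T]%classic.
  by move=> u /=; rewrite !in_itv/= => /andP[-> /le_trans ->].
have [i2 e2] := fub t0T.
have iD := integrableS (mI T) (mI t) sub path_diagonal_integrable.
have iJ := integrableS (mI T) (mI t) sub path_inner_limit_integrable.
have iI := integrableS (mI T) (mI t) sub path_inner_integrable.
rewrite /drift.
have -> : \int[leb]_(s in `[0, t]) drift_density dKmu mu X J s w =
    \int[leb]_(s in `[0, t]) \int[leb]_(u in `[0, s]) (km u s * psi u w) +
    \int[leb]_(s in `[0, t]) J s w.
  rewrite -(RintegralD (mI t) iI iJ); apply: eq_Rintegral => s.
  rewrite mem_setE in_itv/= => /andP[s0 st].
  by rewrite density_eq// s0 (le_trans st).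
have e : \int[leb]_(s in `[0, t]) (Kmu s s * psi s w) +
    \int[leb]_(s in `[0, t]) (kernel_primitive km t s * psi s w) =
    \int[leb]_(s in `[0, t]) (Kmu s t * psi s w).
  rewrite -RintegralD//; apply: eq_Rintegral => s; rewrite mem_setE in_itv/= => /andP[s0 st].
  by rewrite (kernel_primitive_kext Kmu_ac)//; ring.
by rewrite addrA e2 e.
Qed.

End path.

Lemma ae_drift_well_defined : drift_well_defined P T Kmu dKmu mu X J.
Proof.
apply: ae_mono ae_paths => w [w1 w2 w3]; split.
- exact: path_diagonal_integrable.
- exact: path_inner_density_integrable.
- exact: path_density_integrable.
Qed.

Let progressive_density : progressive F T (drift_density dKmu mu X J).
Proof.
apply: progressiveD => // u /andP[u0 uT].
have pm : progressive F T (fun s w => psi s w) by [].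
have mf : @measurable_fun _ _ (R * (R * g_sigma_algebraType (F u)))%type _
   (`[0, u] `*` (`[0, u] `*` setT)) (fun p => (km p.1 p.2.1 * psi p.1 p.2.2)%:E).
  have mX : measurable (`[0, u] `*` (`[0, u] `*` setT) : set (R * (R * g_sigma_algebraType (F u)))).
    by apply: measurableX => //; exact: measurableX.
  apply/measurable_EFinP; apply: measurable_funM.
    apply: measurable_funTS.
    apply: (measurableT_comp (g := fun p : R * (R * g_sigma_algebraType (F u)) => (p.1, p.2.1)) mkm).
    apply: measurable_fun_pair; first exact: measurable_fst.
    exact: (measurableT_comp (@measurable_fst _ _ _ _) (@measurable_snd _ _ _ _)).
  apply: (@measurable_comp _ _ _ _ _ _ (`[0, u] `*` setT)
    (fun p : R * g_sigma_algebraType (F u) => psi p.1 p.2) _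
    (fun p : R * (R * g_sigma_algebraType (F u)) => (p.1, p.2.2))).
  - by apply: measurableX; [exact: mI|].
  - by move=> _ [[a [b w]] /= [am _] <-].
  - by apply: pm; rewrite u0.
  - apply: measurable_funTS; apply/measurable_fun_pairP; split => /=; first exact: measurable_fst.
    exact: (measurableT_comp (@measurable_snd _ _ _ _) (@measurable_snd _ _ _ _)).
have mQ := @measurable_moving_integral R _ (g_sigma_algebraType (F u)) u
  (fun r s w => (km r s * psi r w)%:E) mf.
apply: (eq_measurable_fun (fun q : R * g_sigma_algebraType (F u) =>
  fine (\int[leb]_(r in `[0%R, q.1]) (km r q.1 * psi r q.2)%:E)%E)); last first.
  by apply: measurableT_comp.
move=> [s w]; rewrite inE/= in_itv/= => -[/andP[s0 su] _].
congr fine; apply: eq_integral => r; rewrite mem_setE in_itv/= => /andP[r0 rs].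
by rewrite /km kext_in// (le_trans su).
Qed.

Lemma drift_finite_variation : finite_variation_process P F T (drift Kmu dKmu mu X J).
Proof.
have aw f t : 0 <= t <= T -> progressive F T f ->
    measurable_wrt (F t) (fun w => \int[leb]_(s in `[0, t]) f s w).
  move=> /andP[t0 tT] pf; apply: measurableT_comp => //.
  apply: (@measurable_integral_progressive R d Omega F (fun s w => (f s w)%:E)) => //.
  by apply/measurable_EFinP; apply: pf; rewrite t0.
have pK : progressive F T (fun s w => Kmu s s * psi s w).
  apply: progressive_eq (progressive_kernelM ppsi (measurable_kext_diag Kmu_meas)) => s w /andP[s0 sT].
  by rewrite kext_in.
split.
- by move=> t t0T; apply: measurable_funD; exact: aw.
- apply: ae_mono ae_paths => w [w1 w2 w3]; apply: within_continuous_cadlag.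
  apply/subspace_continuousP => x xT; apply: cvgD.
    have := continuous_primitive T_gt0 (path_diagonal_integrable w1 w2).
    by move=> /subspace_continuousP; exact.
  have := continuous_primitive T_gt0 (path_density_integrable w2 w3).
  by move=> /subspace_continuousP; exact.
- apply: ae_mono ae_paths => w [w1 w2 w3]; apply: (bounded_variationD T_gt0).
    exact: (primitive_bounded_variation T_gt0 (path_diagonal_integrable w1 w2)).
  exact: (primitive_bounded_variation T_gt0 (path_density_integrable w2 w3)).
Qed.

(** The diagonal kernel plus the primitive up to [t] is [Ks s t], so by uniqueness of the Ito
    integral the stochastic term of the equation at time [t] is [M t] plus the time integral of the
    inner integral. *)
Lemma solution_decomposition M t : ito_integral_process P F T B H M -> 0 <= t <= T ->
  {ae P, forall w, X t w - x0 t = M t w + drift Kmu dKmu mu X J t w}.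
Proof.
move=> [_ iM] t0T; have /andP[t0 tT] := t0T.
have [_ _ /(_ t t0T)[_ [I [iI eX]]]] := sol.
have iS := ito_add usual bm 1 t0T (iM t t0T) (primitive_ito t0T).
have eI : {ae P, forall w, I w = M t w + 1 * \int[leb]_(s in `[0, t]) J s w}.
  apply: (ito_unique usual bm t0T iI); apply: (ito_eq t0T iS) => s w /andP[s0 st].
  by rewrite (kernel_primitive_kext Ks_ac)// /H; ring.
have h := ae_mono2 (C := fun w => _ /\ _) (fun w a b => conj a b) eX eI.
apply: ae_mono2 h ae_paths => w [eXw eIw] [w1 w2 w3].
by rewrite (path_drift w1 w2 w3)// eXw eIw; ring.
Qed.

End construction.

Lemma volterra_semimartingale : exists M J : R -> Omega -> R,
    [/\ ito_integral_process P F T B H M,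
        inner_ito_integral P F T B dKs sg X J,
        drift_well_defined P T Kmu dKmu mu X J &
        semimartingale_decomposition P F T
          (fun t w => X t w - x0 t) M (drift Kmu dKmu mu X J)].
Proof.
have [N NH] := cell_processes_exist T_gt0 usual bm pphi phi2 mks ks_L2.
have [ni [niE niS]] := kernel_avg_subsequence T_gt0 mks ks_out ks_L2.
have fH := ae_sqint_diagonal NH niE niS.
have [M MH] := ito_process_exists T_gt0 usual bm pH fH.
exists M, (inner_limit T N ni); split => //.
- exact: inner_limit_is_inner_ito_integral.
- exact: ae_drift_well_defined.
split.
- exact: (ito_local_martingale T_gt0 usual bm pH fH MH).
- exact: drift_finite_variation.
- by move=> t t0T; exact: (solution_decomposition NH niE niS MH t0T).
Qed.

End volterra.

Theorem lemma3p6 (R : realType) (d : measure_display)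
    (Omega : measurableType d) (P : probability Omega R)
    (T : R) (F : R -> set_system Omega) (B : R -> Omega -> R)
    (x0 : R -> R) (Kmu dKmu Ksigma dKsigma mu sigma : R -> R -> R)
    (X : R -> Omega -> R)
    (T_gt0 : 0 < T)
    (F_usual : usual_conditions P F T)
    (B_brownian : brownian_motion P F T B)
    (x0_continuous : {within `[0, T], continuous x0})
    (Kmu_measurable : measurable_on_triangle T Kmu)
    (Ksigma_measurable : measurable_on_triangle T Ksigma)
    (Kmu_ac : abs_continuous_kernel T Kmu dKmu)
    (dKmu_L1 : in_Lp_triangle 1 T dKmu)
    (Ksigma_ac : abs_continuous_kernel T Ksigma dKsigma)
    (dKsigma_L2 : in_Lp_triangle 2 T dKsigma)
    (mu_measurable :
      measurable_fun (`[0, T] `*` setT) (fun p : R * R => mu p.1 p.2))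
    (sigma_measurable :
      measurable_fun (`[0, T] `*` setT) (fun p : R * R => sigma p.1 p.2))
    (linear_growth : exists2 C : R, 0 < C &
      forall t x : R, 0 <= t <= T ->
        `|mu t x| + `|sigma t x| <= C * (1 + `|x|))
    (X_solution : volterra_solution P F T B x0 Kmu Ksigma mu sigma X)
    (X_moment : exists C : R, forall t : R, 0 <= t <= T ->
      ('E_P[fun w => (`|X t w| ^+ 2)%R] <= C%:E)%E) :
  exists M J : R -> Omega -> R,
    [/\ ito_integral_process P F T B
          (fun s w => Ksigma s s * sigma s (X s w)) M,
        inner_ito_integral P F T B dKsigma sigma X J,
        drift_well_defined P T Kmu dKmu mu X J &
        semimartingale_decomposition P F T
          (fun t w => X t w - x0 t) M (drift Kmu dKmu mu X J)].
Proof.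
have [C C0 growth] := linear_growth; have [m X2] := X_moment.
have [pX _ _] := X_solution.
have pmu := progressive_comp mu_measurable pX.
have psigma := progressive_comp sigma_measurable pX.
have mY (Y : R -> Omega -> R) t : 0 <= t <= T -> progressive F T Y -> measurable_fun setT (Y t).
  by move=> t0T pY; exact: (measurable_wrt_ambient F_usual t0T (progressive_at t0T pY)).
apply: (@volterra_semimartingale R d Omega P T F B T_gt0 F_usual B_brownian x0
  Kmu dKmu Ksigma dKsigma mu sigma X Kmu_measurable Ksigma_measurable Kmu_ac dKmu_L1
  Ksigma_ac dKsigma_L2 X_solution (2 * C * (1 + m)) (2 * C ^+ 2 * (1 + m)) pmu psigma) => s sT.
- apply: (linear_growth_L1 (mY _ _ sT pX) (mY _ _ sT pmu) (X2 s sT)) (ltW C0) => w.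
  by apply: le_trans (growth _ _ sT); rewrite lerDl.
- apply: (linear_growth_L2 (mY _ _ sT pX) (mY _ _ sT psigma) (X2 s sT)) => w.
  by apply: le_trans (growth _ _ sT); rewrite lerDr.
Qed.
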